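(* The complexity of a viewshed in a 2.5D terrain is $O(n\cdot \pi(T))$; that is, for a 2.5D terrain $T$ with $n$ vertices and prickliness $\pi(T)$ and a viewpoint $p$, the viewshed of $p$ on $T$ has complexity $O(n\cdot\pi(T))$.
   Context: A 2.5D terrain (TIN) $T$ is a triangulated $xy$-monotone polyhedral surface in $\mathbb{R}^3$; two vertices are neighbors if they are joined by an edge of the triangulation. A vertex is internal if it is not on the boundary of the triangulation (not incident to the unbounded face of the triangulation projected to the $xy$-plane). A vertex $v$ is convex if there is a non-vertical plane through $v$ that leaves all neighboring points of $v$ on $T$ below it. For a vector $\vec w\in\mathbb{R}^3$, a vertex $v$ is a local maximum of $T$ in direction $\vec w$ if $\langle v,\vec w\rangle > \langle u,\vec w\rangle$ for every neighbor $u$ of $v$. Let $\pi_{\vec w}(T)$ be the number of internal and convex vertices of $T$ that are local maxima of $T$ in direction $\vec w$. The prickliness of $T$ is $\pi(T)=\max_{\vec w}\pi_{\vec w}(T)$ (equivalently, the maximum over all invertible affine transformations $A$ of $\mathbb{R}^3$ of the number of internal and convex vertices of $T$ that are local maxima, in the vertical direction, of $A(T)$). Two points on or above $T$ are mutually visible if the segment joining them does not intersect the interior of the terrain (the region strictly below $T$). The viewshed of a viewpoint $p$ is the set of all points of $T$ visible from $p$. The viewshed is a union of parts of triangles of $T$, viewed as a set of polygons; its complexity is the total number of vertices of these polygons.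
   Formalization: The projected triangulation is required to cover the convex hull of its vertices (over non-convex domains the bound can fail), and the bound proved is O(n·max(1, π(T))), since O(n·π(T)) fails when π(T)=0, e.g. for a single triangle. *)

(* Defs.v *)
From HB Require Import structures.
From mathcomp Require Import all_boot all_order all_algebra.
From mathcomp Require Import all_classical all_reals all_analysis.

Set Implicit Arguments.
Unset Strict Implicit.
Unset Printing Implicit Defensive.

Import Order.TTheory GRing.Theory Num.Theory numFieldNormedType.Exports.

Local Open Scope classical_set_scope.
Local Open Scope ring_scope.

Definition dot (R : realType) (d : nat) (u v : 'rV[R]_d) : R :=
  \sum_(i < d) u 0 i * v 0 i.

Definition xy (R : realType) (q : 'rV[R]_3) : 'rV[R]_2 :=
  lsubmx (q : 'rV[R]_(2 + 1)).
Arguments xy {R} q.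

Definition zcoord (R : realType) (q : 'rV[R]_3) : R := q 0 ord_max.

Definition hull (R : realType) (n d : nat) (P : 'I_n -> 'rV[R]_d)
    (S : {set 'I_n}) : set 'rV[R]_d :=
  [set q | exists c : 'I_n -> R,
     [/\ forall i, 0 <= c i, forall i, i \notin S -> c i = 0,
         \sum_(i < n) c i = 1 & q = \sum_(i < n) c i *: P i]].

Definition affinely_independent (R : realType) (n d : nat)
    (P : 'I_n -> 'rV[R]_d) (S : {set 'I_n}) : Prop :=
  forall c : 'I_n -> R, (forall i, i \notin S -> c i = 0) ->
    \sum_(i < n) c i = 0 -> \sum_(i < n) c i *: P i = 0 ->
    forall i, c i = 0.

(* A TIN with [n] vertices is given by its vertices in space and a family of
   vertex triples whose projections triangulate the projected vertex set, in
   the usual sense for point sets: the triangles cover the convex hull of the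
   projected vertices, so the unbounded face is the complement of that hull.
   xy-monotonicity of the surface is forced by conditions on the projection. *)
Record terrain (R : realType) (n : nat) := Terrain {
  vtx : 'I_n -> 'rV[R]_3 ;
  tri : {set {set 'I_n}} ;
  tri_card : forall t, t \in tri -> #|t| = 3%N ;
  tri_indep : forall t, t \in tri -> affinely_independent (xy \o vtx) t ;
  tri_meet : forall s t, s \in tri -> t \in tri ->
    hull (xy \o vtx) s `&` hull (xy \o vtx) t `<=`
    hull (xy \o vtx) (s :&: t)%SET ;
  tri_vertex : forall t v, t \in tri -> hull (xy \o vtx) t (xy (vtx v)) ->
    v \in t ;
  tri_cover : hull (xy \o vtx) [set: 'I_n]%SET `<=`
    \bigcup_(t in [set` tri]) hull (xy \o vtx) t }.

Definition facet (R : realType) (n : nat) (T : terrain R n)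
    (t : {set 'I_n}) : set 'rV[R]_3 := hull (vtx T) t.

Definition surface (R : realType) (n : nat) (T : terrain R n) :
    set 'rV[R]_3 := \bigcup_(t in [set` tri T]) facet T t.

Definition domain (R : realType) (n : nat) (T : terrain R n) :
    set 'rV[R]_2 := [set xy q | q in surface T].

Definition neighbor (R : realType) (n : nat) (T : terrain R n)
    (u v : 'I_n) : Prop :=
  u != v /\ exists t, [/\ t \in tri T, u \in t & v \in t].

(* [~` domain T] is the unbounded face of the projected triangulation. *)
Definition internal_vertex (R : realType) (n : nat) (T : terrain R n)
    (v : 'I_n) : Prop := ~ closure (~` domain T) (xy (vtx T v)).

(* The non-vertical plane through v is the graph of
   q |-> zcoord v + dot a (q - xy v). *)
Definition convex_vertex (R : realType) (n : nat) (T : terrain R n)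
    (v : 'I_n) : Prop :=
  exists a : 'rV[R]_2, forall u, neighbor T u v ->
    zcoord (vtx T u) <
    zcoord (vtx T v) + dot a (xy (vtx T u) - xy (vtx T v)).

Definition local_max (R : realType) (n : nat) (T : terrain R n)
    (w : 'rV[R]_3) (v : 'I_n) : Prop :=
  forall u, neighbor T u v -> dot (vtx T u) w < dot (vtx T v) w.

Definition prickliness_in (R : realType) (n : nat) (T : terrain R n)
    (w : 'rV[R]_3) : nat :=
  #|[set v : 'I_n |
     `[< [/\ internal_vertex T v, convex_vertex T v & local_max T w v] >]]%SET|.

(* The values of [prickliness_in T] lie in {0, ..., n}. *)
Definition prickliness (R : realType) (n : nat) (T : terrain R n) : nat :=
  (\max_(k < n.+1 | `[< exists w, prickliness_in T w = k >]) k)%N.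

Definition strictly_below (R : realType) (n : nat) (T : terrain R n) :
    set 'rV[R]_3 :=
  [set q | exists2 r, surface T r & xy r = xy q /\ zcoord q < zcoord r].

Definition on_or_above (R : realType) (n : nat) (T : terrain R n) :
    set 'rV[R]_3 :=
  [set q | exists2 r, surface T r & xy r = xy q /\ zcoord r <= zcoord q].

Definition visible (R : realType) (n : nat) (T : terrain R n)
    (p q : 'rV[R]_3) : Prop :=
  forall s : R, 0 <= s <= 1 -> ~ strictly_below T (p + s *: (q - p)).

Definition viewshed (R : realType) (n : nat) (T : terrain R n)
    (p : 'rV[R]_3) : set 'rV[R]_3 := surface T `&` visible T p.

(* The polygons forming the viewshed are planar, so they are taken triangle by
   triangle. On a triangle [xy] is an injective affine map, hence it carries
   polygons to polygons and vertices to vertices, and polygons are described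
   through their projections. *)
Definition visible_part (R : realType) (n : nat) (T : terrain R n)
    (p : 'rV[R]_3) (t : {set 'I_n}) : set 'rV[R]_2 :=
  [set xy q | q in viewshed T p `&` facet T t].

(* Passing to the interior discards the isolated points and segments that a
   degenerate position of the viewpoint may leave; polygons may have holes. *)
Definition viewshed_polygons (R : realType) (n : nat) (T : terrain R n)
    (p : 'rV[R]_3) (t : {set 'I_n}) : set (set 'rV[R]_2) :=
  [set closure (connected_component (interior (visible_part T p t)) x)
     | x in interior (visible_part T p t)].

(* Near x, Q is a closed half-plane bounded by a line through x, or, if a = 0,
   everything. *)
Definition locally_straight (R : realType) (Q : set 'rV[R]_2)
    (x : 'rV[R]_2) : Prop :=
  exists a : 'rV[R]_2, \forall y \near x, Q y <-> 0 <= dot a (y - x).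

Definition polygon_vertex (R : realType) (Q : set 'rV[R]_2)
    (x : 'rV[R]_2) : Prop := Q x /\ ~ locally_straight Q x.

(* A point that is a vertex of several polygons is counted once for each.
   The value is +oo if there are infinitely many vertices. *)
Definition viewshed_complexity (R : realType) (n : nat) (T : terrain R n)
    (p : 'rV[R]_3) : \bar R :=
  counting [set u : {set 'I_n} * set 'rV[R]_2 * 'rV[R]_2 |
    [/\ u.1.1 \in tri T, viewshed_polygons T p u.1.1 u.1.2 &
        polygon_vertex u.1.2 u.2]].

(* Main.v *)
(* Put the viewpoint at the origin. A point of a triangle [t] is hidden exactly
   when an edge, seen from the viewpoint, passes strictly above it, so the
   visible part of [t] is a closed set cut out by finitely many lines. At a
   vertex of one of its polygons two boundary directions are not parallel, and
   each of them runs along an edge of [t] or along the shadow of an edge on [t].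
   In the line of sight of such a vertex, one of the two edges, namely the
   farther one for two shadows and the edge of [t] otherwise, starts or stops
   being visible. This start of visibility, a [germ], determines the vertex and
   its polygon up to the choice of a triangle containing the edge, so it remains
   to count germs.

   Between consecutive germs of an edge [e] there is a hidden point lying between
   two visible ones. The terrain above the plane through the viewpoint and [e],
   inside the triangle spanned by the viewpoint and the two visible points, has a
   maximum relative to a generic perturbation of this plane. It is an internal
   convex vertex, and a local maximum in the normal direction, which is the same
   for all gaps of [e]. Hence [e] has at most [prickliness T + 1] germs. There
   are at most [2 n] triangles, since a triangle is determined by its middle
   vertex in a generic direction and the side on which it continues. *)

(* Germs are directed: each edge is taken with both orders of its endpoints, and visibility that
   stops in one order starts in the other.

   A shadow is charged only on a triangle whose plane passes strictly below the viewpoint. On such a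
   plane a line of sight descends through the triangle, so just after a germ only one triangle can
   carry the visible shadow of the edge; this is why the edge and its germ fix the triangle as well.
   If the plane of the triangle contains the viewpoint, all shadows on it run along lines of sight.
   Two of them are parallel at a common point, so every vertex there involves a side of the
   triangle, which is charged instead.

   An edge whose line projects through the viewpoint spans a vertical plane with it, and heights
   above that plane make no sense. Such an edge has no gaps at all, by an argument inside this
   plane.

   The perturbation of the plane of an edge makes the relative heights of all vertices distinct, yet
   is too small to move the maximum to the boundary of its triangle.

   Near a given point, the visible part is described by signs of finitely many affine functions, so
   it looks like a cone there; all local arguments rest on this. *)
Require Import Defs.
From HB Require Import structures.
From mathcomp Require Import all_boot all_order all_algebra.
From mathcomp Require Import finmap.
From mathcomp Require Import all_classical all_reals all_analysis.
From mathcomp Require Import ring lra.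

Set Implicit Arguments.
Unset Strict Implicit.
Unset Printing Implicit Defensive.

Import Order.TTheory GRing.Theory Num.Theory numFieldNormedType.Exports.

Local Open Scope classical_set_scope.
Local Open Scope ring_scope.

(** * Plane geometry and barycentric coordinates *)

Section Plane.
Variable R : realType.
Implicit Types (u v w x y : 'rV[R]_2) (k : R).

Definition cross u v : R := u 0 0 * v 0 1 - u 0 1 * v 0 0.

Definition perp u : 'rV[R]_2 := \row_j (if j == 0 then - u 0 1 else u 0 0).

Lemma perpE u : (perp u 0 0 = - u 0 1) * (perp u 0 1 = u 0 0).
Proof. by rewrite !mxE. Qed.

Lemma addvE u v i : (u + v) 0 i = u 0 i + v 0 i. Proof. by rewrite mxE. Qed.
Lemma oppvE u i : (- u) 0 i = - u 0 i. Proof. by rewrite mxE. Qed.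
Lemma scalevE k u i : (k *: u) 0 i = k * u 0 i. Proof. by rewrite mxE. Qed.
Lemma zerovE i : (0 : 'rV[R]_2) 0 i = 0. Proof. by rewrite mxE. Qed.

Definition vE := (addvE, oppvE, scalevE, zerovE, perpE).

Lemma crossC u v : cross v u = - cross u v.
Proof. by rewrite /cross; ring. Qed.

Lemma cross0l u : cross 0 u = 0.
Proof. by rewrite /cross !vE !mul0r subrr. Qed.

Lemma vecP u v : u 0 0 = v 0 0 -> u 0 1 = v 0 1 -> u = v.
Proof.
move=> h0 h1; apply/rowP => j; case: j => [[|[|//]] i].
  by rewrite (_ : Ordinal i = 0) //; apply/val_inj.
by rewrite (_ : Ordinal i = 1) //; apply/val_inj.
Qed.

Lemma vec_neq0 u : u != 0 -> u 0 0 != 0 \/ u 0 1 != 0.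
Proof.
case: (eqVneq (u 0 0) 0) => [h0|]; last by left.
case: (eqVneq (u 0 1) 0) => [h1|]; last by right.
by rewrite (_ : u = 0) ?eqxx //; apply: vecP; rewrite ?vE.
Qed.

Lemma dotE u v : dot u v = u 0 0 * v 0 0 + u 0 1 * v 0 1.
Proof.
rewrite /dot big_ord_recl big_ord1 (_ : lift ord0 ord0 = 1) //.
exact/val_inj.
Qed.

Lemma cramer u v x : cross u v != 0 ->
  x = (cross x v / cross u v) *: u + (cross u x / cross u v) *: v.
Proof.
move=> h; apply: vecP; rewrite !vE; move: h; rewrite /cross => h; by field.
Qed.

Lemma cross_perp u : u != 0 -> 0 < cross u (perp u).
Proof.
move=> /vec_neq0 h; rewrite /cross !vE.
case: h => h; have : 0 < u 0 0 ^+ 2 \/ 0 < u 0 1 ^+ 2.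
- by left; rewrite exprn_even_gt0.
- by case=> ?; nra.
- by right; rewrite exprn_even_gt0.
- by case=> ?; nra.
Qed.

Lemma parallel u v : u != 0 -> cross u v = 0 -> exists c, v = c *: u.
Proof.
move=> /vec_neq0 [] h e.
- exists (v 0 0 / u 0 0); apply: vecP; rewrite !vE; first by field.
  move: e; rewrite /cross => /eqP; rewrite subr_eq0 => /eqP e.
  by apply: (mulfI h); rewrite e; field.
- exists (v 0 1 / u 0 1); apply: vecP; rewrite !vE; last by field.
  move: e; rewrite /cross => /eqP; rewrite subr_eq0 => /eqP e.
  by apply: (mulfI h); rewrite -e; field.
Qed.

Definition affine (f : 'rV[R]_2 -> R) :=
  exists a b, forall x, f x = dot a x + b.

Lemma affine_cst k : affine (fun=> k).
Proof. by exists 0, k => x; rewrite dotE !vE; ring. Qed.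

Lemma affineD f g : affine f -> affine g -> affine (fun x => f x + g x).
Proof.
move=> [a [b fE]] [c [d gE]]; exists (a + c), (b + d) => x.
by rewrite fE gE !dotE !vE; ring.
Qed.

Lemma affineM f k : affine f -> affine (fun x => f x * k).
Proof.
move=> [a [b fE]]; exists (k *: a), (b * k) => x.
by rewrite fE !dotE !vE; ring.
Qed.

Lemma affineB f g : affine f -> affine g -> affine (fun x => f x - g x).
Proof.
move=> hf hg; have := affineD hf (affineM (-1) hg).
by under [X in affine X -> _]eq_fun do rewrite mulrN1.
Qed.

Lemma affine_sum n (f : 'I_n -> 'rV[R]_2 -> R) :
  (forall i, affine (f i)) -> affine (fun x => \sum_i f i x).
Proof.
move=> hf; elim: n f hf => [|n ih] f hf.
  under eq_fun do rewrite big_ord0; exact: affine_cst.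
under eq_fun do rewrite big_ord_recl.
by apply: affineD => //; apply: ih.
Qed.

Lemma affine_comp f y : affine f -> affine (fun x => f (y + x)).
Proof.
move=> [a [b fE]]; exists a, (dot a y + b) => x.
by rewrite fE !dotE !vE; ring.
Qed.

Lemma affine_sub f y : affine f -> affine (fun x => f (x - y)).
Proof.
move=> [a [b fE]]; exists a, (b - dot a y) => x.
by rewrite fE !dotE !vE; ring.
Qed.

Lemma affine_dot a : affine (dot a).
Proof. by exists a, 0 => x; rewrite addr0. Qed.

Lemma affine_crossl v : affine (cross ^~ v).
Proof.
exists (- perp v), 0 => x; rewrite dotE !vE /cross; ring.
Qed.

Lemma affine_crossr v : affine (cross v).
Proof. exists (perp v), 0 => x; rewrite dotE !vE /cross; ring. Qed.

Lemma affine_line f x u k : affine f ->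
  f (x + k *: u) = f x + k * (f (x + u) - f x).
Proof. by move=> [a [b fE]]; rewrite !fE !dotE !vE; ring. Qed.

Lemma affine_conv f x y k : affine f ->
  f ((1 - k) *: x + k *: y) = (1 - k) * f x + k * f y.
Proof. by move=> [a [b fE]]; rewrite !fE !dotE !vE; ring. Qed.

Lemma affine_scale f x k : affine f -> f (k *: x) = f 0 + k * (f x - f 0).
Proof. by move=> [a [b fE]]; rewrite !fE !dotE !vE; ring. Qed.

Lemma affine_continuous f : affine f -> continuous f.
Proof.
move=> [a [b fE]]; have -> : f = fun x => a 0 0 * x 0 0 + a 0 1 * x 0 1 + b.
  by apply/funext => x; rewrite fE dotE.
move=> x.
have c0 := @coord_continuous R 1 2 0 0 x.
have c1 := @coord_continuous R 1 2 0 1 x.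
apply: (@cvgD _ _ _ (nbhs x) _ (fun x : 'rV[R]_2 => a 0 0 * x 0 0 + a 0 1 * x 0 1)
  (fun=> b)); last exact: cvg_cst.
by apply: (@cvgD _ _ _ (nbhs x) _ (fun x : 'rV[R]_2 => a 0 0 * x 0 0)
  (fun x : 'rV[R]_2 => a 0 1 * x 0 1)); exact: cvgMl_tmp.
Qed.

End Plane.

Section Barycentric.
Variables (R : realType) (n : nat) (P : 'I_n -> 'rV[R]_2).

Lemma sum3 (V : nmodType) (a b c : 'I_n) (f : 'I_n -> V) :
  a != b -> a != c -> b != c ->
  (forall i, i != a -> i != b -> i != c -> f i = 0) ->
  \sum_i f i = f a + f b + f c.
Proof.
move=> ab ac bc h; rewrite (bigD1 a) //= (bigD1 b) ?[b == a]eq_sym //=.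
rewrite (bigD1 c) ?[c == _]eq_sym ?ac ?bc //= big1 ?addr0 ?addrA //.
by move=> i /andP[/andP[? ?] ?]; exact: h.
Qed.

Lemma set3P (S : {set 'I_n}) : #|S| = 3%N ->
  exists a b c, [/\ a != b, a != c, b != c & S = [set a; b; c]%SET].
Proof.
move=> /eqP; rewrite cardE => h.
have : uniq (enum S) by exact: enum_uniq.
have : forall i, (i \in S) = (i \in enum S) by move=> i; rewrite mem_enum.
move: (enum S) h => [|a [|b [|c [|]]]] // _ hS /=.
rewrite !inE !negb_or => /and3P[/andP[ab ac] bc _].
exists a, b, c; split=> //; apply/setP => i.
by rewrite hS !inE -orbA.
Qed.

Lemma affinely_independent_cross a b c : a != b -> a != c -> b != c ->
  affinely_independent P [set a; b; c]%SET ->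
  cross (P b - P a) (P c - P a) != 0.
Proof.
move=> ab ac bc ind; apply/eqP => h.
have ba : b == a = false by rewrite eq_sym (negbTE ab).
have ca : c == a = false by rewrite eq_sym (negbTE ac).
have cb : c == b = false by rewrite eq_sym (negbTE bc).
have key al be ga : al + be + ga = 0 ->
    al *: P a + be *: P b + ga *: P c = 0 -> be = 0 /\ ga = 0.
  move=> h1 h2.
  pose f i := if i == a then al else if i == b then be
              else if i == c then ga else 0.
  have fa : f a = al by rewrite /f eqxx.
  have fb : f b = be by rewrite /f ba eqxx.
  have fc : f c = ga by rewrite /f ca cb eqxx.
  have f0 i : i != a -> i != b -> i != c -> f i = 0.
    by rewrite /f => /negbTE -> /negbTE -> /negbTE ->.
  have s1 : \sum_i f i = 0 by rewrite (sum3 ab ac bc f0) fa fb fc.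
  have s2 : \sum_i f i *: P i = 0.
    rewrite (sum3 ab ac bc) ?fa ?fb ?fc // => i *; by rewrite f0 // scale0r.
  have h3 : forall i, f i = 0.
    apply: ind => // i.
    by rewrite !inE !negb_or => /andP[/andP[? ?] ?]; exact: f0.
  by rewrite -fb -fc !h3.
set u := P b - P a in h; set v := P c - P a in h.
(* If the cross product vanishes, [- v 0 0 *: u + u 0 0 *: v] is zero in both coordinates, and this
   is an affine dependence of the three points. The same with the other coordinate leaves
   [u = 0]. *)
have k0 : - v 0 0 = 0 /\ u 0 0 = 0.
  apply: (key (v 0 0 - u 0 0)); first by ring.
  apply: vecP; rewrite !vE; first by rewrite /u /v ?vE; ring.
  by rewrite -h /cross /u /v ?vE; ring.
have k1 : - v 0 1 = 0 /\ u 0 1 = 0.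
  apply: (key (v 0 1 - u 0 1)); first by ring.
  apply: vecP; rewrite !vE; last by rewrite /u /v ?vE; ring.
  by rewrite -[RHS]oppr0 -h /cross /u /v ?vE; ring.
have u0 : u = 0 by apply: vecP; rewrite vE; [case: k0|case: k1].
have [|//|/eqP] := key (-1) 1 0; first by ring.
- by rewrite scale0r addr0 scale1r scaleN1r addrC.
- by rewrite oner_eq0.
Qed.

(** The weights are affine on the whole plane and vanish identically off [S], so later sums range
    over all vertices and extend beyond the triangle. *)
Lemma barycentric_exists (S : {set 'I_n}) : #|S| = 3%N ->
  affinely_independent P S ->
  exists g : 'I_n -> 'rV[R]_2 -> R,
    [/\ forall i, affine (g i), forall i x, i \notin S -> g i x = 0,
        forall x, \sum_i g i x = 1 & forall x, \sum_i g i x *: P i = x].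
Proof.
move=> /set3P[a [b [c [ab ac bc ->]]]] ind.
have D0 := affinely_independent_cross ab ac bc ind.
have ba : b == a = false by rewrite eq_sym (negbTE ab).
have ca : c == a = false by rewrite eq_sym (negbTE ac).
have cb : c == b = false by rewrite eq_sym (negbTE bc).
set D := cross (P b - P a) (P c - P a) in D0.
pose gb x := cross (x - P a) (P c - P a) * D^-1.
pose gc x := cross (P b - P a) (x - P a) * D^-1.
pose g i x := if i == a then 1 - gb x - gc x else if i == b then gb x
            else if i == c then gc x else 0.
have ab' : affine gb.
  by apply: affineM; apply: affine_sub (affine_crossl (P c - P a)).
have ac' : affine gc.
  by apply: affineM; apply: affine_sub (affine_crossr (P b - P a)).
have ga x : g a x = 1 - gb x - gc x by rewrite /g eqxx.
have gbE x : g b x = gb x by rewrite /g ba eqxx.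
have gcE x : g c x = gc x by rewrite /g ca cb eqxx.
have g0 i x : i != a -> i != b -> i != c -> g i x = 0.
  by rewrite /g => /negbTE -> /negbTE -> /negbTE ->.
exists g; split.
- move=> i; rewrite /g; case: eqP => _.
    by apply: (affineB (f := fun x => 1 - gb x)) => //; apply: affineB => //;
       exact: affine_cst.
  by case: eqP => // _; case: eqP => // _; exact: affine_cst.
- by move=> i x; rewrite !inE !negb_or => /andP[/andP[? ?] ?]; exact: g0.
- move=> x; rewrite (sum3 ab ac bc) => [|*]; last exact: g0.
  by rewrite ga gbE gcE; ring.
- move=> x; rewrite (sum3 ab ac bc) => [|*]; last by rewrite g0 // scale0r.
  rewrite ga gbE gcE; have := cramer (x - P a) D0.
  rewrite -/D -/(gb x) -/(gc x) => h.
  rewrite -[RHS](subrK (P a)) h; apply: vecP; rewrite !vE; ring.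
Qed.

End Barycentric.

(** * The terrain seen from the viewpoint *)

Lemma lift_point (R : realType) (x : 'rV[R]_2) (k : R) :
  exists q, xy q = x /\ zcoord q = k.
Proof.
exists (row_mx x (const_mx k : 'rV[R]_1)); split; first by rewrite /xy row_mxKl.
rewrite /zcoord (_ : ord_max = rshift 2 (0 : 'I_1)); last exact/val_inj.
by rewrite (row_mxEr x) mxE.
Qed.

Section Relative.
Variables (R : realType) (n : nat) (T : terrain R n) (p : 'rV[R]_3).
Implicit Types (s t : {set 'I_n}) (a b i j : 'I_n) (d x y : 'rV[R]_2).

(** The projected viewpoint becomes the origin. The lock keeps simplification from expanding
    positions into matrix entries. *)
Definition pos i : 'rV[R]_2 := locked (xy (vtx T i) - xy p).

Lemma pos_def : pos = fun i => xy (vtx T i) - xy p.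
Proof. by apply/funext => i; rewrite /pos -lock. Qed.

Definition zr i : R := zcoord (vtx T i) - zcoord p.

Lemma bc_exists t : exists g : 'I_n -> 'rV[R]_2 -> R, t \in tri T ->
  [/\ forall i, affine (g i), forall i x, i \notin t -> g i x = 0,
      forall x, \sum_i g i x = 1 & forall x, \sum_i g i x *: pos i = x].
Proof.
case: (boolP (t \in tri T)) => tT; last by exists (fun _ _ => 0).
have [g [h1 h2 h3 h4]] := barycentric_exists (tri_card tT) (tri_indep tT).
exists (fun i x => g i (xy p + x)) => _; split => //.
- by move=> i; exact: affine_comp.
- by move=> i x ti; exact: h2.
- move=> x; rewrite pos_def.
  under eq_bigr do rewrite scalerBr.
  by rewrite sumrB -scaler_suml h3 scale1r h4 addrC addKr.
Qed.

Definition bc t := sval (cid (bc_exists t)).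

Section Triangle.
Variables (t : {set 'I_n}) (tT : t \in tri T).

Lemma bc_affine i : affine (bc t i).
Proof. by have [+ _ _ _] := svalP (cid (bc_exists t)) tT; apply. Qed.

Lemma bc_out i x : i \notin t -> bc t i x = 0.
Proof. by have [_ + _ _] := svalP (cid (bc_exists t)) tT; apply. Qed.

Lemma bc_sum1 x : \sum_i bc t i x = 1.
Proof. by have [_ _ + _] := svalP (cid (bc_exists t)) tT; apply. Qed.

Lemma bc_pos x : \sum_i bc t i x *: pos i = x.
Proof. by have [_ _ _ +] := svalP (cid (bc_exists t)) tT; apply. Qed.

Lemma bc_uniq (c : 'I_n -> R) x i : (forall j, j \notin t -> c j = 0) ->
  \sum_j c j = 1 -> \sum_j c j *: pos j = x -> bc t i x = c i.
Proof.
move=> c0 c1 cx; apply/eqP; rewrite -subr_eq0; apply/eqP.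
have h := @tri_indep _ _ _ _ tT (fun j => bc t j x - c j).
apply: h.
- by move=> j jt; rewrite bc_out // c0 // subr0.
- by rewrite sumrB bc_sum1 c1 subrr.
- transitivity (\sum_j (bc t j x - c j) *: pos j).
    rewrite pos_def; under [RHS]eq_bigr do rewrite scalerBr.
    by rewrite sumrB -[X in _ - X]scaler_suml sumrB bc_sum1 c1 subrr scale0r subr0.
  under eq_bigr do rewrite scalerBl.
  by rewrite sumrB bc_pos cx subrr.
Qed.

End Triangle.

Definition inT t x := forall i, 0 <= bc t i x.
Definition hgt t x := \sum_i bc t i x * zr i.
Definition dom x := exists2 t, t \in tri T & inT t x.

Lemma hgt_affine t : t \in tri T -> affine (hgt t).
Proof.
by move=> tT; apply: affine_sum => i; apply: affineM; exact: bc_affine.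
Qed.

Lemma hull_pos (S : {set 'I_n}) x : hull (@xy R \o vtx T) S (xy p + x) <->
  exists c : 'I_n -> R, [/\ forall i, 0 <= c i, forall i, i \notin S -> c i = 0,
    \sum_i c i = 1 & \sum_i c i *: pos i = x].
Proof.
rewrite pos_def; split=> -[c [c0 cS c1 cx]]; exists c; split => //.
  under eq_bigr do rewrite scalerBr.
  by rewrite sumrB -scaler_suml c1 scale1r -cx addrC addKr.
move: cx; under eq_bigr do rewrite scalerBr.
rewrite sumrB -scaler_suml c1 scale1r => <-.
by rewrite addrC subrK.
Qed.

Lemma hull_inT t x : t \in tri T ->
  hull (@xy R \o vtx T) t (xy p + x) <-> inT t x.
Proof.
move=> tT; rewrite hull_pos; split=> [[c [c0 cS c1 cx]] i|h].
  by rewrite (bc_uniq tT i cS c1 cx).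
exists (bc t ^~ x); split => //; last exact: bc_pos.
  by move=> i; exact: bc_out.
exact: bc_sum1.
Qed.

Lemma inT_weights t (c : 'I_n -> R) : t \in tri T -> (forall i, 0 <= c i) ->
  (forall i, i \notin t -> c i = 0) -> \sum_i c i = 1 ->
  inT t (\sum_i c i *: pos i).
Proof. by move=> tT c0 ct c1 i; rewrite (bc_uniq tT i ct c1 erefl). Qed.

(** By [tri_meet] the point is a convex combination of common vertices, and both weight vectors
    coincide with that one. *)
Lemma bc_consist s t x i : s \in tri T -> t \in tri T -> inT s x -> inT t x ->
  bc s i x = bc t i x.
Proof.
move=> sT tT /(hull_inT _ sT) hs /(hull_inT _ tT) ht.
have := @tri_meet _ _ _ _ _ sT tT _ (conj hs ht).
rewrite hull_pos => -[c [c0 cS c1 cx]].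
by rewrite (bc_uniq sT i _ c1 cx) ?(bc_uniq tT i _ c1 cx) // => j jt;
  apply: cS; rewrite inE (negbTE jt) ?andbF.
Qed.

Lemma hgt_consist s t x : s \in tri T -> t \in tri T -> inT s x -> inT t x ->
  hgt s x = hgt t x.
Proof.
by move=> sT tT hs ht; apply: eq_bigr => i _; rewrite (bc_consist i sT tT).
Qed.

Lemma inT_interior_uniq s t x : s \in tri T -> t \in tri T ->
  (forall i, i \in s -> 0 < bc s i x) -> (forall i, i \in t -> 0 < bc t i x) ->
  s = t.
Proof.
have pT u : u \in tri T -> (forall i, i \in u -> 0 < bc u i x) -> inT u x.
  by move=> uT h i; case: (boolP (i \in u)) => [/h/ltW //|iu]; rewrite bc_out.
move=> sT tT hs ht; apply/setP => i; apply/idP/idP => hi.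
  apply/negPn/negP => it; have := hs _ hi.
  by rewrite (bc_consist i sT tT) ?bc_out ?ltxx //; apply: pT.
apply/negPn/negP => it; have := ht _ hi.
by rewrite -(bc_consist i sT tT) ?bc_out ?ltxx //; apply: pT.
Qed.

Lemma inT_sub_edge s t x (S : {set 'I_n}) : s \in tri T -> t \in tri T ->
  inT s x -> inT t x -> (forall i, i \notin S -> bc s i x = 0) ->
  forall i, 0 < bc t i x -> i \in S.
Proof.
move=> sT tT hs ht h i; rewrite -(bc_consist i sT tT) //.
by apply: contraTT => /h ->; rewrite ltxx.
Qed.

Lemma inT_conv t x y k : t \in tri T -> inT t x -> inT t y -> 0 <= k <= 1 ->
  inT t ((1 - k) *: x + k *: y).
Proof.
move=> tT hx hy /andP[k0 k1] i; rewrite affine_conv; last exact: bc_affine.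
by rewrite addr_ge0 // mulr_ge0 // subr_ge0.
Qed.

Lemma hgt_conv t x y k : t \in tri T ->
  hgt t ((1 - k) *: x + k *: y) = (1 - k) * hgt t x + k * hgt t y.
Proof. by move=> tT; apply: affine_conv; exact: hgt_affine. Qed.

(** The combination lies in the hull of all projected vertices, which the triangles cover by
    [tri_cover]. *)
Lemma dom_conv x y k : dom x -> dom y -> 0 <= k <= 1 ->
  dom ((1 - k) *: x + k *: y).
Proof.
move=> [s sT hs] [t tT ht] /andP[k0 k1].
have : hull (@xy R \o vtx T) [set: 'I_n]%SET (xy p + ((1 - k) *: x + k *: y)).
  rewrite hull_pos.
  exists (fun i => (1 - k) * bc s i x + k * bc t i y); split.
  - by move=> i; rewrite addr_ge0 // mulr_ge0 // subr_ge0.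
  - by move=> i; rewrite inE.
  - by rewrite big_split /= -!mulr_sumr !bc_sum1 // !mulr1 subrK.
  - under eq_bigr do rewrite scalerDl -!scalerA.
    by rewrite big_split /= -!scaler_sumr !bc_pos.
by move=> /(@tri_cover _ _ T)[u uT /(hull_inT _ uT) hu]; exists u.
Qed.

Lemma inT_pos t i : t \in tri T -> i \in t ->
  forall j, bc t j (pos i) = (j == i)%:R.
Proof.
move=> tT it j; rewrite (bc_uniq tT j (c := fun j => (j == i)%:R)) //.
- by move=> k; apply: contraNeq; rewrite pnatr_eq0 eqb0 negbK => /eqP ->.
- by rewrite (bigD1 i) //= eqxx big1 ?addr0 // => k /negbTE ->.
- rewrite (bigD1 i) //= eqxx scale1r big1 ?addr0 // => k /negbTE ->.
  by rewrite scale0r.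
Qed.

Lemma inT_vertex t i : t \in tri T -> i \in t -> inT t (pos i).
Proof. by move=> tT it j; rewrite inT_pos. Qed.

Lemma hgt_vertex t i : t \in tri T -> i \in t -> hgt t (pos i) = zr i.
Proof.
move=> tT it; rewrite /hgt (bigD1 i) //= inT_pos // eqxx mul1r.
by rewrite big1 ?addr0 // => j /negbTE ji; rewrite inT_pos // ji mul0r.
Qed.

Lemma vertex_tri i : exists2 t, t \in tri T & i \in t.
Proof.
have : hull (@xy R \o vtx T) [set: 'I_n]%SET (xy p + pos i).
  rewrite hull_pos; exists (fun j => (j == i)%:R); split => //.
  - by move=> j; rewrite inE.
  - by rewrite (bigD1 i) //= eqxx big1 ?addr0 // => k /negbTE ->.
  - rewrite (bigD1 i) //= eqxx scale1r big1 ?addr0 // => k /negbTE ->.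
    by rewrite scale0r.
move=> /(@tri_cover _ _ T)[u uT]; rewrite pos_def addrC subrK => hu.
by exists u => //; exact: tri_vertex hu.
Qed.

Lemma pos_inj : injective pos.
Proof.
move=> i j ij; have [t tT it] := vertex_tri i.
have jt : j \in t.
  apply: (tri_vertex tT); have := inT_vertex tT it.
  by rewrite -(hull_inT _ tT) ij pos_def addrC subrK.
have := inT_pos tT it i; rewrite ij (inT_pos tT jt) eqxx.
by case: eqP => // _ /eqP; rewrite eq_sym oner_eq0.
Qed.

Definition edge a b := a != b /\ exists2 t, t \in tri T & a \in t /\ b \in t.

Lemma edge_sym a b : edge a b -> edge b a.
Proof. by move=> [ab [t tT [? ?]]]; split; [rewrite eq_sym|exists t]. Qed.

Definition epos a b k := (1 - k) *: pos a + k *: pos b.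
Definition ehgt a b k := (1 - k) * zr a + k * zr b.

Lemma epos_sym a b k : epos b a (1 - k) = epos a b k.
Proof. by rewrite /epos subKr addrC. Qed.

Lemma inT_epos t a b k : t \in tri T -> a \in t -> b \in t -> 0 <= k <= 1 ->
  inT t (epos a b k).
Proof. by move=> tT at_ bt k01; apply: inT_conv => //; exact: inT_vertex. Qed.

Lemma hgt_epos t a b k : t \in tri T -> a \in t -> b \in t ->
  hgt t (epos a b k) = ehgt a b k.
Proof. by move=> tT at_ bt; rewrite hgt_conv // !hgt_vertex. Qed.

Lemma bc_epos t a b k i : t \in tri T -> a \in t -> b \in t -> a != b ->
  bc t i (epos a b k) = (1 - k) * (i == a)%:R + k * (i == b)%:R.
Proof.
by move=> tT at_ bt ab; rewrite affine_conv ?inT_pos //; exact: bc_affine.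
Qed.

(* The surface height [k] is only constrained by the points of the terrain
   under the segment from the viewpoint to the point over [x] of height [k]. *)
Definition vis x k := forall s l, s \in tri T -> 0 <= l <= 1 ->
  inT s (l *: x) -> hgt s (l *: x) <= l * k.

Definition vpart t x := inT t x /\ vis x (hgt t x).

Lemma facetE t q : t \in tri T -> facet T t q <->
  inT t (xy q - xy p) /\ hgt t (xy q - xy p) = zcoord q - zcoord p.
Proof.
move=> tT.
have zE (c : 'I_n -> R) : \sum_i c i = 1 ->
    zcoord (\sum_i c i *: vtx T i) - zcoord p = \sum_i c i * zr i.
  move=> c1; rewrite /zr; under [RHS]eq_bigr do rewrite mulrBr.
  rewrite sumrB -mulr_suml c1 mul1r /zcoord summxE; congr (_ - _).
  by apply: eq_bigr => i _; rewrite mxE.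
have xE (c : 'I_n -> R) : \sum_i c i = 1 ->
    xy (\sum_i c i *: vtx T i) - xy p = \sum_i c i *: pos i.
  move=> c1; rewrite pos_def; under [RHS]eq_bigr do rewrite scalerBr.
  rewrite sumrB -scaler_suml c1 scale1r; congr (_ - _).
  by rewrite /xy linear_sum; apply: eq_bigr => i _; rewrite linearZ.
split=> [[c [c0 ct c1 ->]]|[h1 h2]].
  rewrite zE // xE //; split; first exact: inT_weights.
  by apply: eq_bigr => i _; rewrite (bc_uniq tT i ct c1 erefl).
exists (bc t ^~ (xy q - xy p)); split => //.
- by move=> i; exact: bc_out.
- exact: bc_sum1.
have c1 := bc_sum1 tT (xy q - xy p).
have := xE _ c1; rewrite bc_pos // => /addIr h3.
have := zE _ c1; rewrite -/(hgt _ _) h2 => /addIr h4.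
apply/rowP => j; have [j2|j2] := ltnP j 2.
  have [k ->] : exists k : 'I_2, j = lshift 1 k.
    by exists (Ordinal j2); apply/val_inj.
  by have /rowP/(_ k) := h3; rewrite /xy !mxE => ->.
have -> : j = ord_max.
  by apply/val_inj => /=; apply/eqP; rewrite eqn_leq j2 -ltnS ltn_ord.
by rewrite -/(zcoord q) -h4.
Qed.

Lemma surfaceE q : surface T q <->
  exists2 t, t \in tri T & inT t (xy q - xy p) /\
    hgt t (xy q - xy p) = zcoord q - zcoord p.
Proof.
by split=> -[t tT /(facetE _ tT) h]; exists t.
Qed.

Lemma visibleE q : visible T p q <-> vis (xy q - xy p) (zcoord q - zcoord p).
Proof.
have xE l : xy (p + l *: (q - p)) - xy p = l *: (xy q - xy p).
  by rewrite /xy linearD linearZ linearB /= addrC addKr.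
have zE l : zcoord (p + l *: (q - p)) - zcoord p = l * (zcoord q - zcoord p).
  by rewrite /zcoord !mxE; ring.
split=> [h s l sT l01 hs|h l l01 [r]].
  rewrite leNgt; apply/negP => lt; apply: (h l l01).
  pose x := l *: (xy q - xy p).
  have [r [xr zr]] := lift_point (xy p + x) (zcoord p + hgt s x).
  exists r.
    by apply/surfaceE; exists s => //; rewrite xr zr ![_ + _ - _]addrAC !subrr !add0r.
  by rewrite xr zr; split; [rewrite /x -(xE l) addrC subrK|rewrite -ltrBlDl zE].
move=> /surfaceE[t tT [h1 h2]] [h3 h4].
have := h t l tT l01; rewrite -xE -h3 => /(_ h1); rewrite h2 -zE leNgt.
by rewrite ltrBrDr subrK h4.
Qed.

Lemma visible_partE t x : t \in tri T ->
  visible_part T p t x <-> vpart t (x - xy p).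
Proof.
move=> tT; split=> [[q [[_ /visibleE hv] /(facetE _ tT)[h1 h2]] <-]|[h1 h2]].
  by split=> //; rewrite h2.
have [r [xr zr]] := lift_point x (zcoord p + hgt t (x - xy p)).
have fr : facet T t r by apply/facetE => //; rewrite xr zr addrAC subrr add0r.
exists r => //; split => //; split; first by exists t.
by apply/visibleE; rewrite xr zr addrAC subrr add0r.
Qed.

End Relative.

(** * Affine inequalities along a line of sight *)

Section LP.
Variable R : realType.

Lemma push_up (I : eqType) (s : seq I) (A c : I -> R) (l0 : R) : l0 <= 1 ->
  (forall i, i \in s -> 0 <= c i + l0 * A i) ->
  exists l, [/\ l0 <= l <= 1, forall i, i \in s -> 0 <= c i + l * A i &
    l = 1 \/ exists2 i, i \in s & A i != 0 /\ c i + l * A i = 0].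
Proof.
move=> l01; elim: s => [|i s ih] h.
  by exists 1; split; rewrite ?l01 ?lexx //; left.
have [|l [/andP[l0l l1] hs hl]] := ih.
  by move=> j js; apply: h; rewrite inE js orbT.
have hi : 0 <= c i + l0 * A i by apply: h; rewrite inE eqxx.
case: (leP 0 (c i + l * A i)) => hli.
  exists l; split; first by rewrite l0l.
    by move=> j; rewrite inE => /orP[/eqP ->|/hs].
  by case: hl => [|[j js hj]]; [left|right; exists j => //; rewrite inE js orbT].
have Ai : A i < 0 by nra.
have A0 : A i != 0 by rewrite lt_eqF.
have hz : c i + (- c i / A i) * A i = 0 by field.
set m := - c i / A i in hz *.
have lm : l0 <= m <= l by apply/andP; split; nra.
case/andP: lm => lm1 lm2.
exists m; split; first by rewrite lm1 (le_trans lm2).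
  move=> j; rewrite inE => /orP[/eqP ->|js]; first by rewrite hz.
  have h1 := hs _ js; have h2 : 0 <= c j + l0 * A j by apply: h; rewrite inE js orbT.
  by case: (lerP 0 (A j)) => ?; nra.
by right; exists i; rewrite ?inE ?eqxx.
Qed.

(** Moving in the direction in which the objective does not decrease keeps it positive until a
    constraint becomes tight or [[0, 1]] ends. A decreasing objective is handled by substituting
    [1 - l]. *)
Lemma lp_extreme (I : finType) (A c : I -> R) (f g l0 : R) : 0 <= l0 <= 1 ->
  (forall i, 0 <= c i + l0 * A i) -> 0 < g + l0 * f ->
  exists l, [/\ 0 <= l <= 1, forall i, 0 <= c i + l * A i, 0 < g + l * f &
    [\/ l = 0, l = 1 | exists i, A i != 0 /\ c i + l * A i = 0]].
Proof.
move=> /andP[l0p l1] h hf; case: (lerP 0 f) => f0.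
  have [l [/andP[l0l ll1] hl hd]] := push_up (s := enum I) l1 (fun i _ => h i).
  exists l; split; first by rewrite ll1 (le_trans l0p).
  - by move=> i; apply: hl; rewrite mem_enum.
  - by nra.
  - by case: hd => [->|[i _ ?]]; [apply: Or32|apply: Or33; exists i].
have l1' : 1 - l0 <= 1 by lra.
have h' i : i \in enum I -> 0 <= (c i + A i) + (1 - l0) * (- A i).
  by move=> _; have := h i; lra.
have [l [/andP[l0l ll1] hl hd]] := push_up l1' h'.
exists (1 - l); split; first by apply/andP; split; lra.
- by move=> i; have := hl i; rewrite mem_enum => /(_ isT); lra.
- by nra.
- case: hd => [->|[i _ [i0 hi]]]; first by apply: Or31; rewrite subrr.
  by apply: Or33; exists i; split; [move: i0; rewrite oppr_eq0|lra].
Qed.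

End LP.

(** * Visibility in terms of blocking edges *)

Section Blocking.
Variables (R : realType) (n : nat) (T : terrain R n) (p : 'rV[R]_3).
Hypothesis above : on_or_above T p.
Implicit Types (s t : {set 'I_n}) (a b i j : 'I_n) (d x y : 'rV[R]_2).

Local Notation pos := (pos T p).
Local Notation zr := (zr T p).
Local Notation inT := (inT T p).
Local Notation bc := (bc T p).
Local Notation hgt := (hgt T p).
Local Notation vis := (vis T p).
Local Notation edge := (edge T).
Local Notation epos := (epos T p).
Local Notation ehgt := (ehgt T p).

Lemma dom0 : dom T p 0.
Proof.
by case: above => r /(surfaceE _ p)[t tT [h _]] [e _]; exists t;
  rewrite // -(subrr (xy p)) -{1}e.
Qed.

Lemma hgt0_le0 t : t \in tri T -> inT t 0 -> hgt t 0 <= 0.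
Proof.
move=> tT ht; case: above => r /(surfaceE _ p)[s sT [hs hz]] [e le].
move: hs hz; rewrite e subrr => hs hz.
by rewrite -(hgt_consist sT tT hs ht) hz subr_le0.
Qed.

(** [wta] and [wtb] are the coordinates of [d] in the basis [pos a], [pos b]. Both are nonnegative
    on the cone of the edge, where a sum above 1 means lying behind the edge. *)
Definition wta a b d : R := cross d (pos b) / cross (pos a) (pos b).
Definition wtb a b d : R := cross (pos a) d / cross (pos a) (pos b).
(* The height over [d] of the plane through the viewpoint and the edge. *)
Definition ph a b d : R := wta a b d * zr a + wtb a b d * zr b.

Definition blocks a b d k := [/\ edge a b, cross (pos a) (pos b) != 0,
  0 <= wta a b d /\ 0 <= wtb a b d, 1 < wta a b d + wtb a b d & k < ph a b d].

Lemma wtE a b d : cross (pos a) (pos b) != 0 ->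
  d = wta a b d *: pos a + wtb a b d *: pos b.
Proof. exact: cramer. Qed.

Lemma wtaZ a b k d : wta a b (k *: d) = k * wta a b d.
Proof. by rewrite /wta /cross !vE; ring. Qed.
Lemma wtbZ a b k d : wtb a b (k *: d) = k * wtb a b d.
Proof. by rewrite /wtb /cross !vE; ring. Qed.
Lemma phZ a b k d : ph a b (k *: d) = k * ph a b d.
Proof. by rewrite /ph wtaZ wtbZ; ring. Qed.
Lemma wtaD a b x y : wta a b (x + y) = wta a b x + wta a b y.
Proof. by rewrite /wta /cross !vE; ring. Qed.
Lemma wtbD a b x y : wtb a b (x + y) = wtb a b x + wtb a b y.
Proof. by rewrite /wtb /cross !vE; ring. Qed.
Lemma phD a b x y : ph a b (x + y) = ph a b x + ph a b y.
Proof. by rewrite /ph wtaD wtbD; ring. Qed.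

Lemma wta_epos a b k : cross (pos a) (pos b) != 0 -> wta a b (epos a b k) = 1 - k.
Proof. by rewrite /wta /epos /cross !vE => h; field. Qed.
Lemma wtb_epos a b k : cross (pos a) (pos b) != 0 -> wtb a b (epos a b k) = k.
Proof. by rewrite /wtb /epos /cross !vE => h; field. Qed.
Lemma ph_epos a b k : cross (pos a) (pos b) != 0 ->
  ph a b (epos a b k) = ehgt a b k.
Proof. by move=> h; rewrite /ph wta_epos // wtb_epos. Qed.

Lemma wta_affine a b : affine (wta a b).
Proof. by apply: affineM; exact: affine_crossl. Qed.
Lemma wtb_affine a b : affine (wtb a b).
Proof. by apply: affineM; exact: affine_crossr. Qed.
Lemma ph_affine a b : affine (ph a b).
Proof.
by apply: affineD; apply: affineM; [exact: wta_affine|exact: wtb_affine].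
Qed.

Lemma blocks_not_vis a b d k : blocks a b d k -> ~ vis d k.
Proof.
move=> [[ab [s sT [sa sb]]] D0 [x0 e0] lt1 lt h].
set m := wta a b d + wtb a b d in lt1.
have m0 : 0 < m by apply: lt_trans lt1.
have m0' : m != 0 by rewrite gt_eqF.
(* The line of sight crosses the edge at the ratio [m^-1]. *)
have dE : m^-1 *: d = epos a b (wtb a b d / m).
  rewrite /epos {1}(wtE d D0) scalerDr !scalerA.
  by congr (_ *: _ + _ *: _); rewrite /m; field.
have tau : 0 <= wtb a b d / m <= 1.
  by rewrite divr_ge0 ?(ltW m0) //= ler_pdivrMr // mul1r /m lerDr.
have := h s m^-1 sT _ _; rewrite dE hgt_epos //.
have -> : 0 <= m^-1 <= 1 by rewrite invr_ge0 (ltW m0) invf_le1 // ltW.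
move=> /(_ isT (inT_epos _ sT sa sb tau)); rewrite -ph_epos // -dE phZ.
by rewrite ler_pM2l ?invr_gt0 // leNgt lt.
Qed.

(** The weight of a third index vanishes on the line through [pos a] and [pos b], and the origin is
    on this line. *)
Lemma zero_on_line t a b i : t \in tri T -> a \in t -> b \in t -> a != b ->
  i != a -> i != b -> cross (pos a) (pos b) = 0 -> bc t i 0 = 0.
Proof.
move=> tT at_ bt ab ia ib D0.
have [u [c fE]] := bc_affine p tT i.
have ha : bc t i (pos a) = 0 by rewrite inT_pos // (negbTE ia).
have hb : bc t i (pos b) = 0 by rewrite inT_pos // (negbTE ib).
have e : pos b - pos a != 0.
  by rewrite subr_eq0; apply: contra ab => /eqP/pos_inj ->.
move: ha hb; rewrite !fE !dotE => ha hb; rewrite !zerovE; move: D0; rewrite /cross => D0.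
set a0 := pos a 0 0 in ha D0 *; set a1 := pos a 0 1 in ha D0 *.
set b0 := pos b 0 0 in hb D0 *; set b1 := pos b 0 1 in hb D0 *.
case: (vec_neq0 e); rewrite addvE oppvE -/a0 -/a1 -/b0 -/b1 => h;
  apply: (mulfI h).
  transitivity (b0 * (u 0 0 * a0 + u 0 1 * a1 + c)
    - a0 * (u 0 0 * b0 + u 0 1 * b1 + c) + u 0 1 * (a0 * b1 - a1 * b0)).
    by ring.
  by rewrite ha hb D0; ring.
transitivity (b1 * (u 0 0 * a0 + u 0 1 * a1 + c)
  - a1 * (u 0 0 * b0 + u 0 1 * b1 + c) - u 0 0 * (a0 * b1 - a1 * b0)).
  by ring.
by rewrite ha hb D0; ring.
Qed.

(** The excess of a triangle [s] over the line of sight is affine, so a positive excess can be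
    pushed to an end of the segment that the line of sight has in common with [s]. It is not
    positive at the viewpoint, which is on or above the terrain, nor at the target, which is on it.
    Hence that end lies on a side of [s], and this side blocks. *)
Lemma not_vis_blocks t d : t \in tri T -> inT t d -> ~ vis d (hgt t d) ->
  exists a b, blocks a b d (hgt t d).
Proof.
move=> tT td /existsNP[s] /existsNP[l0] /not_implyP[sT] /not_implyP[l01].
move=> /not_implyP[sd /negP]; rewrite -ltNge => lt.
have bE i l : bc s i (l *: d) = bc s i 0 + l * (bc s i d - bc s i 0).
  by apply: affine_scale; exact: bc_affine.
have hE l : hgt s (l *: d) = hgt s 0 + l * (hgt s d - hgt s 0).
  by apply: affine_scale; exact: hgt_affine.
have [||l [l1 hb hf hl]] := lp_extreme (I := 'I_n) (c := bc s ^~ 0)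
  (A := fun i => bc s i d - bc s i 0) (g := hgt s 0)
  (f := hgt s d - hgt s 0 - hgt t d) l01.
- by move=> i; rewrite -bE.
- by move: lt; rewrite hE; lra.
have sl : inT s (l *: d) by move=> i; rewrite bE.
have {}hf : l * hgt t d < hgt s (l *: d) by rewrite hE; lra.
case: hl => [lE|lE|].
- have := hgt0_le0 sT; rewrite -(scale0r d) -lE => /(_ sl).
  by move: hf; rewrite {1}lE mul0r; lra.
- move: sl hf; rewrite lE scale1r mul1r => sl.
  by rewrite (hgt_consist sT tT sl td) ltxx.
move=> [i [Ai /eqP]]; rewrite -bE => /eqP li.
have is_ : i \in s.
  by apply: contraR Ai => is_; rewrite !bc_out // subrr.
have lp : 0 < l.
  case/andP: l1; rewrite le_eqVlt => /orP[/eqP lE|//] _.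
  have := hgt0_le0 sT; rewrite -(scale0r d) lE => /(_ sl).
  by move: hf; rewrite -{1}lE mul0r; lra.
have l0' : l != 0 by rewrite gt_eqF.
have {}l1 : l < 1.
  case/andP: l1 => _; rewrite le_eqVlt => /orP[/eqP l1'|//].
  move: sl hf; rewrite l1' scale1r mul1r => sl.
  by rewrite (hgt_consist sT tT sl td) ltxx.
have [a [b [ab sa sb [ia ib sE]]]] : exists a b, [/\ a != b, a \in s, b \in s &
    [/\ i != a, i != b & forall j, j != a -> j != b -> bc s j (l *: d) = 0]].
  have [x [y [z [xy xz yz sE]]]] := set3P (tri_card sT).
  have o j : j != x -> j != y -> j != z -> bc s j (l *: d) = 0.
    by move=> jx jy jz; apply: bc_out => //; rewrite sE !inE !negb_or jx jy.
  have [xs ys zs] : [/\ x \in s, y \in s & z \in s].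
    by rewrite sE !inE !eqxx !orbT.
  have : i \in [set x; y; z]%SET by rewrite -sE.
  rewrite !inE -orbA => /or3P[]/eqP e; subst i.
  - exists y, z; split=> //; split=> // j jy jz.
    by have [->//|jx] := eqVneq j x; apply: o.
  - exists x, z; split=> //; split=> //.
      by rewrite eq_sym.
    by move=> j jx jz; have [->//|jy] := eqVneq j y; apply: o.
  - exists x, y; split=> //.
    split=> //; try by rewrite eq_sym.
    by move=> j jx jy; have [->//|jz] := eqVneq j z; apply: o.
have sum2 (V : nmodType) (f : 'I_n -> V) :
    (forall j, j != a -> j != b -> f j = 0) -> \sum_j f j = f a + f b.
  move=> f0; rewrite (bigD1 a) //= (bigD1 b) 1?eq_sym //= big1 ?addr0 //.
  by move=> j /andP[? ?]; exact: f0.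
have ca1 : bc s a (l *: d) + bc s b (l *: d) = 1.
  by rewrite -(bc_sum1 p sT (l *: d)) sum2.
have cd : l *: d = bc s a (l *: d) *: pos a + bc s b (l *: d) *: pos b.
  rewrite -{1}(bc_pos p sT (l *: d)) sum2 // => j ja jb.
  by rewrite sE // scale0r.
have ch : hgt s (l *: d) = bc s a (l *: d) * zr a + bc s b (l *: d) * zr b.
  by rewrite /hgt sum2 // => j ja jb; rewrite sE // mul0r.
(* If the side were in line with the viewpoint, the tight weight would vanish at 0 and at [l > 0],
   so its slope along the line of sight would be zero, against [Ai]. *)
have D0 : cross (pos a) (pos b) != 0.
  apply/eqP => D0; have z := zero_on_line sT sa sb ab ia ib D0.
  move: li; rewrite bE z add0r => /eqP; rewrite mulf_eq0 (negbTE l0') /=.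
  by move: Ai; rewrite z => /negbTE ->.
set ca := bc s a _ in ca1 cd ch; set cb := bc s b _ in ca1 cd ch.
have ca0 : 0 <= ca by exact: sl.
have cb0 : 0 <= cb by exact: sl.
have dE : d = l^-1 *: (ca *: pos a + cb *: pos b) by rewrite -cd scalerK.
have xE : wta a b d = ca / l.
  by rewrite dE; move: D0; rewrite /wta /cross !vE => D0; field; rewrite l0'.
have eE : wtb a b d = cb / l.
  by rewrite dE; move: D0; rewrite /wtb /cross !vE => D0; field; rewrite l0'.
exists a, b; split=> //; first by split=> //; exists s.
- by rewrite xE eE !divr_ge0 // ltW.
- by rewrite xE eE -mulrDl ca1 mul1r invf_gt1.
- rewrite /ph xE eE mulrAC [X in _ + X]mulrAC -mulrDl -ch.
  by rewrite ltr_pdivlMr // mulrC.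
Qed.

Lemma visP t d : t \in tri T -> inT t d ->
  vis d (hgt t d) <-> forall a b, ~ blocks a b d (hgt t d).
Proof.
move=> tT td; split=> [v a b /blocks_not_vis//|h].
by apply: contrapT => /(not_vis_blocks tT td)[a [b]]; exact: h.
Qed.

End Blocking.

(** * Peaks of the terrain and gaps in the visibility of an edge *)

Section Small.
Variable R : realType.
Implicit Types (P Q : R -> Prop).

(** The filter of right neighborhoods of 0, written out. *)
Definition small P := exists2 e, 0 < e & forall x, 0 < x < e -> P x.

Lemma small_imp P Q : (forall x, 0 < x -> P x -> Q x) -> small P -> small Q.
Proof.
move=> PQ [e e0 h]; exists e => // x /andP[x0 xe].
by apply: PQ => //; apply: h; rewrite x0.
Qed.

Lemma small_and P Q : small P -> small Q -> small (fun x => P x /\ Q x).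
Proof.
move=> [e e0 he] [f f0 hf]; exists (Order.min e f); first by rewrite lt_min e0.
by move=> x /andP[x0]; rewrite lt_min => /andP[xe xf]; split;
  [apply: he|apply: hf]; rewrite x0.
Qed.

Lemma small_seq (I : eqType) (s : seq I) (P : I -> R -> Prop) :
  (forall i, i \in s -> small (P i)) ->
  small (fun x => forall i, i \in s -> P i x).
Proof.
elim: s => [_|i s ih h]; first by exists 1.
have [||e e0 he] := small_and (P := P i) (Q := fun x => forall j, j \in s -> P j x).
- by apply: h; rewrite inE eqxx.
- by apply: ih => j js; apply: h; rewrite inE js orbT.
exists e => // x xe j; have [hi hs] := he x xe.
by rewrite inE => /orP[/eqP ->|/hs].
Qed.

Lemma small_all (I : finType) (P : I -> R -> Prop) :
  (forall i, small (P i)) -> small (fun x => forall i, P i x).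
Proof.
move=> h; have [e e0 he] := small_seq (s := enum I) (fun i _ => h i).
by exists e => // x xe i; apply: he; rewrite ?mem_enum.
Qed.

Lemma smallT P : (forall x, 0 < x -> P x) -> small P.
Proof. by move=> h; exists 1 => // x /andP[x0 _]; exact: h. Qed.

Lemma small_ex P : small P -> exists2 x, 0 < x & P x.
Proof. by move=> [e e0 h]; exists (e / 2); [|apply: h]; lra. Qed.

Lemma small_lt c : 0 < c -> small (fun x => x < c).
Proof. by move=> c0; exists c => // x /andP[]. Qed.

Lemma small_pos g c : 0 < g -> small (fun x => 0 < g + x * c).
Proof.
move=> g0; have c1 : 0 < `|c| + 1 by rewrite ltr_wpDl.
exists (g / (`|c| + 1)); first by rewrite divr_gt0.
move=> x /andP[x0]; rewrite ltr_pdivlMr // => h.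
have : - `|c| <= c by rewrite lerNl -normrN ler_norm.
by nra.
Qed.

End Small.

(** On the curve of points [(x, x^2)] each condition says that [x] is not a root of a nonzero
    polynomial. The product [Q] has fewer than [size Q] roots, so one of [size Q] distinct
    candidates survives. *)
Lemma avoid_zeros (R : realType) (I : finType) (c : I -> R) (u : I -> 'rV[R]_2) (e : R) :
  0 < e -> (forall i, u i != 0) ->
  exists A : 'rV[R]_2, [/\ `|A 0 0| <= e, `|A 0 1| <= e &
    forall i, c i + dot A (u i) != 0].
Proof.
move=> e0 u0.
pose q i : {poly R} := (c i)%:P + (u i 0 0)%:P * 'X + (u i 0 1)%:P * 'X^2.
have qc i : (q i)`_1 = u i 0 0 /\ (q i)`_2 = u i 0 1.
  by rewrite /q !coefD !coefCM !coefC !coefX !coefXn /= !mulr0 !mulr1 !addr0 !add0r.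
have q0 i : q i != 0.
  apply/eqP => q0; have [h1 h2] := qc i; move: h1 h2; rewrite q0 !coef0 => h1 h2.
  by have /eqP[] := u0 i; apply: vecP; rewrite vE.
pose Q := \prod_i q i.
have Q0 : Q != 0 by rewrite prodf_seq_neq0; apply/allP => i _; exact: q0.
(* The bound 1 gives [x^2 <= x <= e]. *)
pose m := Order.min e 1; have m0 : 0 < m by rewrite lt_min e0 ltr01.
pose f k : R := m / k.+1%:R.
have finj : injective f.
  move=> k l /(mulfI (lt0r_neq0 m0)) /invr_inj /eqP.
  by rewrite eqr_nat => /eqP[].
pose s := [seq f k | k <- iota 0 (size Q)].
have us : uniq s by rewrite map_inj_uniq // iota_uniq.
have /allPn[x xs rx] : ~~ all (root Q) s.
  apply/negP => al; have := max_poly_roots Q0 al us.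
  by rewrite size_map size_iota ltnn.
have /mapP[k _ xE] := xs.
have x0 : 0 < x by rewrite xE divr_gt0.
have xm : x <= m by rewrite xE ler_pdivrMr // ler_peMr ?(ltW m0) // ler1n.
have [xe x1] : x <= e /\ x <= 1 by move: xm; rewrite le_min => /andP[].
exists (\row_j (if j == 0 then x else x ^+ 2)); rewrite !mxE /=; split.
- by rewrite gtr0_norm.
- by rewrite gtr0_norm ?exprn_gt0 // expr2 (le_trans _ xe) // ler_piMr // ltW.
move=> i; rewrite dotE !mxE /=; apply: contra rx => /eqP h.
rewrite /root horner_prod; apply/prodf_eq0; exists i => //.
rewrite /q !hornerD !hornerCM hornerC hornerX hornerXn; apply/eqP.
by rewrite -h; ring.
Qed.

Section Peaks.
Variables (R : realType) (n : nat) (T : terrain R n) (p : 'rV[R]_3).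
Hypothesis above : on_or_above T p.
Implicit Types (s t : {set 'I_n}) (a b i j u v : 'I_n) (d x y A : 'rV[R]_2).

Local Notation pos := (pos T p).
Local Notation zr := (zr T p).
Local Notation inT := (inT T p).
Local Notation bc := (bc T p).
Local Notation hgt := (hgt T p).
Local Notation edge := (edge T).
Local Notation epos := (epos T p).
Local Notation dom := (dom T p).

Lemma dom_bounded : exists2 B : R, 0 < B &
  forall x, dom x -> `|x 0 0| <= B /\ `|x 0 1| <= B.
Proof.
pose B0 := \sum_i (`|pos i 0 0| + `|pos i 0 1|).
have B00 : 0 <= B0 by apply: sumr_ge0 => i _; rewrite addr_ge0.
exists (B0 + 1); first by rewrite ltr_wpDl.
move=> x [t tT tx].
have key k : (forall i, `|pos i 0 k| <= `|pos i 0 0| + `|pos i 0 1|) ->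
    `|x 0 k| <= B0 + 1.
  move=> hk; rewrite (le_trans _ (_ : B0 <= _)) ?lerDl //.
  rewrite -{1}(bc_pos p tT x) summxE (le_trans (ler_norm_sum _ _ _)) //.
  apply: ler_sum => i _; rewrite scalevE normrM ger0_norm //.
  rewrite (le_trans _ (hk i)) // ler_piMl //.
  rewrite -(bc_sum1 p tT x) (bigD1 i) //= lerDl sumr_ge0 // => j _.
by split; apply: key => i; rewrite ?lerDl ?lerDr.
Qed.

Lemma compact_cell t (I : finType) (f : I -> 'rV[R]_2 -> R) : t \in tri T ->
  (forall k, affine (f k)) ->
  compact [set x | inT t x /\ forall k, 0 <= f k x].
Proof.
move=> tT fa; have [B B0 hB] := dom_bounded.
have cl (g : 'rV[R]_2 -> R) : affine g -> closed [set x | 0 <= g x].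
  move=> ga; apply: (closed_comp (f := g) (D := [set y | 0 <= y])).
    by move=> x _; exact: affine_continuous.
  exact: closed_ge.
apply: bounded_closed_compact.
  exists B; split; first exact: num_real.
  move=> M BM x [tx _] /=; have [h0 h1] := hB x (ex_intro2 _ _ t tT tx).
  rewrite [leLHS]/Num.norm /= mx_normrE; apply/bigmax_leP; split; first by lra.
  move=> [i j] _ /=; rewrite (ord1 i); case: j => [[|[|//]] j] /=.
    by rewrite (_ : Ordinal j = 0); [lra|exact/val_inj].
  by rewrite (_ : Ordinal j = 1); [lra|exact/val_inj].
rewrite (_ : [set _ | _] = \bigcap_(i in setT) [set x | 0 <= bc t i x] `&`
   \bigcap_(k in setT) [set x | 0 <= f k x]).
  apply: closedI; apply: closed_bigI => k _; apply: cl => //; exact: bc_affine.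
apply/seteqP; split=> x /= [h1 h2]; split=> i; try by move=> _; try exact: h1;
  exact: h2.
- exact: h1.
- exact: h2.
Qed.

(* As the heights relative to [A] separate the vertices, a maximum of this
   piecewise linear function cannot lie inside an edge or a triangle. *)
Lemma peak (I : finType) (f : I -> 'rV[R]_2 -> R) A t0 m :
  (forall k, affine (f k)) ->
  (forall u v, u != v -> zr u - dot A (pos u) != zr v - dot A (pos v)) ->
  t0 \in tri T -> inT t0 m -> (forall k, 0 <= f k m) ->
  (forall s x, s \in tri T -> inT s x -> (forall k, 0 <= f k x) ->
     (exists k, f k x = 0) -> hgt s x - dot A x < hgt t0 m - dot A m) ->
  exists2 v, forall k, 0 < f k (pos v) &
    forall u, edge u v -> zr u - dot A (pos u) < zr v - dot A (pos v).
Proof.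
move=> fa gen t0T t0m fm bnd.
pose H s x := hgt s x - dot A x.
have Ha s : s \in tri T -> affine (H s).
  by move=> sT; apply: affineB; [exact: hgt_affine|exact: affine_dot].
pose K s := [set x | inT s x /\ forall k, 0 <= f k x].
have /choice[X XP] : forall s, exists x, s \in tri T -> K s !=set0 ->
    K s x /\ forall y, K s y -> H s y <= H s x.
  move=> s; case: (boolP (s \in tri T)) => sT; last by exists 0.
  have [K0|/asboolPn/negP K0] := pselect (K s !=set0); last by exists 0 => _ /asboolP.
  have := compact_EVT_max K0 (compact_cell sT fa) (f := H s).
  case; first by apply: continuous_subspaceT; apply: affine_continuous; exact: Ha.
  by move=> x; rewrite inE => Kx hx; exists x => _ _; split=> // y Ky; apply: hx; rewrite inE.
pose P s := (s \in tri T) && `[< K s !=set0 >].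
have P0 : P t0 by rewrite /P t0T; apply/asboolP; exists m; split.
case: (arg_maxP (fun s => H s (X s)) P0) => s0 /andP[s0T /asboolP K0] smax.
have [[s0x fx] _] := XP s0 s0T K0.
set x := X s0 in s0x fx smax.
have {}xmax s y : s \in tri T -> inT s y -> (forall k, 0 <= f k y) -> H s y <= H s0 x.
  move=> sT sy fy; have Ks : K s !=set0 by exists y; split.
  apply: le_trans (smax s _); last by rewrite /P sT; apply/asboolP.
  by apply: (XP s sT Ks).2.
(* On the boundary of the region the values stay below the one at [m], so the overall maximum lies
   strictly inside the region. *)
have {}fx k : 0 < f k x.
  rewrite lt_neqAle fx andbT eq_sym; apply/negP => /eqP k0.
  have := bnd s0 x s0T s0x fx (ex_intro _ k k0).
  by rewrite ltNge; have := xmax t0 m t0T t0m fm; rewrite /H => ->.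
(* With two positive weights, [x] could move both ways parallel to the side [i j]. Maximality would
   then make [H] equal at both vertices, against [gen]. *)
have only i j : 0 < bc s0 i x -> 0 < bc s0 j x -> i = j.
  move=> hi hj; apply/eqP/negPn/negP => ij.
  have is0 : i \in s0 by apply: contraTT hi => /bc_out ->; rewrite ?ltxx.
  have js0 : j \in s0 by apply: contraTT hj => /bc_out ->; rewrite ?ltxx.
  have key (w : 'rV[R]_2) : (w = pos i - pos j) \/ (w = pos j - pos i) ->
      H s0 (x + w) - H s0 x <= 0.
    move=> wE.
    have sm : small (fun e => (forall k, 0 < f k x + e * (f k (x + w) - f k x)) /\
       (0 < bc s0 i x + e * (-1) /\ 0 < bc s0 j x + e * (-1))).
      by apply: small_and; [apply: small_all => k|apply: small_and]; exact: small_pos.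
    have [e e0 [hf [h1 h2]]] := small_ex sm.
    have fw k : 0 <= f k (x + e *: w) by rewrite affine_line // ltW.
    suff sw : inT s0 (x + e *: w).
      have := xmax s0 _ s0T sw fw.
      by rewrite affine_line ?gerDl ?pmulr_rle0 //; exact: Ha.
    move=> k; rewrite affine_line; last exact: bc_affine.
    have bw : bc s0 k (x + w) - bc s0 k x =
        (k == i)%:R - (k == j)%:R \/ bc s0 k (x + w) - bc s0 k x =
        (k == j)%:R - (k == i)%:R.
      have [ua [ub bE]] := bc_affine p s0T k.
      have := inT_pos p s0T is0 k; have := inT_pos p s0T js0 k.
      rewrite !bE => <- <-.
      by case: wE => ->; [left|right]; rewrite !dotE !vE; ring.
    have := s0x k; have [ki|ki] := eqVneq k i; have [kj|kj] := eqVneq k j.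
    - by move: ij; rewrite -ki -kj eqxx.
    - by move: h1 bw; rewrite -ki eqxx (negbTE kj) /= => ? [] ->; lra.
    - by move: h2 bw; rewrite -kj eqxx (negbTE ki) /= => ? [] ->; lra.
    - by move: bw; rewrite (negbTE ki) (negbTE kj) => -[] ->; lra.
  have := key _ (or_introl erefl); have := key _ (or_intror erefl).
  have [ua [ub hE]] := Ha _ s0T.
  have hi' : H s0 (pos i) = zr i - dot A (pos i) by rewrite /H hgt_vertex.
  have hj' : H s0 (pos j) = zr j - dot A (pos j) by rewrite /H hgt_vertex.
  have := gen _ _ ij; rewrite -hi' -hj' !hE !dotE !vE => ne l1 l2.
  by move/eqP: ne; apply; lra.
have [v hv] : exists v, 0 < bc s0 v x.
  apply: contrapT => /forallNP h; have := bc_sum1 p s0T x.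
  rewrite big1 => [/eqP|i _]; first by rewrite eq_sym oner_eq0.
  by apply/eqP; rewrite eq_le s0x andbT leNgt; apply/negP/h.
have b0 j : j != v -> bc s0 j x = 0.
  move=> jv; apply/eqP; rewrite eq_le s0x andbT leNgt; apply/negP => hj.
  by move: jv; rewrite (only _ _ hj hv) eqxx.
have b1 : bc s0 v x = 1.
  by rewrite -(bc_sum1 p s0T x) (bigD1 v) //= big1 ?addr0.
have xv : x = pos v.
  rewrite -(bc_pos p s0T x) (bigD1 v) //= b1 scale1r big1 ?addr0 // => j jv.
  by rewrite b0 // scale0r.
have vs0 : v \in s0 by apply: contraTT hv => /bc_out ->; rewrite ?ltxx.
exists v => [k|u [uv [t tT [ut vt]]]]; first by rewrite -xv.
rewrite lt_neqAle gen //=.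
have sm : small (fun e => (forall k, 0 < f k x + e * (f k (x + (pos u - pos v)) - f k x)) /\ e < 1).
  by apply: small_and; [apply: small_all => k; exact: small_pos|exact: small_lt].
have [e e0 [hf e1]] := small_ex sm.
have eE : epos v u e = x + e *: (pos u - pos v).
  by rewrite xv; apply: vecP; rewrite /epos !vE; ring.
have e01 : 0 <= e <= 1 by rewrite !ltW.
have fe k : 0 <= f k (epos v u e) by rewrite eE affine_line // ltW.
have := xmax t _ tT (inT_epos p tT vt ut e01) fe.
have -> : H s0 x = zr v - dot A (pos v) by rewrite /H xv hgt_vertex.
rewrite /H hgt_epos // /ehgt /epos !dotE !vE; nra.
Qed.

End Peaks.

Lemma dot_xyz (R : realType) (q w : 'rV[R]_3) :
  dot q w = dot (xy q) (xy w) + zcoord q * zcoord w.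
Proof.
rewrite dotE /dot !big_ord_recl big_ord0 addr0 addrA /xy /zcoord !mxE.
by congr (_ * _ + _ * _ + _ * _); congr (_ 0 _); exact/val_inj.
Qed.

Section Gaps.
Variables (R : realType) (n : nat) (T : terrain R n) (p : 'rV[R]_3).
Hypothesis above : on_or_above T p.
Implicit Types (s t : {set 'I_n}) (a b u v : 'I_n) (d x y A : 'rV[R]_2).

Local Notation pos := (pos T p).
Local Notation zr := (zr T p).
Local Notation inT := (inT T p).
Local Notation hgt := (hgt T p).
Local Notation vis := (vis T p).
Local Notation edge := (edge T).
Local Notation epos := (epos T p).
Local Notation ehgt := (ehgt T p).
Local Notation dom := (dom T p).
Local Notation wta := (wta T p).
Local Notation wtb := (wtb T p).
Local Notation ph := (ph T p).

Lemma prickliness_in_le w : (prickliness_in T w <= prickliness T)%N.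
Proof.
have lt : (prickliness_in T w < n.+1)%N.
  by rewrite ltnS (leq_trans (max_card _)) // card_ord.
apply: (@leq_bigmax_cond _ _ (fun k : 'I_n.+1 => nat_of_ord k) (Ordinal lt)).
by apply/asboolP; exists w.
Qed.

Lemma dom_domain x : dom (x - xy p) -> domain T x.
Proof.
move=> [t tT h]; have [q [qx qz]] := lift_point x (zcoord p + hgt t (x - xy p)).
exists q => //; apply/(surfaceE _ p); exists t => //.
by rewrite qx qz addrAC subrr add0r.
Qed.

Lemma internal_of_open (I : finType) (f : I -> 'rV[R]_2 -> R) v :
  (forall k, affine (f k)) -> (forall x, (forall k, 0 < f k x) -> dom x) ->
  (forall k, 0 < f k (pos v)) -> internal_vertex T v.
Proof.
move=> fa fd fv cl.
have [|x [nx hx]] := cl [set x | forall k, 0 < f k (x - xy p)].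
  apply: (@filter_forall _ I (fun k x => 0 < f k (x - xy p)) (nbhs (xy (vtx T v)))
     (nbhs_filter _)) => k.
  have ca : continuous (fun x => f k (x - xy p)).
    by apply: affine_continuous; apply: affine_sub.
  by apply: (ca (xy (vtx T v)) [set y | 0 < y]); apply: lt_nbhsr; have := fv k; rewrite pos_def.
by apply: nx; apply: dom_domain; apply: fd.
Qed.

(** Up to a constant, the height relative to [A] is the inner product with [w = (- A, 1)]. One
    inequality thus yields both the plane of slope [A] that witnesses convexity and the local
    maximum in direction [w]. *)
Lemma peak_counted (I : finType) (f : I -> 'rV[R]_2 -> R) A v :
  (forall k, affine (f k)) -> (forall x, (forall k, 0 < f k x) -> dom x) ->
  (forall k, 0 < f k (pos v)) ->
  (forall u, edge u v -> zr u - dot A (pos u) < zr v - dot A (pos v)) ->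
  forall w : 'rV[R]_3, xy w = - A -> zcoord w = 1 ->
  [/\ internal_vertex T v, convex_vertex T v & local_max T w v].
Proof.
move=> fa fd fv hv w wx wz.
have hu u : neighbor T u v -> zcoord (vtx T u) - dot A (xy (vtx T u)) <
    zcoord (vtx T v) - dot A (xy (vtx T v)).
  move=> [uv [t [tT ut vt]]].
  have /hv : edge u v by split=> //; exists t.
  by rewrite pos_def /zr !dotE !vE; lra.
split; first exact: internal_of_open fv.
  by exists A => u /hu; rewrite !dotE !vE; lra.
by move=> u /hu; rewrite !dot_xyz wx wz !dotE !vE; lra.
Qed.

Lemma ph_dot a b : exists g, forall x, ph a b x = dot g x.
Proof.
have [g [c gE]] := ph_affine T p a b; exists g => x.
have : ph a b 0 = 0 by rewrite -(scale0r (0 : 'rV[R]_2)) phZ mul0r.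
by rewrite gE !dotE !vE => h; rewrite gE dotE; lra.
Qed.

Section OneEdge.
Variables a b : 'I_n.
Hypotheses (ab : edge a b) (D0 : cross (pos a) (pos b) != 0).

(* The three inequalities [0 <= wedge l r k x] describe the triangle spanned by
   the viewpoint and the points of the edge at the parameters [l] and [r]. *)
Definition wedge (l r : R) (k : 'I_3) x : R :=
  if val k is 0%N then wtb a b x - l * (wta a b x + wtb a b x)
  else if val k is 1%N then r * (wta a b x + wtb a b x) - wtb a b x
  else 1 - (wta a b x + wtb a b x).

Lemma wedgeP (l r : R) (P : R -> Prop) x : (forall k, P (wedge l r k x)) <->
  [/\ P (wtb a b x - l * (wta a b x + wtb a b x)),
   P (r * (wta a b x + wtb a b x) - wtb a b x) & P (1 - (wta a b x + wtb a b x))].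
Proof.
split=> [h|[h0 h1 h2] [[|[|[|//]]] i] //].
by split; [exact: (h (@Ordinal 3 0 isT))|exact: (h (@Ordinal 3 1 isT))|
  exact: (h (@Ordinal 3 2 isT))].
Qed.

Lemma wedge_affine (l r : R) k : affine (wedge l r k).
Proof.
have xa := wta_affine T p a b; have ea := wtb_affine T p a b.
case: k => [[|[|[|//]]] i]; rewrite /wedge /=.
- apply: affineB => //; under eq_fun do rewrite mulrC.
  by apply: affineM; exact: affineD.
- apply: affineB => //; under eq_fun do rewrite mulrC.
  by apply: affineM; exact: affineD.
- by apply: affineB; [exact: affine_cst|exact: affineD].
Qed.

Lemma wedge_polar (l r : R) x : 0 <= l -> l < r -> r <= 1 ->
  (forall k, 0 <= wedge l r k x) ->
  x = 0 \/ exists s k : R, [/\ 0 < s, s <= 1, x = s *: epos a b k,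
    l <= k <= r & [/\ wta a b x + wtb a b x = s & wtb a b x = s * k]].
Proof.
move=> l0 lr r1 /(@wedgeP l r (fun y : R => 0 <= y) x)/= [h0 h1 h2]; have xE := wtE x D0.
set s := wta a b x + wtb a b x in h0 h1 h2.
have s0 : 0 <= s by nra.
move: s0; rewrite le_eqVlt => /orP[/eqP s0|s0].
  left; rewrite xE.
  have e0 : wtb a b x = 0 by move: h0 h1; rewrite -s0 !mulr0; lra.
  have x0 : wta a b x = 0 by move: s0; rewrite /s e0; lra.
  by rewrite e0 x0 !scale0r addr0.
right; exists s, (wtb a b x / s).
have sn : s != 0 by rewrite gt_eqF.
split=> //; first by lra.
- rewrite {1}xE /epos scalerDr !scalerA.
  by congr (_ *: _ + _ *: _); [rewrite /s; field|field].
- by rewrite ler_pdivlMr // ler_pdivrMr //; lra.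
- by split=> //; field.
Qed.

(** The region is spanned by the projected viewpoint and points of the edge, and the domain is
    convex. *)
Lemma wedge_dom (l r : R) x : 0 <= l -> l < r -> r <= 1 ->
  (forall k, 0 <= wedge l r k x) -> dom x.
Proof.
move=> l0 lr r1 /(wedge_polar l0 lr r1)[->|]; first exact: dom0.
move=> [s [k [s0 s1 -> /andP[lk kr] _]]].
have [_ [t tT [at_ bt]]] := ab.
have yd : dom (epos a b k).
  by exists t => //; apply: inT_epos => //; apply/andP; split; lra.
have s01 : 0 <= s <= 1 by rewrite ltW.
by have := dom_conv (dom0 above) yd s01; rewrite scaler0 add0r.
Qed.

Definition evis k := vis (epos a b k) (ehgt a b k).

(* Between two visible points of an edge with an invisible point between them,
   the terrain above the plane through the viewpoint and the edge has a peak
   over the triangle spanned by the viewpoint and the two visible points. *)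
Lemma gap_count m (l z r : 'I_m -> R) :
  (forall i, [/\ 0 <= l i, l i < z i, z i < r i & r i <= 1]) ->
  (forall i, evis (l i) /\ evis (r i)) -> (forall i, ~ evis (z i)) ->
  (forall i j : 'I_m, (i < j)%N -> r i <= l j) -> (m <= prickliness T)%N.
Proof.
move=> ord v nv sep.
have [g gE] := ph_dot a b.
have [t tT [at_ bt]] := ab.2.
(* The obstacle that hides the point [z i] is a point of the terrain above the plane through the
   viewpoint and the edge, over the [i]-th region. *)
have /choice[w wP] : forall i, exists q : {set 'I_n} * 'rV[R]_2,
    [/\ q.1 \in tri T, inT q.1 q.2, (forall k, 0 <= wedge (l i) (r i) k q.2) &
     0 < hgt q.1 q.2 - ph a b q.2].
  move=> i; have [l0 lz zr_ r1] := ord i.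
  have := nv i => /existsNP[s] /existsNP[k] /not_implyP[sT] /not_implyP[/andP[k0 k1]].
  move=> /not_implyP[sd /negP]; rewrite -ltNge => lt.
  exists (s, k *: epos a b (z i)); split=> //=.
    by apply/(@wedgeP _ _ (fun y : R => 0 <= y)); rewrite wtaZ wtbZ wta_epos // wtb_epos //; split; nra.
  by rewrite phZ ph_epos //; lra.
have [B B0 hB] := dom_bounded T p.
(* The perturbation is at most [2 * (e * B)] on the domain; comparing two points doubles this. *)
have [e e0 eP] : exists2 e, 0 < e & forall i,
    0 < (hgt (w i).1 (w i).2 - ph a b (w i).2) + e * (- (4 * B)).
  by apply: small_ex; apply: small_all => i; apply: small_pos; case: (wP i).
pose I2 := {q : 'I_n * 'I_n | q.1 != q.2}.
have [|A [A0 A1 gen]] := @avoid_zeros _ I2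
  (fun q => (zr (val q).1 - ph a b (pos (val q).1)) - (zr (val q).2 - ph a b (pos (val q).2)))
  (fun q => pos (val q).2 - pos (val q).1) e e0.
  by move=> [[i j] /= ij]; rewrite subr_eq0; apply: contra ij => /eqP/pos_inj ->.
have Ab x : dom x -> `|dot A x| <= 2 * (e * B).
  move=> /hB[x0 x1]; rewrite dotE (le_trans (ler_normD _ _)) // !normrM.
  by rewrite mulr2n mulrDl mul1r lerD // ler_pM.
(* The slope of the plane of the edge plus the perturbation. It is the same for all gaps, so all
   peaks are counted in one direction. *)
pose A' := g + A.
have A'E x : dot A' x = ph a b x + dot A x by rewrite gE /A' !dotE !vE; ring.
have gen' u v_ : u != v_ -> zr u - dot A' (pos u) != zr v_ - dot A' (pos v_).
  move=> uv; have := gen (exist _ (u, v_) uv); rewrite /= !A'E.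
  apply: contra => /eqP h; apply/eqP; move: h; rewrite !dotE !addvE !oppvE; lra.
have /choice[pk pkP] : forall i, exists v,
    (forall k, 0 < wedge (l i) (r i) k (pos v)) /\
    forall u, edge u v -> zr u - dot A' (pos u) < zr v - dot A' (pos v).
  move=> i.
  have [l0 lz zr_ r1] := ord i; have lr := lt_trans lz zr_.
  have [w1 w2 w3 w4] := wP i.
  have [|v1 h1 h2] := peak (wedge_affine (l i) (r i)) gen' w1 w2 w3; last by exists v1.
  move=> s x sT sx fx fx0.
  have xd := wedge_dom l0 lr r1 fx.
  have wd := wedge_dom l0 lr r1 w3.
  (* The terrain is nowhere above the plane on the boundary of the region: on the two radial sides
     because their endpoints on the edge are visible, on the third because it is part of the
     edge. *)
  have hx : hgt s x <= ph a b x.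
    case: (wedge_polar l0 lr r1 fx) => [x0|].
      move: sx; rewrite x0 => sx; have -> : ph a b 0 = 0.
        by rewrite -(scale0r (0 : 'rV[R]_2)) phZ mul0r.
      exact: hgt0_le0 sT sx.
    move=> [c [k [c0 c1 xE lkr [h3 h4]]]].
    have c01 : 0 <= c <= 1 by rewrite (ltW c0).
    have pE : ph a b x = c * ehgt a b k by rewrite xE phZ ph_epos.
    have ev : evis k -> hgt s x <= ph a b x.
      by move=> kv; rewrite pE; have := kv s c sT c01; rewrite -xE; exact.
    have c0' := lt0r_neq0 c0.
    move: fx0 => [[[|[|[|//]]] ik]]; rewrite /wedge /= h3 ?h4 => e1.
    - apply: ev; have -> : k = l i by apply: (mulfI c0'); lra.
      by case: (v i).
    - apply: ev; have -> : k = r i by apply: (mulfI c0'); lra.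
      by case: (v i).
    - have c1' : c = 1 by lra.
      move: sx; rewrite pE xE c1' scale1r mul1r => sx.
      have k01 : 0 <= k <= 1.
        by case/andP: lkr => ? ?; apply/andP; split; lra.
      by rewrite -(hgt_epos p k tT at_ bt)
        (hgt_consist sT tT sx (inT_epos p tT at_ bt k01)).
  rewrite !A'E; have := eP i; have := Ab _ xd; have := Ab _ wd.
  rewrite !ler_norml => /andP[? ?] /andP[? ?]; nra.
(* Distinct gaps have disjoint open regions, since [r i <= l j]. *)
have pkinj : injective pk.
  move=> i j ij; apply/eqP; apply: contraT => nij.
  have key (i1 j1 : 'I_m) : (i1 < j1)%N -> pk i1 = pk j1 -> False.
    move=> lt eq; have := (pkP i1).1; have := (pkP j1).1; rewrite eq.
    move=> /(@wedgeP _ _ (fun y : R => 0 < y))/= [x1 x2 x3].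
    move=> /(@wedgeP _ _ (fun y : R => 0 < y))/= [y1 y2 y3].
    have [? ? ? ?] := ord i1; have [? ? ? ?] := ord j1; have := sep _ _ lt.
    nra.
  have : (i < j)%N || (j < i)%N by rewrite -neq_ltn.
  by case/orP => [/key|/key]; [|move: ij => /esym ij]; move=> /(_ ij).
have [q [qx qz]] := lift_point (- A') (1 : R).
apply: leq_trans (prickliness_in_le q); rewrite /prickliness_in.
rewrite -[X in (X <= _)%N]card_ord -(card_imset _ pkinj).
apply/subset_leq_card/fintype.subsetP => _ /imsetP[i _ ->].
rewrite inE; apply/asboolP.
have [h1 h2] := pkP i; have [l0 lz zr_ r1] := ord i.
apply: (peak_counted (wedge_affine (l i) (r i)) _ h1 h2 qx qz) => x fx.
by apply: (wedge_dom l0 (lt_trans lz zr_) r1) => k; exact: ltW.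
Qed.

End OneEdge.

End Gaps.

(** * Starts of visibility along an edge *)

Section Germs.
Variables (R : realType) (n : nat) (T : terrain R n) (p : 'rV[R]_3).
Hypothesis above : on_or_above T p.
Implicit Types (s t : {set 'I_n}) (a b : 'I_n) (d : 'rV[R]_2).

Local Notation pos := (pos T p).
Local Notation zr := (zr T p).
Local Notation inT := (inT T p).
Local Notation hgt := (hgt T p).
Local Notation edge := (edge T).
Local Notation epos := (epos T p).
Local Notation ehgt := (ehgt T p).
Local Notation evis := (evis T p).

(** Everything happens in the vertical plane through the viewpoint and the edge. Let [B] be the
    relative height of the line of the edge at the viewpoint. If [B > 0], either the viewpoint would
    be under the edge, or the nearer of the two visible points would hide the farther one. If
    [B <= 0], an obstacle for [z] off the edge lies under the line of sight to [x] or [y], which is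
    there no higher than the one to [z]; points of the edge itself are no obstacle. *)
Lemma evis_convex_radial a b (x z y : R) : edge a b ->
  cross (pos a) (pos b) = 0 -> 0 <= x -> x < z -> z < y -> y <= 1 ->
  evis a b x -> evis a b y -> evis a b z.
Proof.
move=> [ab [t tT [at_ bt]]] D0 x0 xz zy y1 vx vy.
pose d := pos b - pos a.
have d0 : d != 0 by rewrite subr_eq0; apply: contra ab => /eqP/pos_inj ->.
have [C aC] : exists c, pos a = c *: d.
  by apply: parallel => //; move: D0; rewrite /cross /d !vE => D0; lra.
have bC : pos b = (C + 1) *: d by rewrite scalerDl -aC scale1r /d addrC subrK.
have eE k : epos a b k = (C + k) *: d.
  by rewrite /epos {1}aC bC !scalerA -scalerDl; congr (_ *: _); ring.
have [A [B hE]] : exists A B : R, forall k, ehgt a b k = A * (C + k) + B.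
  exists (zr b - zr a), (zr a - (zr b - zr a) * C) => k.
  by rewrite /ehgt; ring.
have onE s v : s \in tri T -> C <= v <= C + 1 -> inT s (v *: d) ->
    hgt s (v *: d) = A * v + B.
  move=> sT /andP[v0 v1] sv.
  have vE : v *: d = epos a b (v - C) by rewrite eE addrC subrK.
  have k01 : 0 <= v - C <= 1 by apply/andP; split; lra.
  have := inT_epos p tT at_ bt k01; rewrite -vE => tv.
  by rewrite (hgt_consist sT tT sv tv) vE hgt_epos // hE [C + _]addrC subrK.
have onI v : C <= v <= C + 1 -> inT t (v *: d).
  move=> /andP[v0 v1].
  have -> : v *: d = epos a b (v - C) by rewrite eE addrC subrK.
  by apply: inT_epos => //; apply/andP; split; lra.
have vE k : evis a b k <-> forall s l, s \in tri T -> 0 <= l <= 1 ->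
    inT s ((l * (C + k)) *: d) ->
    hgt s ((l * (C + k)) *: d) <= l * (A * (C + k) + B).
  by rewrite /evis /vis; split=> h s l sT l01; have := h s l sT l01;
    rewrite ?eE ?hE scalerA.
move: vx vy => /vE vx /vE vy.
have [q qd] : exists q, q = C + x by exists (C + x).
have [r rd] : exists r, r = C + y by exists (C + y).
rewrite -qd in vx; rewrite -rd in vy.
have [B0|B0] := lerP B 0; last first.
  exfalso.
  have [q0|q0] := lerP q 0.
    have [r0|r0] := lerP 0 r.
      have i0 : inT t (0 *: d) by apply: onI; apply/andP; split; lra.
      have := onE t 0 tT _ i0; rewrite scale0r mulr0 add0r => hb.
      move: i0; rewrite scale0r => i0; have := hgt0_le0 above tT i0.
      rewrite hb; first by lra.
      by apply/andP; split; lra.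
    have qn : q < 0 by lra.
    have l01 : 0 <= r / q <= 1.
      by rewrite -[r / q]divrNN divr_ge0 ?ler_pdivrMr /=; lra.
    have qE : r / q * q = r by rewrite divfK // lt_eqF.
    have rI : C <= r <= C + 1 by apply/andP; split; lra.
    have := vx t (r / q) tT l01; rewrite qE => /(_ (onI _ rI)).
    rewrite (onE _ _ tT rI (onI _ rI)) mulrDr [r / q * (A * q)]mulrCA qE.
    rewrite lerD2l => h.
    have : 1 <= r / q by nra.
    by rewrite -[r / q]divrNN ler_pdivlMr ?oppr_gt0 // mul1r; lra.
  have rp : 0 < r by lra.
  have l01 : 0 <= q / r <= 1.
    by rewrite divr_ge0 ?ler_pdivrMr /= ?(ltW q0) ?(ltW rp) // mul1r; lra.
  have qE : q / r * r = q by rewrite divfK // gt_eqF.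
  have qI : C <= q <= C + 1 by apply/andP; split; lra.
  have := vy t (q / r) tT l01; rewrite qE => /(_ (onI _ qI)).
  rewrite (onE _ _ tT qI (onI _ qI)) mulrDr [q / r * (A * r)]mulrCA qE.
  rewrite lerD2l => h.
  have : 1 <= q / r by nra.
  by rewrite ler_pdivlMr // mul1r; lra.
apply/vE => s l sT /andP[l0 l1].
have [w wd] : exists w, w = C + z by exists (C + z).
have [v vd] : exists v, v = l * w by exists (l * w).
rewrite -wd -vd => sv.
have qw : q < w by lra.
have wr : w < r by lra.
have Cq : C <= q by lra.
have rC : r <= C + 1 by lra.
have [qv|vq] := leP q v; last first.
  have w0 : 0 < w by rewrite ltNge; apply/negP => w0; nra.
  have v0 : 0 <= v by rewrite vd mulr_ge0 // ltW.
  have q0 : 0 < q by lra.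
  have l01 : 0 <= v / q <= 1.
    by rewrite divr_ge0 ?ler_pdivrMr /= ?(ltW q0) // mul1r ltW.
  have qE : v / q * q = v by rewrite divfK // gt_eqF.
  have := vx s (v / q) sT l01; rewrite qE => /(_ sv) h.
  apply: le_trans h _; rewrite !mulrDr [v / q * _]mulrCA qE [l * (A * w)]mulrCA -vd lerD2l.
  suff : l <= v / q by move=> h'; rewrite ler_wnM2r.
  by rewrite ler_pdivlMr // vd ler_wpM2l // ltW.
have [vr|rv] := leP v r; last first.
  have w0 : w < 0 by rewrite ltNge; apply/negP => w0; nra.
  have v0 : v <= 0 by nra.
  have r0 : r < 0 by lra.
  have l01 : 0 <= v / r <= 1.
    by rewrite -[v / r]divrNN divr_ge0 ?ler_pdivrMr /=; lra.
  have qE : v / r * r = v by rewrite divfK // lt_eqF.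
  have := vy s (v / r) sT l01; rewrite qE => /(_ sv) h.
  apply: le_trans h _; rewrite !mulrDr [v / r * _]mulrCA qE [l * (A * w)]mulrCA -vd lerD2l.
  suff : l <= v / r by move=> h'; rewrite ler_wnM2r.
  rewrite -[v / r]divrNN ler_pdivlMr ?oppr_gt0 // vd; nra.
rewrite (onE _ _ sT _ sv); last by apply/andP; split; lra.
rewrite mulrDr mulrCA -vd lerD2l; nra.
Qed.

(** A start of visibility in the direction from [a] to [b]. The alternative [k' < 0] lets visibility
    start at the endpoint [a]: parameters below 0 count as hidden. *)
Definition germ a b (k : R) := [/\ 0 <= k < 1, small (fun e => evis a b (k + e)) &
  forall e, 0 < e -> exists2 k', k - e < k' < k & k' < 0 \/ ~ evis a b k'].

(** Shortly after each germ there is a visible point, and shortly before the next germ a hidden one,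
    so [m.+1] germs enclose [m] gaps. *)
Lemma germ_sorted a b (m : nat) (f : 'I_m.+1 -> R) : edge a b ->
  (forall i, germ a b (f i)) -> (forall i j : 'I_m.+1, (i < j)%N -> f i < f j) ->
  (m <= prickliness T)%N.
Proof.
move=> ab fg fi.
have /choice[X XP] : forall i : 'I_m.+1, exists x : R, [/\ f i < x, x < 1,
    (forall j : 'I_m.+1, (i < j)%N -> x < f j) & evis a b x].
  move=> i; have [/andP[f0 f1] fs _] := fg i.
  have [||x xp [[h1 h2] h3]] := small_ex (small_and (small_and (small_lt (c := 1 - f i) _)
    (small_all (P := fun (j : 'I_m.+1) x => (i < j)%N -> x < f j - f i) _)) fs).
  - by rewrite subr_gt0.
  - move=> j; case: ltnP => [ij|_]; last by apply: smallT.
    have := small_lt (c := f j - f i); rewrite subr_gt0 => /(_ (fi _ _ ij)).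
    by apply: small_imp.
  exists (f i + x); split=> //; try by lra.
  by move=> j /h2; lra.
have /choice[Z ZP] : forall i : 'I_m, exists z, [/\ X (widen_ord (leqnSn m) i) < z,
    z < f (lift ord0 i) & ~ evis a b z].
  move=> i; set i0 := widen_ord _ i; set i1 := lift ord0 i.
  have [/andP[f0 f1] _ fz] := fg i1.
  have [x1 x2 x3 x4] := XP i0.
  have lt : (i0 < i1)%N by rewrite /= /bump.
  have [|z /andP[z1 z2] z3] := fz (f i1 - X i0); first by rewrite subr_gt0 x3.
  exists z; split=> //; first by lra.
  case: z3 => // z0; have [/andP[g0 _] _ _] := fg i0; lra.
have xlt (i : 'I_m.+1) : 0 <= X i.
  by have [/andP[f0 _] _ _] := fg i; have [h _ _ _] := XP i; lra.
have [D0|D0] := eqVneq (cross (pos a) (pos b)) 0; last first.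
  apply: (gap_count above ab D0 (l := fun i => X (widen_ord (leqnSn m) i))
    (z := Z) (r := fun i => X (lift ord0 i))).
  - move=> i; have [z1 z2 z3] := ZP i; have [x1 x2 x3 x4] := XP (lift ord0 i).
    by split=> //; lra.
  - by move=> i; split; [have [] := XP (widen_ord (leqnSn m) i)|
      have [] := XP (lift ord0 i)].
  - by move=> i; have [] := ZP i.
  - move=> i j ij; have := leqnn i.
    set i1 := lift ord0 i; set j0 := widen_ord _ j.
    have : (i1 <= j0)%N by rewrite /= /bump.
    rewrite leq_eqVlt => /orP[/eqP/val_inj -> //|lt].
    have [x1 x2 x3 x4] := XP i1; have [y1 y2 y3 y4] := XP j0.
    by have := x3 _ lt; lra.
case: m f fg fi X XP Z ZP xlt => [//|m] f fg fi X XP Z ZP xlt; exfalso.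
pose i : 'I_m.+1 := ord0.
have [z1 z2 z3] := ZP i; have [x1 x2 x3 x4] := XP (lift ord0 i).
have [y1 y2 y3 y4] := XP (widen_ord (leqnSn m.+1) i).
apply: z3; apply: (evis_convex_radial ab D0 (xlt _) z1 _ _ y4 x4); lra.
Qed.

Lemma germ_size a b (s : seq R) : edge a b -> uniq s ->
  (forall k, k \in s -> germ a b k) -> (size s <= (prickliness T).+1)%N.
Proof.
move=> ab us sg; case sE : (size s) => [//|m]; rewrite ltnS.
pose s' := sort <=%R s.
have ss' : size s' = m.+1 by rewrite size_sort.
apply: (germ_sorted (f := fun i : 'I_m.+1 => nth 0 s' i) ab).
  by move=> i; apply: sg; rewrite -(mem_sort <=%R) mem_nth // ss'.
have : sorted <%R s'.
  by rewrite lt_sorted_uniq_le sort_uniq us sort_sorted //; exact: le_total.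
move=> so i j ij; apply: (sorted_ltn_nth lt_trans) => //.
  by rewrite inE ss'.
by rewrite inE ss'.
Qed.

(** The bound on duplicate-free lists of germs provides a longest one, and a longest list contains
    every germ. *)
Lemma germ_enum a b : edge a b -> exists g : 'I_(prickliness T).+1 -> R,
  forall k, germ a b k -> exists i, g i = k.
Proof.
move=> ab.
pose P m := `[< exists s : seq R, [/\ uniq s, size s = m & forall k, k \in s -> germ a b k] >].
have P0 : exists m, P m by exists 0%N; apply/asboolP; exists [::].
have Pb m : P m -> (m <= (prickliness T).+1)%N.
  by move=> /asboolP[s [us <- sg]]; exact: germ_size sg.
case: (ex_maxnP P0 Pb) => m /asboolP[s [us sm sg]] mmax.
exists (fun i => nth 0 s i) => k gk.
have ks : k \in s.
  apply: contraT => ks; have : P m.+1.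
    apply/asboolP; exists (k :: s); rewrite /= ks us sm; split=> // l.
    by rewrite inE => /orP[/eqP ->|/sg].
  by move=> /mmax; rewrite ltnn.
have lt : (index k s < (prickliness T).+1)%N.
  by rewrite (leq_trans _ (germ_size ab us sg)) // index_mem.
by exists (Ordinal lt); rewrite /= nth_index.
Qed.

End Germs.

(** * The number of triangles *)

Section TriangleCount.
Variables (R : realType) (n : nat) (T : terrain R n).
Implicit Types (s t : {set 'I_n}) (a b i j : 'I_n).

Local Notation pos := (pos T 0).
Local Notation bc := (bc T 0).
Local Notation epos := (epos T 0).

Lemma sort3 (S : {set 'I_n}) (f : 'I_n -> R) : injective f -> #|S| = 3%N ->
  exists a m b, [/\ f a < f m, f m < f b & S = [set a; m; b]%SET].
Proof.
move=> fi /set3P[a [b [c [ab ac bc ->]]]].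
have key u v w : u != v -> u != w -> v != w -> f u < f v ->
    exists a' m b', [/\ f a' < f m, f m < f b' &
      [set u; v; w]%SET = [set a'; m; b']%SET].
  move=> uv uw vw lt.
  have ne1 : f u != f w by apply: contra uw => /eqP/fi ->.
  have ne2 : f v != f w by apply: contra vw => /eqP/fi ->.
  have [h1|h1|/eqP] := ltgtP (f v) (f w); last by rewrite (negbTE ne2).
    by exists u, v, w.
  have [h2|h2|/eqP] := ltgtP (f u) (f w); last by rewrite (negbTE ne1).
    by exists u, w, v; split=> //; apply/setP => i; rewrite !inE orbAC.
  exists w, u, v; split=> //; apply/setP => i; rewrite !inE.
  by case: (i == u); case: (i == v); case: (i == w).
have ne : f a != f b by apply: contra ab => /eqP/fi ->.
have [h|h|/eqP] := ltgtP (f a) (f b); last by rewrite (negbTE ne).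
  exact: key.
have -> : [set a; b; c]%SET = [set b; a; c]%SET.
  by apply/setP => i; rewrite !inE [(i == a) || _]orbC.
by apply: key => //; rewrite eq_sym.
Qed.

(* With respect to a linear functional separating the vertices, a triangle has
   a middle vertex, and contains the points near it on one side of its level
   line. The triangle is determined by this vertex and this side. *)
Lemma tri_count : (#|tri T| <= n * 2)%N.
Proof.
pose I2 := {q : 'I_n * 'I_n | q.1 != q.2}.
have [|A [_ _ gen]] := @avoid_zeros _ I2 (fun=> 0)
  (fun q => pos (val q).2 - pos (val q).1) 1 ltr01.
  by move=> [[i j] /= ij]; rewrite subr_eq0; apply: contra ij => /eqP/pos_inj ->.
have Li : injective (fun i => dot A (pos i)).
  move=> i j ij; apply/eqP; apply: contraT => nij.
  have := gen (exist _ (i, j) nij); rewrite /= add0r.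
  move: ij; rewrite !dotE !addvE !oppvE => ij.
  by move=> /eqP[]; lra.
have [->|/finset.set0Pn[t0 t0T]] := eqVneq (tri T) finset.set0; first by rewrite cards0.
have [i0 _] := set3P (tri_card t0T).
have /choice[key keyP] : forall t, exists k : 'I_n * bool, t \in tri T ->
    small (fun e => forall i, i \in t ->
      0 < bc t i (pos k.1 + (if k.2 then e else - e) *: perp A)).
  move=> t; case: (boolP (t \in tri T)) => tT; last by exists (i0, true).
  have [a [m [b [am mb tE]]]] := sort3 Li (tri_card tT).
  have [at_ mt bt] : [/\ a \in t, m \in t & b \in t].
    by rewrite tE !inE !eqxx !orbT.
  have ma : m != a by apply: contraTneq am => ->; rewrite ltxx.
  have mb' : m != b by apply: contraTneq mb => ->; rewrite ltxx.
  have ab : a != b.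
    by apply: contraTneq (lt_trans am mb) => ->; rewrite ltxx.
  have Lab : 0 < dot A (pos b) - dot A (pos a) by lra.
  (* [epos a b k] is the point of the opposite side on the level line of the middle vertex [m], so
     [w] is parallel to [perp A] and points into the triangle. *)
  pose k := (dot A (pos m) - dot A (pos a)) / (dot A (pos b) - dot A (pos a)).
  have k0 : 0 < k by rewrite divr_gt0 // subr_gt0.
  have k1 : k < 1 by rewrite ltr_pdivrMr // mul1r; lra.
  pose w := epos a b k - pos m.
  have A0 : A != 0.
    by apply: contraTneq am => ->; rewrite !dotE !zerovE !mul0r ltxx.
  have rA0 : perp A != 0.
    apply: contra A0 => /eqP h; apply/eqP; apply: vecP.
      by have := perpE A => -[_ <-]; rewrite h !zerovE.
    by have := perpE A => -[h0 _]; rewrite -[LHS]opprK -h0 h !zerovE oppr0.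
  have [c wc] : exists c, w = c *: perp A.
    apply: parallel => //.
    have kE : k * (dot A (pos b) - dot A (pos a)) = dot A (pos m) - dot A (pos a).
      by rewrite /k divfK // gt_eqF.
    move: kE; rewrite /cross !perpE /w /epos !dotE.
    rewrite !addvE !oppvE !scalevE; lra.
  have bw i : bc t i (pos m + w) = (1 - k) * (i == a)%:R + k * (i == b)%:R.
    by rewrite /w addrC subrK bc_epos.
  have c0 : c != 0.
    apply/eqP => c0; have := bw m; rewrite wc c0 scale0r addr0 inT_pos //.
    by rewrite eqxx (negbTE ma) (negbTE mb') !mulr0 addr0 => /eqP; rewrite oner_eq0.
  have pos_e (e : R) : 0 < e -> e < 1 -> forall i, i \in t ->
      0 < bc t i (pos m + e *: w).
    move=> e0 e1 i it; rewrite affine_line; last exact: bc_affine.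
    rewrite bw inT_pos //; move: it; rewrite tE !inE -orbA => /or3P[]/eqP ->.
    - by rewrite eqxx [a == m]eq_sym (negbTE ma) (negbTE ab) /=; nra.
    - by rewrite eqxx (negbTE ma) (negbTE mb') /=; nra.
    - by rewrite eqxx [b == m]eq_sym (negbTE mb') [b == a]eq_sym (negbTE ab) /=; nra.
  exists (m, 0 < c) => _ /=; exists `|c|; first by rewrite normr_gt0.
  move=> e /andP[e0 ec] i it.
  have -> : (if 0 < c then e else - e) *: perp A = (e / `|c|) *: w.
    rewrite wc scalerA; congr (_ *: _); case: ltrP => hc.
      by rewrite gtr0_norm // divfK // gt_eqF.
    by rewrite ler0_norm // invrN mulrN mulNr divfK.
  apply: pos_e it; first by rewrite divr_gt0 // normr_gt0.
  by rewrite ltr_pdivrMr ?normr_gt0 // mul1r.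
(* Two triangles with the same key have a common interior point. *)
have inj : {in tri T &, injective key}.
  move=> s t sT tT st; have hs := keyP s sT; have := keyP t tT; rewrite -st => ht.
  have [e e0 [h1 h2]] := small_ex (small_and hs ht).
  exact: inT_interior_uniq sT tT h1 h2.
rewrite -(card_in_imset inj) (leq_trans (max_card _)) //.
by rewrite card_prod card_ord card_bool.
Qed.

End TriangleCount.

(** * Corners of components of a closed semilinear set *)

Section PlaneTopology.
Variable R : realType.
Implicit Types (u v w x y d : 'rV[R]_2) (e r s : R).

Definition box r w := `|w 0 0| < r /\ `|w 0 1| < r.

Lemma affine_near (f : 'rV[R]_2 -> R) x : affine f -> 0 < f x ->
  \forall y \near x, 0 < f y.
Proof.
move=> fa fx; have := affine_continuous fa.
by move=> /(_ x [set y | 0 < y]); apply; exact: lt_nbhsr.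
Qed.

Lemma box_near x r : 0 < r -> \forall y \near x, box r (y - x).
Proof.
move=> r0.
pose L y (k : 'I_4) := nth 0 [:: r - (y - x) 0 0; r + (y - x) 0 0;
  r - (y - x) 0 1; r + (y - x) 0 1] k.
have bE y : (forall k, 0 < L y k) -> box r (y - x).
  move=> h.
  have h0 := h (@Ordinal 4 0 isT); have h1 := h (@Ordinal 4 1 isT).
  have h2 := h (@Ordinal 4 2 isT); have h3 := h (@Ordinal 4 3 isT).
  move: h0 h1 h2 h3; rewrite /L /= => h0 h1 h2 h3.
  by split; rewrite ltr_norml; apply/andP; split; lra.
have : \forall y \near x, forall k, 0 < L y k.
  apply: (@filter_forall _ 'I_4 (fun k y => 0 < L y k) (nbhs x)
    (nbhs_filter _)) => k.
  apply: (@affine_near (L ^~ k)); last first.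
    rewrite /L.
    by case: k => [[|[|[|[|//]]]] i] /=; rewrite subrr zerovE ?subr0 ?addr0.
  have a0 : affine (fun y : 'rV[R]_2 => y 0 0).
    by exists (\row_j (j == 0)%:R), 0 => y; rewrite dotE !mxE /=; ring.
  have a1 : affine (fun y : 'rV[R]_2 => y 0 1).
    by exists (\row_j (j == 1)%:R), 0 => y; rewrite dotE !mxE /=; ring.
  have c := affine_cst r.
  have b0 := @affine_sub _ _ x a0; have b1 := @affine_sub _ _ x a1.
  by case: k => [[|[|[|[|//]]]] i]; rewrite /L /=;
    [exact: (affineB c b0)|exact: (affineD c b0)|
     exact: (affineB c b1)|exact: (affineD c b1)].
by apply: filterS => y; exact: bE.
Qed.

Lemma nbhs_box x (S : set 'rV[R]_2) : nbhs x S ->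
  exists2 r, 0 < r & forall w, box r w -> S (x + w).
Proof.
move=> /nbhs_ballP[e /= e0 h]; exists e => // w [w0 w1]; apply: h.
split=> // i j; rewrite (ord1 i) /ball /= mxE opprD addNKr normrN.
by case: j => [[|[|//]] j] /=; [rewrite (_ : Ordinal j = 0)|
  rewrite (_ : Ordinal j = 1)] => //; exact/val_inj.
Qed.

Lemma box_nbhs x r (S : set 'rV[R]_2) : 0 < r ->
  (forall w, box r w -> S (x + w)) -> nbhs x S.
Proof.
by move=> r0 h; apply: filterS (box_near x r0) => y /h; rewrite addrC subrK.
Qed.

Lemma box_scale r k w : box r w -> 0 <= k <= 1 -> box r (k *: w).
Proof.
move=> [h0 h1] /andP[k0 k1]; split; rewrite scalevE normrM ger0_norm //.
  by rewrite (le_lt_trans _ h0) // ler_piMl.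
by rewrite (le_lt_trans _ h1) // ler_piMl.
Qed.

Lemma box_small r w : 0 < r -> small (fun e => box r (e *: w)).
Proof.
move=> r0; have key (k : R) : small (fun e => `|e * k| < r).
  have := small_pos (- `|k|) r0; apply: small_imp => e e0.
  by rewrite normrM gtr0_norm // mulrN subr_gt0.
by have := small_and (key (w 0 0)) (key (w 0 1)); apply: small_imp => e e0 [h1 h2];
  split; rewrite scalevE.
Qed.

Lemma box_small_add r w v : box r w -> small (fun e => box r (w + e *: v)).
Proof.
move=> [h0 h1].
have key (k l : R) : `|k| < r -> small (fun e => `|k + e * l| < r).
  move=> kr; have : 0 < r - `|k| by rewrite subr_gt0.
  move=> /(small_pos (- `|l|)); apply: small_imp => e e0.
  rewrite mulrN => h; rewrite (le_lt_trans (ler_normD _ _)) // normrM.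
  by rewrite gtr0_norm // ?e0 // in h *; lra.
by have := small_and (key _ (v 0 0) h0) (key _ (v 0 1) h1);
  apply: small_imp => e e0 [h2 h3]; split; rewrite addvE scalevE.
Qed.

(** Near [x], [S] contains a thin open sector along the half-line in direction [u], on the side of
    [v]. The weak bounds allow [s = k = e], which is how two sectors are shown to meet. *)
Definition thin (S : set 'rV[R]_2) x u v :=
  small (fun e => forall s k, 0 < s -> s <= e -> 0 < k -> k <= e ->
    S (x + s *: (u + k *: v))).

Lemma thinP S x u v : thin S x u v <-> exists2 e, 0 < e &
  forall s k : R, 0 < s < e -> 0 < k < e -> S (x + s *: (u + k *: v)).
Proof.
split=> [/small_ex[e e0 h]|[e e0 h]].
  exists e => // s k /andP[s0 se] /andP[k0 ke]; apply: h => //; exact: ltW.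
exists e => // f /andP[f0 fe] s k s0 sf k0 kf.
by apply: h; apply/andP; split=> //; [apply: le_lt_trans fe|apply: le_lt_trans fe].
Qed.

Lemma thin_and (S S' : set 'rV[R]_2) x u v : thin S x u v -> thin S' x u v ->
  exists s k, [/\ 0 < s, 0 < k, S (x + s *: (u + k *: v)) &
    S' (x + s *: (u + k *: v))].
Proof.
move=> h1 h2; have [e e0 [h3 h4]] := small_ex (small_and h1 h2).
by exists e, e; split => //; [apply: h3|apply: h4].
Qed.

Lemma thin_sub (S S' : set 'rV[R]_2) x u v : S `<=` S' -> thin S x u v ->
  thin S' x u v.
Proof. by move=> SS; apply: small_imp => e _ h *; apply: SS; apply: h. Qed.

(** Only the half-line of [u] and the side of [v] matter: a different choice reparametrizes points
    of the same sector. *)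
Lemma thin_change S x u v (c k l : R) : 0 < c -> 0 < l -> thin S x u v ->
  thin S x (c *: u) (k *: u + l *: v).
Proof.
move=> c0 l0 /thinP[e e0 h].
have [f f0 [[h1 h2] [h3 f1]]] : exists2 f, 0 < f & (0 < e + f * (- (c + `|k|)) /\
    0 < e * c + f * (- (l + e * `|k|))) /\ (0 < c + f * (- `|k|) /\ f < 1).
  apply: small_ex; apply: small_and; apply: small_and; try exact: small_pos.
    by apply: small_pos; rewrite mulr_gt0.
  exact: small_lt.
apply/thinP; exists f => // s m /andP[s0 sf] /andP[m0 mf].
have mk : `|m * k| <= m * `|k| by rewrite normrM gtr0_norm.
have kk := normr_ge0 k.
have /andP[mk1 mk2] : - (m * `|k|) <= m * k <= m * `|k| by rewrite -ler_norml.
have g0 : 0 < c + m * k by nra.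
pose g := c + m * k.
have -> : s *: (c *: u + m *: (k *: u + l *: v)) =
    (s * g) *: (u + (m * l / g) *: v).
  have g0' : g != 0 by rewrite gt_eqF.
  by apply: vecP; rewrite !vE; move: g0'; rewrite /g => g0'; field.
have s1 : s * g < e.
  have : s * g <= s * (c + `|k|).
    rewrite ler_wpM2l ?(ltW s0) // /g lerD2l (le_trans mk2) // ler_piMl //.
    by rewrite ltW // (lt_trans mf).
  have : s * (c + `|k|) <= f * (c + `|k|).
    by rewrite ler_wpM2r ?(ltW sf) // addr_ge0 // ltW.
  by lra.
have s2 : m * l < e * g.
  have : m * (l + e * `|k|) <= f * (l + e * `|k|).
    by rewrite ler_wpM2r ?(ltW mf) // addr_ge0 ?mulr_ge0 // ltW.
  have : e * (- (m * `|k|)) <= e * (m * k) by rewrite ler_wpM2l // ltW.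
  by rewrite /g; lra.
apply: h; first by rewrite mulr_gt0.
by rewrite divr_gt0 ?mulr_gt0 //= ltr_pdivrMr.
Qed.

End PlaneTopology.

Section Corner.
Variables (R : realType) (I : finType) (f : I -> 'rV[R]_2 -> R).
Variables (V C : set 'rV[R]_2).
Hypothesis fa : forall i, affine (f i).
(** [V] is semilinear: the signs of the functions [f i] decide membership. [C] stands for a
    component of the interior of [V], and the connectedness is used in the form of [Cseg]. *)
Hypothesis Vf : forall x y, (forall i, Num.sg (f i x) = Num.sg (f i y)) ->
  V x -> V y.
Hypothesis Vcl : closed V.
Hypothesis CV : C `<=` interior V.
Hypothesis Cseg : forall x y, C x ->
  (forall k : R, 0 <= k <= 1 -> interior V ((1 - k) *: x + k *: y)) -> C y.
Implicit Types (u v w x y d : 'rV[R]_2) (e r s k : R).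

(* The half-line from [x] in direction [u] bounds [C], on the side of [v]. *)
Definition bray x u v := [/\ cross u v != 0, thin C x u v & thin (~` V) x u (- v)].

Lemma C_open x : C x -> exists2 r, 0 < r & forall w, box r w -> C (x + w).
Proof.
move=> Cx; have /nbhs_box[r r0 h] : nbhs x (interior V).
  by apply: nbhs_interior; exact: CV.
exists r => // w wr; apply: Cseg Cx _ => k k01.
have -> : (1 - k) *: x + k *: (x + w) = x + k *: w.
  by apply: vecP; rewrite !vE; ring.
by apply: h; apply: box_scale.
Qed.

(** The strict inequalities cut out an open convex subset of [V], so the segment from [x] to [y]
    stays in the interior of [V]. *)
Lemma C_convex_region (J : finType) (g : J -> 'rV[R]_2 -> R) x y :
  (forall j, affine (g j)) -> (forall z, (forall j, 0 < g j z) -> V z) ->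
  (forall j, 0 < g j x) -> (forall j, 0 < g j y) -> C x -> C y.
Proof.
move=> ga gV gx gy Cx; apply: Cseg Cx _ => k /andP[k0 k1].
have h : forall j, 0 < g j ((1 - k) *: x + k *: y).
  move=> j; rewrite affine_conv //; have hx := gx j; have hy := gy j.
  have [->|k0'] := eqVneq k 0; first by lra.
  have kp : 0 < k by rewrite lt_def k0'.
  have h1 : 0 < k * g j y by rewrite mulr_gt0.
  have h2 : 0 <= (1 - k) * g j x by rewrite mulr_ge0 ?subr_ge0 // ltW.
  by lra.
have : \forall z \near (1 - k) *: x + k *: y, forall j, 0 < g j z.
  by apply: (@filter_forall _ J (fun j z => 0 < g j z) (nbhs _)
    (nbhs_filter _)) => j; exact: affine_near.
by apply: filterS => z; exact: gV.
Qed.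

Section AtPoint.
Variable x0 : 'rV[R]_2.

(** A function that vanishes at [x0] is linear in the displacement, and any other keeps its sign
    near [x0]. *)
Lemma conic : exists2 r, 0 < r & forall w k, box r w -> 0 < k -> k <= 1 ->
  forall i, Num.sg (f i (x0 + w)) = Num.sg (f i (x0 + k *: w)).
Proof.
suff : small (fun r => forall i w k, box r w -> 0 < k -> k <= 1 ->
    Num.sg (f i (x0 + w)) = Num.sg (f i (x0 + k *: w))).
  by move=> /small_ex[r r0 h]; exists r => // w k wr k0 k1 i; exact: h.
apply: small_all => i; have [a [b fE]] := fa i.
have fwE w k : f i (x0 + k *: w) = f i x0 + k * dot a w.
  by rewrite !fE !dotE !vE; ring.
have [f0|f0] := eqVneq (f i x0) 0.
  apply: smallT => r r0 w k wr k0 k1; rewrite fwE -[w in LHS]scale1r fwE f0.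
  by rewrite !add0r mul1r sgrM (gtr0_sg k0) mul1r.
have g0 : 0 < `|f i x0| by rewrite normr_gt0.
have := small_pos (- (`|a 0 0| + `|a 0 1|)) g0.
apply: small_imp => r r0 h w k [w0 w1] k0 k1.
have dw : `|dot a w| < `|f i x0|.
  rewrite dotE (le_lt_trans (ler_normD _ _)) // !normrM.
  have : `|a 0 0| * `|w 0 0| <= `|a 0 0| * r by rewrite ler_wpM2l // ltW.
  have : `|a 0 1| * `|w 0 1| <= `|a 0 1| * r by rewrite ler_wpM2l // ltW.
  by lra.
rewrite fwE -[w in LHS]scale1r fwE mul1r.
have kd : `|k * dot a w| < `|f i x0|.
  by rewrite normrM gtr0_norm // (le_lt_trans _ dw) // ler_piMl.
have [fp|fn] := ltrP 0 (f i x0).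
  move: dw kd; rewrite (gtr0_norm fp) !ltr_norml => /andP[? ?] /andP[? ?].
  by rewrite !gtr0_sg //; lra.
have {}fn : f i x0 < 0 by rewrite lt_neqAle f0.
move: dw kd; rewrite (ltr0_norm fn) !ltr_norml => /andP[? ?] /andP[? ?].
by rewrite !ltr0_sg //; lra.
Qed.

(** By [conic], scaling towards [x0] preserves [V] near [x0], hence also its interior, and so the
    segment joining the two points stays there. *)
Lemma C_conic : exists2 r, 0 < r & forall w k, box r w -> 0 < k -> k <= 1 ->
  (C (x0 + w) <-> C (x0 + k *: w)).
Proof.
have [r r0 hr] := conic; exists r => // w k wr k0 k1.
have Vk w' k' : box r w' -> 0 < k' -> k' <= 1 -> V (x0 + w') <-> V (x0 + k' *: w').
  by move=> ? ? ?; split; apply: Vf => i; [|apply/esym]; exact: hr.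
have kn : k != 0 by rewrite gt_eqF.
have nb : nbhs (x0 + w) [set y | box r (y - x0)].
  have [e e0 h] := small_ex (box_small_add 0 wr).
  have [q q0 hq] : exists2 q, 0 < q & forall w', box q w' -> box r (w + w').
    move: wr => [w0 w1]; exists (Order.min (r - `|w 0 0|) (r - `|w 0 1|)).
      by rewrite lt_min !subr_gt0 w0.
    move=> w' [h0 h1]; move: h0 h1; rewrite !lt_min => /andP[h0 _] /andP[_ h1].
    by split; rewrite addvE (le_lt_trans (ler_normD _ _)) //; lra.
  by apply: (box_nbhs q0) => w' /hq; rewrite /= -[x0 + w + w']addrA [x0 + _ - _]addrAC subrr add0r.
have int1 : interior V (x0 + w) -> forall k', 0 < k' -> k' <= 1 ->
    interior V (x0 + k' *: w).
  move=> iV k' k'0 k'1; have nV : nbhs (x0 + w) (V `&` [set y | box r (y - x0)]) by exact: filterI.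
  have [q q0 h] := nbhs_box nV.
  have kq : 0 < k' * q by rewrite mulr_gt0.
  apply: (box_nbhs kq) => w' [h0 h1].
  have kn' : k' != 0 by rewrite gt_eqF.
  have -> : x0 + k' *: w + w' = x0 + k' *: (w + k'^-1 *: w').
    by rewrite scalerDr scalerA mulfV // scale1r addrA.
  have bq : box q (k'^-1 *: w').
    by split; rewrite scalevE normrM gtr0_norm ?invr_gt0 // ltr_pdivrMl.
  have [h2 h3] := h _ bq; apply: (Vk _ _ _ k'0 k'1).1; last by rewrite addrA.
  by move: h3; rewrite /= -[x0 + w + _]addrA [x0 + _ - _]addrAC subrr add0r.
have int2 : interior V (x0 + k *: w) -> interior V (x0 + w).
  move=> iV; have [q q0 h] := nbhs_box (iV : nbhs _ V).
  have : nbhs (x0 + w) ([set y | box q (y - (x0 + w))] `&` [set y | box r (y - x0)]).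
    by apply: filterI => //; exact: box_near.
  apply: filterS => y [yq yr].
  have -> : y = x0 + (y - x0) by rewrite addrC subrK.
  apply: (Vk _ _ yr k0 k1).2.
  have -> : x0 + k *: (y - x0) = x0 + k *: w + k *: (y - (x0 + w)).
    by apply: vecP; rewrite !vE; ring.
  by apply: h; apply: box_scale => //; rewrite (ltW k0).
split=> hC.
  apply: (Cseg hC) => k' /andP[k'0 k'1].
  have -> : (1 - k') *: (x0 + w) + k' *: (x0 + k *: w) =
      x0 + (1 - k' + k' * k) *: w by apply: vecP; rewrite !vE; ring.
  by apply: int1; [exact: CV|nra|nra].
apply: (Cseg hC) => k' /andP[k'0 k'1].
have -> : (1 - k') *: (x0 + k *: w) + k' *: (x0 + w) =
    x0 + ((1 - k') * k + k') *: w by apply: vecP; rewrite !vE; ring.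
by apply: int1; [apply: int2; exact: CV|nra|nra].
Qed.

(** Scaling reduces the claim to the fixed distance [rho]. There each function is affine in [k] and
    has a constant sign for small [k > 0]. *)
Lemma thin_sign u v : small (fun e => forall i s k s' k',
  0 < s -> s <= e -> 0 < k -> k <= e -> 0 < s' -> s' <= e -> 0 < k' -> k' <= e ->
  Num.sg (f i (x0 + s *: (u + k *: v))) = Num.sg (f i (x0 + s' *: (u + k' *: v)))).
Proof.
have [r r0 hr] := conic.
pose rho := r / (`|u 0 0| + `|u 0 1| + `|v 0 0| + `|v 0 1| + 1).
have den : 0 < `|u 0 0| + `|u 0 1| + `|v 0 0| + `|v 0 1| + 1.
  by rewrite ltr_wpDl // !addr_ge0.
have rho0 : 0 < rho by rewrite divr_gt0.
have bx s k : 0 < s -> s <= rho -> 0 < k -> k <= 1 -> box r (s *: (u + k *: v)).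
  move=> s0 sr k0 k1; have sd : s * (`|u 0 0| + `|u 0 1| + `|v 0 0| + `|v 0 1| + 1) <= r.
    by rewrite -ler_pdivlMr.
  have key j : `|u 0 j| + `|v 0 j| <= `|u 0 0| + `|u 0 1| + `|v 0 0| + `|v 0 1| ->
      `|(s *: (u + k *: v)) 0 j| < r.
    move=> hj; rewrite !vE normrM gtr0_norm //.
    rewrite (lt_le_trans _ sd) // ltr_pM2l // (le_lt_trans (ler_normD _ _)) //.
    rewrite normrM gtr0_norm //.
    have : k * `|v 0 j| <= `|v 0 j| by rewrite ler_piMl.
    by lra.
  have n1 := normr_ge0 (u 0 0); have n2 := normr_ge0 (u 0 1).
  have n3 := normr_ge0 (v 0 0); have n4 := normr_ge0 (v 0 1).
  by split; apply: key; lra.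
have sc s k s' : 0 < s -> s <= rho -> 0 < s' -> s' <= rho -> 0 < k -> k <= 1 ->
    forall i, Num.sg (f i (x0 + s *: (u + k *: v))) =
      Num.sg (f i (x0 + s' *: (u + k *: v))).
  have key a b : 0 < a -> a <= b -> b <= rho -> 0 < k -> k <= 1 ->
      forall i, Num.sg (f i (x0 + b *: (u + k *: v))) =
        Num.sg (f i (x0 + a *: (u + k *: v))).
    move=> a0 ab br k0 k1 i; have b0 : 0 < b by lra.
    rewrite (hr _ (a / b) (bx _ _ b0 br k0 k1)) ?divr_gt0 ?ler_pdivrMr ?mul1r //.
    by rewrite scalerA divfK // gt_eqF.
  move=> s0 sr s'0 s'r k0 k1 i; case: (lerP s s') => h; first exact/esym/key.
  by apply: key => //; exact: ltW.
have cst i : small (fun e => forall k k', 0 < k -> k <= e -> 0 < k' -> k' <= e ->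
    Num.sg (f i (x0 + rho *: (u + k *: v))) = Num.sg (f i (x0 + rho *: (u + k' *: v)))).
  have [a [b fE]] := fa i.
  pose A := f i (x0 + rho *: u); pose B := rho * dot a v.
  have fk k : f i (x0 + rho *: (u + k *: v)) = A + k * B.
    by rewrite /A /B !fE !dotE !vE; ring.
  have [A0|A0] := eqVneq A 0.
    apply: smallT => e e0 k k' k0 _ k'0 _.
    by rewrite !fk A0 !add0r !sgrM (gtr0_sg k0) (gtr0_sg k'0).
  have := small_pos (- `|B|) (_ : 0 < `|A|); rewrite normr_gt0 => /(_ A0).
  apply: small_imp => e e0 h.
  have key k : 0 < k -> k <= e -> Num.sg (A + k * B) = Num.sg A.
    move=> k0 ke; have : `|k * B| < `|A|.
      rewrite normrM gtr0_norm //.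
      have : k * `|B| <= e * `|B| by rewrite ler_wpM2r.
      by lra.
    have [Ap|An] := ltrP 0 A.
      by rewrite (gtr0_norm Ap) ltr_norml => /andP[? ?]; rewrite !gtr0_sg //; lra.
    have {}An : A < 0 by rewrite lt_neqAle A0.
    by rewrite (ltr0_norm An) ltr_norml => /andP[? ?]; rewrite !ltr0_sg //; lra.
  by move=> k k' *; rewrite !fk !key.
have := small_and (small_and (small_lt rho0) (small_lt ltr01)) (small_all cst).
apply: small_imp => e e0 [[er e1] h] i s k s' k' s0 se k0 ke s'0 s'e k'0 k'e.
rewrite (sc s k rho) ?lexx //; try lra.
rewrite (sc s' k' rho) ?lexx //; try lra.
exact: h.
Qed.

Lemma thinV_dec u v : thin V x0 u v \/ thin (~` V) x0 u v.
Proof.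
have [e e0 h] := small_ex (thin_sign u v).
have [h1|h1] := pselect (V (x0 + e *: (u + e *: v))); [left|right].
  exists e => // e' /andP[e'0 e'e] s k s0 se k0 ke; apply: Vf h1 => i.
  by apply: h => //; lra.
exists e => // e' /andP[e'0 e'e] s k s0 se k0 ke; apply: contra_not h1.
by apply: Vf => i; apply: h => //; lra.
Qed.

(* Affine inequalities make it plain that an open sector is open and convex. *)
Definition sector u v (l e : R) (j : 'I_4) y : R :=
  let s := cross (y - x0) v / cross u v in
  let q := cross u (y - x0) / cross u v in
  nth 0 [:: s; e - s; q - l * s; e * s - q] j.

Lemma sector_affine u v l e j : affine (sector u v l e j).
Proof.
have s : affine (fun y => cross (y - x0) v / cross u v).
  apply: affineM; exact: (@affine_sub _ _ x0 (affine_crossl v)).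
have q : affine (fun y => cross u (y - x0) / cross u v).
  apply: affineM; exact: (@affine_sub _ _ x0 (affine_crossr u)).
have mulC (c : R) (g : 'rV[R]_2 -> R) : affine g -> affine (fun y => c * g y).
  by move=> ga; under eq_fun do rewrite mulrC; exact: affineM.
case: j => [[|[|[|[|//]]]] i]; rewrite /sector /=.
- exact: s.
- exact: (affineB (affine_cst e) s).
- exact: (affineB q (mulC l _ s)).
- exact: (affineB (mulC e _ s) q).
Qed.

Lemma sectorP u v l e y : cross u v != 0 -> (forall j, 0 < sector u v l e j y) <->
  exists s k, [/\ 0 < s < e, l < k < e & y = x0 + s *: (u + k *: v)].
Proof.
move=> D0; split=> [h|[s [k [/andP[s0 se] /andP[lk ke] ->]]] j].
  have := h (@Ordinal 4 0 isT); have := h (@Ordinal 4 1 isT).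
  have := h (@Ordinal 4 2 isT); have := h (@Ordinal 4 3 isT).
  rewrite /sector /=; set s := cross (y - x0) v / _; set q := cross u _ / _.
  move=> h3 h2 h1 h0; have sn : s != 0 by rewrite gt_eqF.
  exists s, (q / s); split; first by rewrite h0; lra.
    by rewrite ltr_pdivlMr // ltr_pdivrMr //; lra.
  rewrite scalerDr scalerA [s * _]mulrC divfK // -[LHS](subrK x0) addrC.
  by congr (_ + _); exact: cramer.
have sE : cross (x0 + s *: (u + k *: v) - x0) v / cross u v = s.
  by move: D0; rewrite /cross !vE => D0; field.
have qE : cross u (x0 + s *: (u + k *: v) - x0) / cross u v = s * k.
  by move: D0; rewrite /cross !vE => D0; field.
case: j => [[|[|[|[|//]]]] i]; rewrite /sector /= ?sE ?qE //; nra.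
Qed.

Lemma thinC_dec u v : cross u v != 0 -> thin V x0 u v ->
  thin C x0 u v \/ thin (~` C) x0 u v.
Proof.
move=> D0 /thinP[e e0 h].
have reg z : (forall j, 0 < sector u v 0 e j z) -> V z.
  by move=> /(sectorP _ _ _ D0)[s [k [h1 h2 ->]]]; exact: h.
have e2 : 0 < e / 2 < e by lra.
have sec s k : 0 < s < e -> 0 < k < e ->
    forall j, 0 < sector u v 0 e j (x0 + s *: (u + k *: v)).
  by move=> hs hk; apply/(sectorP _ _ _ D0); exists s, k.
have [h1|h1] := pselect (C (x0 + (e / 2) *: (u + (e / 2) *: v))); [left|right].
  apply/thinP; exists e => // s k hs hk.
  exact: C_convex_region (sector_affine u v 0 e) reg (sec _ _ e2 e2) (sec _ _ hs hk) h1.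
apply/thinP; exists e => // s k hs hk; apply: contra_not h1 => h1.
exact: C_convex_region (sector_affine u v 0 e) reg (sec _ _ hs hk) (sec _ _ e2 e2) h1.
Qed.

Lemma closed_ray v y : (forall e, 0 < e -> exists2 k, 0 < k < e & V (y + k *: v)) ->
  V y.
Proof.
move=> h; apply: contrapT => nV.
have /nbhs_box[r r0 hr] : nbhs y (~` V).
  by move: (closed_openC Vcl); rewrite openE; apply.
have [e e0 he] := box_small v r0.
have [k k0e Vk] := h e e0.
by apply: (hr (k *: v)) => //; exact: he.
Qed.

(** The half-line between the two sectors is in [V] because [V] is closed. Together they form an
    open convex region inside [V] that meets [C]. *)
Lemma thin_merge u v : cross u v != 0 -> thin C x0 u v -> thin V x0 u (- v) ->
  exists2 e, 0 < e & forall s k, 0 < s < e -> - e < k < e ->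
    C (x0 + s *: (u + k *: v)).
Proof.
move=> D0 /thinP[e e0 h1] /thinP[e' e'0 h2].
pose g := Order.min e e'.
have g0 : 0 < g by rewrite lt_min e0.
have [ge gf] : g <= e /\ g <= e' by rewrite /g !ge_min !lexx orbT.
have Vall s k : 0 < s < g -> - g < k < g -> V (x0 + s *: (u + k *: v)).
  move=> /andP[s0 sg] /andP[k0 k1]; have [k0'|k0'|k0'] := ltgtP 0 k.
  - by apply: interior_subset; apply/CV/h1; apply/andP; split; lra.
  - have := h2 s (- k); rewrite scaleNr scalerN opprK; apply; apply/andP; split; lra.
  rewrite -k0' scale0r addr0; apply: (closed_ray (v := s *: v)) => // h h0.
  have [m m0 [m1 m2]] := small_ex (small_and (small_lt h0) (small_lt e0)).
  exists m; first by rewrite m0.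
  rewrite -addrA [m *: _]scalerA mulrC -scalerA -scalerDr.
  by apply: interior_subset; apply/CV/h1; apply/andP; split; lra.
have reg z : (forall j, 0 < sector u v (- g) g j z) -> V z.
  by move=> /(sectorP _ _ _ D0)[s [k [h3 h4 ->]]]; exact: Vall.
have g2 : 0 < g / 2 < g by lra.
have h3 : C (x0 + (g / 2) *: (u + (g / 2) *: v)).
  by apply: h1; apply/andP; split; lra.
exists g => // s k hs hk.
apply: C_convex_region (sector_affine u v (- g) g) reg _ _ h3.
  by apply/(sectorP _ _ _ D0); exists (g / 2), (g / 2); split=> //; lra.
by apply/(sectorP _ _ _ D0); exists s, k.
Qed.

Definition dirC d := small (fun s => C (x0 + s *: d)).

(** On either side of [u] a thin sector lies in [V] or in its complement. If both lie in [V], a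
    sector of [C] on one side spreads to the other; if only one does, it avoids [C], since otherwise
    [u] would bound [C]. *)
Lemma no_bray_const u v : cross u v != 0 ->
  ~ bray x0 u v -> ~ bray x0 u (- v) ->
  (exists2 e, 0 < e & forall k, `|k| < e -> dirC (u + k *: v)) \/
  (exists2 e, 0 < e & forall k, `|k| < e -> ~ dirC (u + k *: v)).
Proof.
move=> D0 nb1 nb2.
have D0' : cross u (- v) != 0.
  by move: D0; rewrite /cross !vE; apply: contra => /eqP h; apply/eqP; lra.
have full w : cross u w != 0 -> w = v \/ w = - v -> thin C x0 u w ->
    thin V x0 u (- w) -> exists2 e, 0 < e & forall k, `|k| < e -> dirC (u + k *: v).
  move=> Dw wE h1 h2; have [e e0 h] := thin_merge Dw h1 h2.
  exists e => // k; rewrite ltr_norml => /andP[k1 k2].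
  exists e => // s s0e; case: wE => wE; rewrite wE in h.
    by apply: h => //; rewrite k1.
  by have := h s (- k) s0e; rewrite scaleNr scalerN opprK; apply; apply/andP; lra.
have none : thin (~` C) x0 u v -> thin (~` C) x0 u (- v) ->
    exists2 e, 0 < e & forall k, `|k| < e -> ~ dirC (u + k *: v).
  move=> /thinP[e e0 h1] /thinP[e' e'0 h2].
  exists (Order.min e e'); first by rewrite lt_min e0.
  move=> k; rewrite lt_min => /andP[ke ke'] hC.
  have [s s0 [[h3 h4] h5]] := small_ex (small_and (small_and (small_lt e0) (small_lt e'0)) hC).
  have s0e : 0 < s < e by rewrite s0.
  have [k0|k0|k0] := ltgtP 0 k.
  - by apply: (h1 s k s0e) h5; rewrite k0 -(gtr0_norm k0).
  - apply: (h2 s (- k)); rewrite ?s0 //; last first.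
      by rewrite scaleNr scalerN opprK.
    by rewrite -(ltr0_norm k0) ke' normr_gt0 lt_eqF.
  move: h5; rewrite -k0 scale0r addr0 => /C_open[r r0 hr].
  have [m m0 [m1 m2]] := small_ex (small_and (small_lt e0) (box_small (s *: v) r0)).
  apply: (h1 s m); rewrite ?s0 ?m0 //.
  have := hr _ m2; rewrite scalerA mulrC -scalerA -addrA -scalerDr; exact.
have CnV u' v' : thin (~` V) x0 u' v' -> thin (~` C) x0 u' v'.
  by apply: thin_sub => y ny Cy; apply: ny; apply: interior_subset; exact: CV.
have [h1|h1] := thinV_dec u v; have [h2|h2] := thinV_dec u (- v).
- have [h3|h3] := thinC_dec D0 h1; first by left; apply: (full v) => //; left.
  have [h4|h4] := thinC_dec D0' h2; last by right; exact: none.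
  by left; apply: (full (- v)) => //; [right|rewrite opprK].
- have [h3|h3] := thinC_dec D0 h1; last by right; apply: none => //; exact: CnV.
  by case: nb1.
- have [h3|h3] := thinC_dec D0' h2; last by right; apply: none => //; exact: CnV.
  by case: nb2; split; rewrite ?opprK.
- by right; apply: none; exact: CnV.
Qed.

Lemma cst_connected (P : R -> Prop) :
  (forall k, (exists2 e, 0 < e & forall l, `|l - k| < e -> P l) \/
     (exists2 e, 0 < e & forall l, `|l - k| < e -> ~ P l)) ->
  (forall k, P k) \/ (forall k, ~ P k).
Proof.
move=> h; have [[k0 Pk0]|] := pselect (exists k, P k); last first.
  by move=> nP; right=> k Pk; apply: nP; exists k.
left=> k; apply: contrapT => nPk.
have op (Q : R -> Prop) : (forall k, Q k -> exists2 e, 0 < e &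
    forall l, `|l - k| < e -> Q l) -> open [set k | Q k].
  move=> hQ; rewrite openE => l /hQ[e e0 he].
  by apply/nbhs_ballP; exists e => // m; rewrite /ball /= distrC; exact: he.
have h1 l : P l -> exists2 e, 0 < e & forall m, `|m - l| < e -> P m.
  by case: (h l) => // -[e e0 he] Pl; case: (he l); rewrite // subrr normr0.
have h2 l : ~ P l -> exists2 e, 0 < e & forall m, `|m - l| < e -> ~ P m.
  by case: (h l) => // -[e e0 he] Pl; case: Pl; apply: he; rewrite subrr normr0.
have co : connected [set: R].
  by rewrite -set_itvE; apply/connected_intervalP; exact: interval_is_interval.
have o1 : exists2 D, open D & [set l | P l] = setT `&` D.
  by exists [set l | P l]; [exact: op|rewrite setTI].
have o2 : exists2 D, closed D & [set l | P l] = setT `&` D.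
  exists [set l | P l]; last by rewrite setTI.
  by rewrite -openC; exact: op.
have /seteqP[_ /(_ k Logic.I)] := co [set l | P l] (ex_intro _ k0 Pk0) o1 o2.
by [].
Qed.

Lemma closure_half u r y : u != 0 ->
  (forall w, box r w -> 0 < cross u w -> C (x0 + w)) ->
  box r (y - x0) -> 0 <= cross u (y - x0) -> closure C y.
Proof.
move=> u0 h yr; rewrite le_eqVlt => /orP hy B /nbhs_box[q q0 hq].
have cp := cross_perp u0.
have [e e0 [e1 e2]] := small_ex (small_and (box_small (perp u) q0)
  (box_small_add (perp u) yr)).
exists (y + e *: perp u); split; last exact: hq.
have -> : y + e *: perp u = x0 + (y - x0 + e *: perp u).
  by rewrite addrA [x0 + _]addrC subrK.
apply: h => //.
have -> : cross u (y - x0 + e *: perp u) = cross u (y - x0) + e * cross u (perp u).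
  by rewrite /cross !vE; ring.
have : 0 < e * cross u (perp u) by rewrite mulr_gt0.
by case: hy => [/eqP|]; lra.
Qed.

Lemma half_straight u r : u != 0 -> 0 < r ->
  (forall w, box r w -> 0 < cross u w -> C (x0 + w)) ->
  (forall w, box r w -> cross u w < 0 -> ~ C (x0 + w)) ->
  locally_straight (closure C) x0.
Proof.
move=> u0 r0 h1 h2; exists (perp u).
have dE w : dot (perp u) w = cross u w by rewrite dotE /cross !vE; ring.
apply: filterS (box_near x0 r0) => y yr; rewrite dE.
split=> [cy|]; last exact: closure_half h1 yr.
rewrite leNgt; apply/negP => lt.
have aff : affine (fun z => 0 - cross u (z - x0)).
  by apply: affineB; [exact: affine_cst|exact: (@affine_sub _ _ x0 (affine_crossr u))].
have n1 : \forall z \near y, 0 < 0 - cross u (z - x0).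
  by apply: (affine_near aff); lra.
have n2 : \forall z \near y, box r (z - x0).
  have [q q0 hq] : exists2 q, 0 < q & forall w', box q w' -> box r (y - x0 + w').
    move: yr => [w0 w1]; exists (Order.min (r - `|(y - x0) 0 0|) (r - `|(y - x0) 0 1|)).
      by rewrite lt_min !subr_gt0 w0.
    move=> w' [g0 g1]; move: g0 g1; rewrite !lt_min => /andP[g0 _] /andP[_ g1].
    by split; rewrite [(y - x0 + w') _ _]addvE (le_lt_trans (ler_normD _ _)) //; lra.
  by apply: (box_nbhs q0) => w' /hq; rewrite addrAC.
have [z [Cz [z1 z2]]] := cy _ (filterI n1 n2).
apply: (h2 _ z2); first by lra.
by rewrite addrC subrK.
Qed.

(** If all bounding half-lines were parallel to one direction [u], membership in [C] would be
    locally constant, hence constant, over the directions on each side of the line along [u]. Then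
    [closure C] would be a half-plane or everything near [x0]. *)
Lemma corner : closure C x0 -> ~ locally_straight (closure C) x0 ->
  exists u1 v1 u2 v2, [/\ bray x0 u1 v1, bray x0 u2 v2 & cross u1 u2 != 0].
Proof.
move=> cx nst; apply: contrapT => no.
have par u1 v1 u2 v2 : bray x0 u1 v1 -> bray x0 u2 v2 -> cross u1 u2 = 0.
  move=> b1 b2; apply/eqP; apply: contraT => ne; exfalso; apply: no.
  by exists u1, v1, u2, v2.
have [u [u0 hu]] : exists u, u != 0 /\ forall u' v', bray x0 u' v' -> cross u u' = 0.
  have [[u [v b]]|nb] := pselect (exists u v, bray x0 u v).
    exists u; split; last by move=> u' v' b'; exact: par b b'.
    by case: b => D0 _ _; apply: contra D0 => /eqP ->; rewrite /cross !vE !mul0r subrr.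
  exists (const_mx 1); split.
    by apply/eqP => /rowP/(_ 0); rewrite !mxE => /eqP; rewrite oner_eq0.
  by move=> u' v' b; case: nb; exists u', v'.
have [r r0 hr] := C_conic.
pose nn := perp u; have cn : 0 < cross u nn := cross_perp u0.
have dirP w : box r w -> C (x0 + w) <-> dirC w.
  move=> wr; split=> [Cw|].
    exists 1 => // s /andP[s0 s1].
    by apply/(hr w s) => //; exact: ltW.
  move=> /small_and/(_ (small_lt ltr01))/small_ex[s s0 [Cs s1]].
  by apply/(hr w s) => //; exact: ltW.
have dirZ k w : 0 < k -> dirC w <-> dirC (k *: w).
  have key a z : 0 < a -> dirC z -> dirC (a *: z).
    move=> a0 [e e0 h]; exists (e / a); first by rewrite divr_gt0.
    move=> s /andP[s0 se]; rewrite scalerA; apply: h.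
    by rewrite mulr_gt0 // -ltr_pdivlMr.
  move=> k0; split; first exact: key.
  move=> /(key k^-1); rewrite invr_gt0 => /(_ k0).
  by rewrite scalerA mulVf ?scale1r // gt_eqF.
(* Up to positive scaling, the directions on one side of the line form a copy of the real line,
   parametrized by [k]. *)
have side (c : R) : c != 0 -> (forall k, dirC (c *: nn + k *: u)) \/
    (forall k, ~ dirC (c *: nn + k *: u)).
  move=> c0; apply: (@cst_connected (fun k => dirC (c *: nn + k *: u))) => k.
  have D : cross (c *: nn + k *: u) u != 0.
    have -> : cross (c *: nn + k *: u) u = - (c * cross u nn).
      by rewrite /cross !vE; ring.
    by rewrite oppr_eq0 mulf_neq0 // gt_eqF.
  have nb v : ~ bray x0 (c *: nn + k *: u) v.
    move=> /hu; move/eqP: D; apply: contra_not => h.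
    by rewrite -[RHS]oppr0 -h /cross; ring.
  have e1 l : c *: nn + l *: u = c *: nn + k *: u + (l - k) *: u.
    by apply: vecP; rewrite !vE; ring.
  case: (no_bray_const D (nb _) (nb _)) => -[e e0 h]; [left|right];
    by exists e => // l lk; rewrite e1; exact: h.
have repr w : cross u w != 0 -> exists k, exists2 c, 0 < c &
    w = c *: ((if 0 < cross u w then 1 else - 1) *: nn + k *: u).
  move=> D; have wE := cramer w (lt0r_neq0 cn).
  set al := cross w nn / _ in wE; set be := cross u w / _ in wE.
  case: ltrP => hw.
    have be0 : 0 < be by rewrite divr_gt0.
    exists (al / be), be => //; rewrite scalerDr !scalerA mulr1 mulrC divfK ?gt_eqF //.
    by rewrite addrC.
  have be0 : 0 < - be.
    by rewrite -mulNr divr_gt0 // oppr_gt0 lt_neqAle D.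
  exists (al / - be), (- be) => //.
  rewrite scalerDr !scalerA mulrN1 opprK mulrC divfK ?gt_eqF //.
  by rewrite addrC.
have n1 : (-1 : R) != 0 by rewrite oppr_eq0 oner_neq0.
have pos_side : (forall w, box r w -> 0 < cross u w -> C (x0 + w)) \/
    (forall w, box r w -> 0 < cross u w -> ~ C (x0 + w)).
  have [d|d] := side 1 (oner_neq0 _); [left|right] => w wr hw;
    have [k [c c0 wE]] := repr w (lt0r_neq0 hw); rewrite hw in wE.
    by apply: (dirP _ wr).2; rewrite wE; apply: (dirZ _ _ c0).1; exact: d.
  by move=> /(dirP _ wr).1; rewrite wE => /(dirZ _ _ c0).2; exact: d.
have neg_side : (forall w, box r w -> cross u w < 0 -> C (x0 + w)) \/
    (forall w, box r w -> cross u w < 0 -> ~ C (x0 + w)).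
  have [d|d] := side (-1) n1; [left|right] => w wr hw;
    have [k [c c0 wE]] := repr w (ltr0_neq0 hw);
    rewrite ltNge (ltW hw) /= in wE.
    by apply: (dirP _ wr).2; rewrite wE; apply: (dirZ _ _ c0).1; exact: d.
  by move=> /(dirP _ wr).1; rewrite wE => /(dirZ _ _ c0).2; exact: d.
have Nu0 : - u != 0 by rewrite oppr_eq0.
have cN w : cross (- u) w = - cross u w by rewrite /cross !vE; ring.
have cl : exists2 y, C y & box r (y - x0).
  by have [y [Cy yr]] := cx _ (box_near x0 r0); exists y.
apply: nst; case: pos_side => hp; case: neg_side => hn.
- exists 0; apply: filterS (box_near x0 r0) => y yr; split=> [_|_].
    by rewrite dotE !vE !mul0r addr0.
  have [h0|h0] := lerP 0 (cross u (y - x0)); first exact: closure_half hp yr h0.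
  apply: (closure_half Nu0 _ yr); last by rewrite cN; lra.
  by move=> w wr; rewrite cN oppr_gt0; exact: hn.
- exact: half_straight u0 r0 hp hn.
- apply: (half_straight Nu0 r0) => w wr; rewrite cN.
    by rewrite oppr_gt0; exact: hn.
  by rewrite oppr_lt0; exact: hp.
(* If [C] avoids both sides, it lies on the line near [x0]; but [C] is open and has points there. *)
exfalso; case: cl => y Cy yr.
have [q q0 hq] := C_open Cy.
have yE (z : 'rV[R]_2) : x0 + (y - x0 + z) = y + z.
  by rewrite addrA [x0 + _]addrC subrK.
have [e e0 [e1 e2]] := small_ex (small_and (box_small nn q0) (box_small_add nn yr)).
have cE : cross u (y - x0 + e *: nn) = cross u (y - x0) + e * cross u nn.
  by rewrite /cross !vE; ring.
have en : 0 < e * cross u nn by rewrite mulr_gt0.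
have [h0|h0] := lerP 0 (cross u (y - x0)).
  by apply: (hp _ e2); rewrite ?yE; [rewrite cE; lra|exact: hq].
by apply: (hn _ yr h0); rewrite addrC subrK.
Qed.

End AtPoint.
End Corner.

(** * Boundary directions of the visible part of a triangle *)

Section VisiblePart.
Variables (R : realType) (n : nat) (T : terrain R n) (p : 'rV[R]_3).
Hypothesis above : on_or_above T p.
Implicit Types (a b i : 'I_n) (u v w x y d : 'rV[R]_2).

Local Notation pos := (pos T p).
Local Notation inT := (inT T p).
Local Notation bc := (bc T p).
Local Notation hgt := (hgt T p).
Local Notation vis := (vis T p).
Local Notation edge := (edge T).
Local Notation epos := (epos T p).
Local Notation dom := (dom T p).
Local Notation wta := (wta T p).
Local Notation wtb := (wtb T p).
Local Notation ph := (ph T p).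
Local Notation blocks := (blocks T p).
Local Notation vpart := (vpart T p).

Section OneTriangle.
Variables (t : {set 'I_n}) (tT : t \in tri T).

(** The finitely many affine functions whose signs decide membership in [vpart t]: the weights of
    [t], and the inequalities in [blocks] for every pair of vertices. *)
Definition vsign (j : 'I_n + 'I_n * 'I_n * 'I_4) x : R :=
  match j with
  | inl i => bc t i x
  | inr (a, b, k) => nth 0 [:: wta a b x; wtb a b x; wta a b x + wtb a b x - 1;
                              ph a b x - hgt t x] k
  end.

Lemma vsign_affine j : affine (vsign j).
Proof.
have h1 a b := wta_affine T p a b; have h2 a b := wtb_affine T p a b.
case: j => [i|[[a b] [[|[|[|[|//]]]] k]]]; rewrite /vsign /=.
- exact: bc_affine.
- exact: h1.
- exact: h2.
- exact: (affineB (affineD (h1 a b) (h2 a b)) (affine_cst 1)).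
- exact: (affineB (ph_affine T p a b) (hgt_affine p tT)).
Qed.

Lemma sg_ge0 (k l : R) : Num.sg k = Num.sg l -> (0 <= k) = (0 <= l).
Proof. by move=> e; rewrite -sgr_ge0 e sgr_ge0. Qed.

Lemma sg_gt0 (k l : R) : Num.sg k = Num.sg l -> (0 < k) = (0 < l).
Proof. by move=> e; rewrite -sgr_gt0 e sgr_gt0. Qed.

Lemma blocks_sign a b x y :
  (forall k, Num.sg (vsign (inr (a, b, k)) x) = Num.sg (vsign (inr (a, b, k)) y)) ->
  blocks a b x (hgt t x) -> blocks a b y (hgt t y).
Proof.
move=> h [ab D0 [w1 w2] w3 w4].
have h0 := h (@Ordinal 4 0 isT); have h1 := h (@Ordinal 4 1 isT).
have h2 := h (@Ordinal 4 2 isT); have h3 := h (@Ordinal 4 3 isT).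
rewrite /vsign /= in h0 h1 h2 h3.
split=> //; first by rewrite -(sg_ge0 h0) -(sg_ge0 h1).
  by rewrite -subr_gt0 -(sg_gt0 h2) subr_gt0.
by rewrite -subr_gt0 -(sg_gt0 h3) subr_gt0.
Qed.

Lemma vpart_sign x y : (forall j, Num.sg (vsign j x) = Num.sg (vsign j y)) ->
  vpart t x -> vpart t y.
Proof.
move=> h [tx vx]; have ty : inT t y.
  by move=> i; rewrite -(sg_ge0 (h (inl i))); exact: tx.
split=> //; apply/(visP above tT ty) => a b bl.
have /(visP above tT tx)/(_ a b) := vx; apply.
by apply: blocks_sign bl => k; rewrite h.
Qed.

Lemma affine_scaled (f : 'rV[R]_2 -> R) (l : R) : affine f ->
  affine (fun x => f (l *: x)).
Proof.
move=> [a [b fE]]; exists (l *: a), b => x.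
by rewrite fE !dotE !vE; ring.
Qed.

(** An obstacle at ratio [l] persists for points [y] near [x], but [l *: y] may leave the triangle
    [s0]. So the strict inequality is kept for every triangle containing [l *: x], and the other
    triangles are avoided nearby. *)
Lemma vpart_closed : closed [set x | vpart t x].
Proof.
rewrite -[X in closed X]setCK; apply: open_closedC; rewrite openE => x nx.
have [tx|/existsNP[i /negP]] := pselect (inT t x); last first.
  rewrite -ltNge => ti.
  have aff : affine (fun y => 0 - bc t i y).
    by apply: affineB; [exact: affine_cst|exact: bc_affine].
  have : \forall y \near x, 0 < 0 - bc t i y by apply: (affine_near aff); lra.
  by apply: filterS => y hy [/(_ i) h _]; lra.
have /existsNP[s0] : ~ vis x (hgt t x) by move=> vx; apply: nx; split.
move=> /existsNP[l] /not_implyP[s0T] /not_implyP[l01] /not_implyP[sx /negP].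
rewrite -ltNge => lt.
have nr : \forall y \near x, forall s, s \in tri T -> inT s (l *: y) ->
    l * hgt t y < hgt s (l *: y).
  apply: (@filter_forall _ {set 'I_n} (fun s y => s \in tri T ->
    inT s (l *: y) -> l * hgt t y < hgt s (l *: y)) (nbhs x) (nbhs_filter _)) => s.
  case: (boolP (s \in tri T)) => sT; last by apply: nearW.
  have [ls|/existsNP[i /negP]] := pselect (inT s (l *: x)).
    have aff : affine (fun y => hgt s (l *: y) - hgt t y * l).
      apply: affineB; first by apply: affine_scaled; exact: hgt_affine.
      by apply: affineM; exact: hgt_affine.
    have : \forall y \near x, 0 < hgt s (l *: y) - hgt t y * l.
      by apply: (affine_near aff); rewrite (hgt_consist sT s0T ls sx); lra.
    by apply: filterS => y hy _ _; lra.
  rewrite -ltNge => si.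
  have aff : affine (fun y => 0 - bc s i (l *: y)).
    apply: affineB; first exact: affine_cst.
    by apply: affine_scaled; exact: bc_affine.
  have : \forall y \near x, 0 < 0 - bc s i (l *: y).
    by apply: (affine_near aff); lra.
  by apply: filterS => y hy _ /(_ i) h; lra.
apply: filterS nr => y hy [ty vy].
have dy : dom (l *: y).
  have td : dom y by exists t.
  by have := dom_conv (dom0 above) td l01; rewrite scaler0 add0r.
case: dy => s sT sy; have := vy s l sT l01 sy.
by rewrite leNgt hy.
Qed.

Lemma small_limit (g : 'rV[R]_2 -> R) y w : affine g ->
  small (fun e => 0 <= g (y + e *: w)) -> 0 <= g y.
Proof.
move=> ga h; rewrite leNgt; apply/negP => gy.
have gn : 0 < - g y by rewrite oppr_gt0.
have [e e0 [h1 h2]] := small_ex (small_and h (small_pos (- (g (y + w) - g y)) gn)).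
by move: h1; rewrite affine_line //; lra.
Qed.

(** If [g] vanishes at [x], its positive slope along [u] outweighs a small turn towards [w];
    otherwise continuity suffices. *)
Lemma small_thin (g : 'rV[R]_2 -> R) x u w : affine g ->
  small (fun s => 0 < g (x + s *: u)) -> thin [set y | 0 < g y] x u w.
Proof.
move=> ga h; have [a [b gE]] := ga.
have lE s k : g (x + s *: (u + k *: w)) = g x + s * dot a u + (s * k) * dot a w.
  by rewrite !gE !dotE !vE; ring.
have l0 s : g (x + s *: u) = g x + s * dot a u by rewrite !gE !dotE !vE; ring.
have gx : 0 <= g x.
  by apply: small_limit ga _; apply: small_imp h => e _; exact: ltW.
have ub s k e : 0 < s -> s <= e -> 0 < k -> k <= e -> e < 1 ->
    [/\ - (e * `|dot a u|) <= s * dot a u, - (e * `|dot a w|) <= k * dot a w &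
     - (e * `|dot a w|) <= s * k * dot a w].
  move=> s0 se k0 ke e1.
  have key (m c : R) : 0 < m -> m <= e -> - (e * `|c|) <= m * c.
    move=> m0 me; have : - (m * `|c|) <= m * c.
      have : `|m * c| <= m * `|c| by rewrite normrM gtr0_norm.
      by rewrite ler_norml => /andP[].
    have : m * `|c| <= e * `|c| by rewrite ler_wpM2r.
    by lra.
  split; apply: key => //; first by rewrite mulr_gt0.
  by rewrite (le_trans _ se) // ler_piMr ?(ltW s0) //; lra.
move: gx; rewrite le_eqVlt => /orP[/eqP g0|gp].
  have [e1 e10] := small_ex h; rewrite l0 -g0 add0r pmulr_rgt0 // => du.
  have := small_and (small_pos (- `|dot a w|) du) (small_lt ltr01).
  apply: small_imp => e e0 [h1 h2] s k s0 se k0 ke /=.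
  have [_ h3 _] := ub s k e s0 se k0 ke h2.
  rewrite lE -g0 add0r -mulrA -mulrDr pmulr_rgt0 //; lra.
have := small_and (small_pos (- (`|dot a u| + `|dot a w|)) gp) (small_lt ltr01).
apply: small_imp => e e0 [h1 h2] s k s0 se k0 ke /=.
have [h3 _ h4] := ub s k e s0 se k0 ke h2.
by rewrite lE; lra.
Qed.

(** The linear part of [ph a b - hgt t]. The two planes meet over [x] exactly when
    [Lf a b x = hgt t 0], and meet along the directions in the kernel. *)
Definition Lf a b w := ph a b w - hgt t w + hgt t 0.

Lemma Lf_dot a b : exists g, forall w, Lf a b w = dot g w.
Proof.
have [g gE] := ph_dot T p a b; have [c [e hE]] := hgt_affine p tT.
exists (g - c) => w; rewrite /Lf gE !hE !dotE !vE; ring.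
Qed.

(* On the half-line from [x] in direction [u], which runs inside the triangle,
   the triangle meets the plane through the viewpoint and the edge, and this
   edge hides the points of the triangle on the side opposite to [v]. *)
Record shadow a b x u v : Prop := Shadow {
  sh_uv : cross u v != 0;
  sh_edge : edge a b;
  sh_cross : cross (pos a) (pos b) != 0;
  sh_wta : 0 <= wta a b x;
  sh_wtb : 0 <= wtb a b x;
  sh_wt : 1 <= wta a b x + wtb a b x;
  sh_Lx : Lf a b x = hgt t 0;
  sh_Lu : Lf a b u = 0;
  sh_Lv : Lf a b v < 0;
  sh_hgt0 : hgt t 0 <= 0;
  sh_ray : small (fun s => let y := x + s *: u in
    [/\ vpart t y, forall i, i \in t -> 0 < bc t i y,
      0 <= wta a b y /\ 0 <= wtb a b y, 1 < wta a b y + wtb a b y &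
      ph a b y = hgt t y]);
  sh_thin : thin [set y | blocks a b y (hgt t y)] x u (- v) }.

Definition along a b (k : R) x u := [/\ a != b, a \in t /\ b \in t, x = epos a b k,
  0 <= k < 1 & exists2 c, 0 < c & u = c *: (pos b - pos a)].

Lemma third i : i \in t -> exists a b, [/\ a != b, i != a, i != b,
  a \in t /\ b \in t & forall j, j \in t -> j = i \/ j = a \/ j = b].
Proof.
move=> it; have [x [y [z [xy xz yz tE]]]] := set3P (tri_card tT).
have [xt yt zt] : [/\ x \in t, y \in t & z \in t].
  by rewrite tE !inE !eqxx !orbT.
have tP j : j \in t -> [\/ j = x, j = y | j = z].
  by rewrite tE !inE -orbA => /or3P[]/eqP; [exact: Or31|exact: Or32|exact: Or33].
case: (tP i it) => e; subst i.
- exists y, z; split=> // j /tP[]; tauto.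
- exists x, z; split=> //; first by rewrite eq_sym.
  by move=> j /tP[]; tauto.
- exists x, y; split=> //; try by rewrite eq_sym.
  by move=> j /tP[]; tauto.
Qed.

Lemma on_side i a b x : i != a -> i != b -> a != b ->
  (forall j, j \in t -> j = i \/ j = a \/ j = b) -> bc t i x = 0 ->
  bc t a x = 1 - bc t b x /\ x = epos a b (bc t b x).
Proof.
move=> ia ib ab tP i0.
have z j : j != a -> j != b -> bc t j x = 0.
  move=> ja jb; case: (boolP (j \in t)) => jt; last exact: bc_out.
  case: (tP j jt) => [->//|[] e]; first by rewrite e eqxx in ja.
  by rewrite e eqxx in jb.
have s1 : bc t a x + bc t b x = 1.
  rewrite -(bc_sum1 p tT x) (bigD1 a) //= (bigD1 b) 1?eq_sym //= big1 ?addr0 //.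
  by move=> j /andP[? ?]; exact: z.
have aE : bc t a x = 1 - bc t b x by rewrite -s1 addrK.
split=> //; rewrite -{1}(bc_pos p tT x) (bigD1 a) //= (bigD1 b) 1?eq_sym //=.
rewrite big1 ?addr0 /epos ?aE // => j /andP[? ?]; by rewrite z // scale0r.
Qed.

(** A point of an edge has positive weight at most at two vertices, in whichever triangle it is
    expressed; an interior point of [t] has three. *)
Lemma edge_not_interior a b x (k : R) : edge a b -> 0 <= k <= 1 -> x = epos a b k ->
  ~ (forall i, i \in t -> 0 < bc t i x).
Proof.
move=> [ab [s sT [sa sb]]] k01 xE h.
have sx : inT s x by rewrite xE; exact: inT_epos.
have tx : inT t x.
  by move=> i; case: (boolP (i \in t)) => it; [exact/ltW/h|rewrite bc_out].
have sub : t \subset [set a; b]%SET.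
  apply/fintype.subsetP => i it; apply: (inT_sub_edge sT tT sx tx) (h i it) => j.
  rewrite !inE negb_or => /andP[ja jb]; rewrite xE bc_epos //.
  by rewrite (negbTE ja) (negbTE jb) !mulr0 addr0.
by have := subset_leq_card sub; rewrite (tri_card tT) cards2 ab.
Qed.

Lemma wt_on_edge a b x : cross (pos a) (pos b) != 0 ->
  wta a b x + wtb a b x = 1 -> x = epos a b (wtb a b x).
Proof.
move=> D0 h; rewrite {1}(wtE x D0) /epos; congr (_ *: _ + _).
by rewrite -h addrK.
Qed.

Lemma bray_ray (C : set 'rV[R]_2) x u v : C `<=` [set y | vpart t y] ->
  thin C x u v -> small (fun s => vpart t (x + s *: u)).
Proof.
move=> CV /thinP[e e0 h]; exists e => // s /andP[s0 se].
apply: (closed_ray (V := [set y | vpart t y]) vpart_closed (v := s *: v)) => e' e'0.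
have [m m0 [m1 m2]] := small_ex (small_and (small_lt e'0) (small_lt e0)).
exists m; first by rewrite m0.
rewrite -addrA [m *: _]scalerA mulrC -scalerA -scalerDr.
by apply: CV; apply: h; apply/andP; split; lra.
Qed.

(** If no weight of [t] vanishes along the half-line, it enters the interior of [t], and the points
    next to it on the side of [- v] are in [t] but hidden. The inequalities of a blocking edge pass
    to the half-line as weak ones. Points of the half-line are visible, so the height inequality
    must become an equality there. *)
Lemma bray_type (C : set 'rV[R]_2) x u v : C `<=` [set y | vpart t y] ->
  bray [set y | vpart t y] C x u v ->
  (exists a b k, along a b k x u) \/ (exists a b, shadow a b x u v).
Proof.
move=> CV [D0 thC thV]; have rayV := bray_ray CV thC.
have u0 : u != 0 by apply: contra D0 => /eqP ->; rewrite cross0l.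
have bx i : 0 <= bc t i x.
  apply: (small_limit (w := u)); first exact: bc_affine.
  by apply: small_imp rayV => s _ [+ _]; apply.
have lineE i s : bc t i (x + s *: u) = bc t i x + s * (bc t i (x + u) - bc t i x).
  by apply: affine_line; exact: bc_affine.
have [[i [it i0 iu]]|nb] := pselect (exists i, [/\ i \in t, bc t i x = 0 &
    bc t i (x + u) = 0]).
  left; have [a [b [ab ia ib [at_ bt] tP]]] := third it.
  have [ax xE] := on_side ia ib ab tP i0.
  have [au uE] := on_side ia ib ab tP iu.
  set k0 := bc t b x in ax xE; set k1 := bc t b (x + u) in au uE.
  have uD : u = (k1 - k0) *: (pos b - pos a).
    rewrite -[LHS](addKr x) uE {1}xE; apply: vecP; rewrite /epos !vE; ring.
  have kn : k1 - k0 != 0 by apply: contra u0 => /eqP h; rewrite uD h scale0r.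
  have [s s0 [sV _]] := small_ex rayV.
  have [k01|k01|/eqP] := ltgtP k0 k1; last by rewrite eq_sym -subr_eq0 (negbTE kn).
    exists a, b, k0; split=> //; last by exists (k1 - k0); rewrite // subr_gt0.
    rewrite /k0 bx /=; have := sV a; rewrite lineE ax au -/k0.
    have : 0 < s * (k1 - k0) by rewrite mulr_gt0 // subr_gt0.
    by lra.
  exists b, a, (1 - k0); split=> //; first by rewrite eq_sym.
  - by rewrite epos_sym.
  - have := bx a; rewrite ax => ->; have := sV b; rewrite lineE -/k0 -/k1.
    have : 0 < s * (k0 - k1) by rewrite mulr_gt0 // subr_gt0.
    by move=> h1 h2; rewrite /=; lra.
  - exists (k0 - k1); first by rewrite subr_gt0.
    by rewrite uD -[pos b - pos a]opprB scalerN -scaleNr opprB.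
right.
have intr : small (fun s => forall i, i \in t -> 0 < bc t i (x + s *: u)).
  apply: small_all => i; case: (boolP (i \in t)) => it; last by apply: smallT.
  have := bx i; rewrite le_eqVlt => /orP[/eqP i0|ip]; last first.
    by have := small_pos (bc t i (x + u) - bc t i x) ip; apply: small_imp => s s0 h _;
      rewrite lineE.
  have [s s0 [sV _]] := small_ex rayV; have := sV i.
  rewrite lineE -i0 add0r subr0 pmulr_rge0 // le_eqVlt => /orP[/eqP iu|iu].
    by case: nb; exists i.
  by apply: smallT => s' s'0 _; rewrite lineE -i0 add0r subr0 mulr_gt0.
have thT : thin [set y | forall i, i \in t -> 0 < bc t i y] x u (- v).
  have : small (fun e => forall i, i \in t -> forall s k, 0 < s -> s <= e ->
      0 < k -> k <= e -> 0 < bc t i (x + s *: (u + k *: (- v)))).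
    apply: small_all => i; case: (boolP (i \in t)) => it; last by apply: smallT.
    have hi : small (fun s => 0 < bc t i (x + s *: u)).
      by apply: small_imp intr => s s0; apply.
    by apply: small_imp (small_thin (- v) (bc_affine p tT i) hi).
  by apply: small_imp => e e0 h s k s0 se k0 ke i it; exact: h.
(* The relevant signs are constant on the sector, so the edge that blocks one of its points blocks
   all of them. *)
have thB : exists a b, thin [set y | blocks a b y (hgt t y)] x u (- v).
  have sgn := thin_sign vsign_affine x u (- v).
  have [e e0 [[h1 h2] h3]] := small_ex (small_and (small_and thT thV) sgn).
  have y0 := h1 e e e0 (lexx _) e0 (lexx _).
  have ny := h2 e e e0 (lexx _) e0 (lexx _).
  set y := x + _ in y0 ny.
  have ty : inT t y.
    by move=> i; case: (boolP (i \in t)) => it; [exact/ltW/y0|rewrite bc_out].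
  have [|a [b bl]] := not_vis_blocks above tT ty; first by move=> vy; apply: ny.
  exists a, b, e => // f /andP[f0 fe] s k s0 sf k0 kf.
  by apply: blocks_sign bl => j; apply: h3 => //; lra.
have [a [b thB']] := thB.
exists a, b; have [e e0 hB] := small_ex thB'.
have [ab Dab _ _ _] := hB e e e0 (lexx _) e0 (lexx _).
have wa := wta_affine T p a b; have wb := wtb_affine T p a b.
have lim (g : 'rV[R]_2 -> R) : affine g ->
    (forall y, blocks a b y (hgt t y) -> 0 <= g y) ->
    small (fun s => 0 <= g (x + s *: u)).
  move=> ga gb; exists e => // s /andP[s0 se].
  apply: (small_limit (w := s *: (- v)) ga); exists e => // k /andP[k0 ke].
  rewrite -addrA [k *: _]scalerA mulrC -scalerA -scalerDr; apply: gb.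
  by apply: hB => //; exact: ltW.
have l1 := lim _ wa (fun y h => match h with And5 _ _ (conj h1 _) _ _ => h1 end).
have l2 := lim _ wb (fun y h => match h with And5 _ _ (conj _ h1) _ _ => h1 end).
have a3 := affineB (affineD wa wb) (affine_cst 1).
have l3 : small (fun s => 0 <= wta a b (x + s *: u) + wtb a b (x + s *: u) - 1).
  by apply: (lim _ a3) => y [_ _ _ h _]; rewrite subr_ge0 ltW.
have a4 := affineB (ph_affine T p a b) (hgt_affine p tT).
have l4 : small (fun s => 0 <= ph a b (x + s *: u) - hgt t (x + s *: u)).
  by apply: (lim _ a4) => y [_ _ _ _ h]; rewrite subr_ge0 ltW.
have ray : small (fun s => let y := x + s *: u in
    [/\ vpart t y, forall i, i \in t -> 0 < bc t i y,
      0 <= wta a b y /\ 0 <= wtb a b y, 1 < wta a b y + wtb a b y &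
      ph a b y = hgt t y]).
  have := small_and (small_and rayV intr) (small_and (small_and l1 l2) (small_and l3 l4)).
  apply: small_imp => s s0 [[Vy iy] [[w1 w2] [w3 w4]]] /=.
  set y := x + s *: u in Vy iy w1 w2 w3 w4 *.
  have w5 : 1 < wta a b y + wtb a b y.
    rewrite lt_neqAle; apply/andP; split; last by lra.
    apply/negP => /eqP /esym yE.
    apply: (edge_not_interior ab (k := wtb a b y) _ (wt_on_edge Dab yE) iy).
    by rewrite w2; lra.
  split=> //; apply/eqP; rewrite eq_le; apply/andP; split; last by lra.
  rewrite leNgt; apply/negP => lt; case: Vy => ty /(visP above tT ty)/(_ a b).
  by apply; split.
have [g gE] := Lf_dot a b.
have eE y : ph a b y - hgt t y = dot g y - hgt t 0 by rewrite -gE /Lf; ring.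
have eR s : ph a b (x + s *: u) - hgt t (x + s *: u) =
    (ph a b x - hgt t x) + s * Lf a b u.
  by rewrite !eE gE !dotE !vE; ring.
have [s1 s10 hs] := ray.
have [Lu xx] : Lf a b u = 0 /\ ph a b x - hgt t x = 0.
  have [|_ _ _ _ q1] := hs (s1 / 2); first by apply/andP; split; lra.
  have [|_ _ _ _ q2] := hs (s1 / 4); first by apply/andP; split; lra.
  have := eR (s1 / 2); have := eR (s1 / 4); rewrite q1 q2 !subrr => e1 e2.
  have s1L : s1 * Lf a b u = 0 by lra.
  have L0 : Lf a b u = 0.
    by apply/eqP; move/eqP: s1L; rewrite mulf_eq0 gt_eqF.
  by split=> //; move: e1; rewrite L0; lra.
split=> //.
- by apply: small_limit l1.
- by apply: small_limit l2.
- by rewrite -subr_ge0; apply: (small_limit (g := fun y => _) a3 l3).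
- by rewrite /Lf; lra.
- have [_ _ _ _] := hB e e e0 (lexx _) e0 (lexx _).
  have -> : x + e *: (u + e *: - v) = x + e *: u + (- (e * e)) *: v.
    by apply: vecP; rewrite !vE; ring.
  set z := _ + _ => h; have : 0 < ph a b z - hgt t z by lra.
  have -> : ph a b z - hgt t z = (ph a b x - hgt t x) + e * Lf a b u - e * e * Lf a b v.
    by rewrite !eE !gE /z !dotE !vE; ring.
  rewrite xx Lu mulr0 !add0r oppr_gt0 => h'.
  by rewrite -(pmulr_rlt0 _ (mulr_gt0 e0 e0)).
(* The remaining goal is [hgt t 0 <= 0]. A visible interior point of [t] is not hidden by the points
   of [t] just before it, so the plane of [t] does not pass above the viewpoint. *)
have [s s0 [[ty vy] iy _ _ _]] := small_ex ray.
set y := x + s *: u in ty vy iy.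
have [m m0 [m1 m2]] : exists2 m, 0 < m & m < 1 /\ inT t ((1 - m) *: y).
  apply: small_ex; apply: small_and; first exact: small_lt.
  have : small (fun m => forall i, i \in t -> 0 < bc t i (y + m *: (- y))).
    apply: small_all => i; case: (boolP (i \in t)) => it; last by apply: smallT.
    have := small_pos (bc t i (y - y) - bc t i y) (iy i it).
    by apply: small_imp => m m0 h _; rewrite affine_line //; exact: bc_affine.
  apply: small_imp => m m0 h i; rewrite scalerBl scale1r -scalerN.
  by case: (boolP (i \in t)) => it; [exact/ltW/h|rewrite bc_out].
have l01 : 0 <= 1 - m <= 1 by apply/andP; split; lra.
have := vy t (1 - m) tT l01 m2; rewrite (affine_scale _ _ (hgt_affine p tT)) => h.
have : m * hgt t 0 <= 0 by lra.
by rewrite pmulr_rle0.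
Qed.

End OneTriangle.
End VisiblePart.

(** * From two boundary directions to a germ *)

Section KeyLemma.
Variables (R : realType) (n : nat) (T : terrain R n) (p : 'rV[R]_3).
Hypothesis above : on_or_above T p.
Implicit Types (a b i : 'I_n) (u v w x y d : 'rV[R]_2).

Local Notation pos := (pos T p).
Local Notation inT := (inT T p).
Local Notation bc := (bc T p).
Local Notation hgt := (hgt T p).
Local Notation edge := (edge T).
Local Notation epos := (epos T p).
Local Notation ehgt := (ehgt T p).
Local Notation wta := (wta T p).
Local Notation wtb := (wtb T p).
Local Notation ph := (ph T p).
Local Notation blocks := (blocks T p).
Local Notation vpart := (vpart T p).
Local Notation evis := (evis T p).
Local Notation germ := (germ T p).

Definition wt a b x := wta a b x + wtb a b x.

Lemma wtD a b x y : wt a b (x + y) = wt a b x + wt a b y.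
Proof. by rewrite /wt wtaD wtbD; ring. Qed.

Lemma wtZ a b (k : R) x : wt a b (k *: x) = k * wt a b x.
Proof. by rewrite /wt wtaZ wtbZ; ring. Qed.

Lemma wta_sym a b x : wta b a x = wtb a b x.
Proof.
by rewrite /wta /wtb [cross x _]crossC [cross (pos b) _]crossC divrNN.
Qed.

Lemma wtb_sym a b x : wtb b a x = wta a b x.
Proof. by rewrite -wta_sym. Qed.

Lemma ph_sym a b x : ph b a x = ph a b x.
Proof. by rewrite /ph (wta_sym a) (wtb_sym a) addrC. Qed.

Lemma blocks_sym a b x (k : R) : blocks a b x k -> blocks b a x k.
Proof.
move=> [ab D0 [w1 w2] w3 w4]; split; first exact: edge_sym.
- by rewrite crossC oppr_eq0.
- by rewrite (wta_sym a) (wtb_sym a).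
- by rewrite (wta_sym a) (wtb_sym a) addrC.
- by rewrite ph_sym.
Qed.

Lemma mk_germ a b (k : R) : 0 <= k < 1 -> small (fun e => evis a b (k + e)) ->
  k = 0 \/ small (fun e => ~ evis a b (k - e)) -> germ a b k.
Proof.
move=> k01 kv kn; split=> // e e0; case: kn => [k0|kn].
  by exists (k - e / 2); [apply/andP; split; lra|left; lra].
have [m m0 [m1 m2]] := small_ex (small_and kn (small_lt e0)).
by exists (k - m); [apply/andP; split; lra|right].
Qed.

Lemma small_scale (P : R -> Prop) (c : R) : 0 < c -> small P -> small (fun e => P (e / c)).
Proof.
move=> c0 [e e0 h]; exists (e * c); first by rewrite mulr_gt0.
by move=> x /andP[x0 xe]; apply: h; rewrite divr_gt0 //= ltr_pdivrMr.
Qed.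

(** Both endpoints of the first edge have positive weight at its interior points, so they occur
    among the endpoints of the second edge. *)
Lemma same_edge s t a b a' b' (k k' : R) : s \in tri T -> t \in tri T -> a \in t -> b \in t -> a != b ->
  a' \in s -> b' \in s -> a' != b' -> 0 < k < 1 -> 0 <= k' <= 1 ->
  epos a b k = epos a' b' k' -> (a = a' /\ b = b') \/ (a = b' /\ b = a').
Proof.
move=> sT tT at_ bt ab as_ bs ab' /andP[k0 k1] k'01 e.
have tx : inT t (epos a b k) by apply: inT_epos => //; rewrite !ltW.
have sx : inT s (epos a b k) by rewrite e; exact: inT_epos.
have sub i : 0 < bc t i (epos a b k) -> i \in [set a'; b']%SET.
  apply: (inT_sub_edge sT tT sx tx) => j; rewrite !inE negb_or e => /andP[ja jb].
  by rewrite bc_epos // (negbTE ja) (negbTE jb) !mulr0 addr0.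
have := sub a; rewrite bc_epos // eqxx (negbTE ab) mulr1 mulr0 addr0 subr_gt0.
move=> /(_ k1); have := sub b; rewrite bc_epos // eqxx [b == a]eq_sym (negbTE ab).
rewrite mulr1 mulr0 add0r => /(_ k0).
rewrite !inE => /orP[]/eqP eb /orP[]/eqP ea; subst; try by [left|right].
  by rewrite eqxx in ab.
by rewrite eqxx in ab.
Qed.

Section OneTriangle.
Variables (t : {set 'I_n}) (tT : t \in tri T).

Local Notation Lf := (Lf T p t).
Local Notation shadow := (shadow T p t).
Local Notation along := (along T p t).

Lemma LfD a b x y : Lf a b (x + y) = Lf a b x + Lf a b y.
Proof. by have [g gE] := Lf_dot p tT a b; rewrite !gE !dotE !vE; ring. Qed.

Lemma LfZ a b (k : R) x : Lf a b (k *: x) = k * Lf a b x.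
Proof. by have [g gE] := Lf_dot p tT a b; rewrite !gE !dotE !vE; ring. Qed.

Lemma Lf_sym a b x : Lf b a x = Lf a b x.
Proof. by rewrite /Lf ph_sym. Qed.

Lemma Lf_kernel a b u w y : Lf a b u = 0 -> Lf a b w = 0 -> cross u w != 0 ->
  Lf a b y = 0.
Proof.
move=> hu hw D0; rewrite (cramer y D0) LfD !LfZ hu hw; ring.
Qed.

Lemma ell_line a b x (k : R) w : Lf a b x = hgt t 0 ->
  ph a b (x + k *: w) - hgt t (x + k *: w) = k * Lf a b w.
Proof.
move=> hx; have -> : ph a b (x + k *: w) - hgt t (x + k *: w) =
  Lf a b (x + k *: w) - hgt t 0 by rewrite /Lf; ring.
by rewrite LfD LfZ hx; ring.
Qed.

Lemma shadow_sym a b x u v : shadow a b x u v -> shadow b a x u v.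
Proof.
move=> [h1 h2 h3 h4 h5 h6 h7 h8 h9 h10 h11 h12]; split=> //.
- exact: edge_sym.
- by rewrite crossC oppr_eq0.
- by rewrite (wta_sym a).
- by rewrite (wtb_sym a).
- by rewrite (wta_sym a) (wtb_sym a) addrC.
- by rewrite Lf_sym.
- by rewrite Lf_sym.
- by rewrite Lf_sym.
- apply: small_imp h11 => s s0 /= [k1 k2 [k3 k4] k5 k6].
  by rewrite (wta_sym a) (wtb_sym a) ph_sym [wtb a b _ + _]addrC.
- by apply: thin_sub h12 => y; exact: blocks_sym.
Qed.

(** The plane of [t] and the plane of the edge both pass through the viewpoint, and hence so does
    the line in which they meet. *)
Lemma shadow_radial a b x u v : shadow a b x u v -> hgt t 0 = 0 -> cross x u = 0.
Proof.
move=> sh h0; apply/eqP; apply: contraT => D0.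
have := sh_Lv sh; rewrite (Lf_kernel v _ (sh_Lu sh) D0) ?ltxx //.
by rewrite (sh_Lx sh).
Qed.

Lemma shadow_nonradial a b x u v : shadow a b x u v -> hgt t 0 < 0 -> cross x u != 0.
Proof.
move=> sh h0; apply/eqP => D0.
have u0 : u != 0 by apply: contra (sh_uv sh) => /eqP ->; rewrite cross0l.
have [|c xE] := parallel u0 (v := x); first by rewrite crossC D0 oppr0.
by move: (sh_Lx sh) h0; rewrite xE LfZ (sh_Lu sh) mulr0 => <-; rewrite ltxx.
Qed.

(** Strictly inside the cone of the edge, the conditions on the weights are open. If instead
    [hgt t 0 = 0], then [x] may lie on the boundary of the cone, but the shadow is radial and
    [x + e *: w] is a positive multiple of a point in the sector of [sh_thin], so the cone still
    contains it. *)
Lemma shadow_halfdisc a b x u v w : shadow a b x u v -> 1 < wt a b x ->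
  (0 < wta a b x /\ 0 < wtb a b x) \/ hgt t 0 = 0 -> 0 < Lf a b w ->
  small (fun e => blocks a b (x + e *: w) (hgt t (x + e *: w))).
Proof.
move=> sh S1 alt Lw.
have sS : small (fun e => 1 < wt a b (x + e *: w)).
  have S1' : 0 < wt a b x - 1 by lra.
  apply: small_imp (small_pos (wt a b w) S1') => e e0 h.
  by rewrite wtD wtZ; lra.
have sL e : 0 < e -> hgt t (x + e *: w) < ph a b (x + e *: w).
  move=> e0; rewrite -subr_gt0 (ell_line e w (sh_Lx sh)); exact: mulr_gt0.
case: alt => [[w1 w2]|h0].
  have := small_and sS (small_and (small_pos (wta a b w) w1) (small_pos (wtb a b w) w2)).
  apply: small_imp => e e0 [h1 [h2 h3]]; split; [exact: sh_edge sh|exact: sh_cross sh| |by []|exact: sL].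
  by rewrite wtaD wtaZ wtbD wtbZ !ltW.
have x0 : x != 0.
  apply: contraTneq S1 => ->; rewrite -(scale0r (0 : 'rV[R]_2)) wtZ mul0r.
  by rewrite -leNgt ler01.
have [c uE] := parallel x0 (shadow_radial sh h0).
have Dxv : cross x v != 0.
  apply: contra (sh_uv sh) => /eqP D; rewrite uE.
  have -> : cross (c *: x) v = c * cross x v by rewrite /cross !vE; ring.
  by rewrite D mulr0.
have wE := cramer w Dxv; set al := cross w v / _ in wE; set be := cross x w / _ in wE.
have be0 : be < 0.
  move: Lw; rewrite wE LfD !LfZ (sh_Lx sh) h0 mulr0 add0r.
  by have := sh_Lv sh; nra.
have [e1 e10 hB] := small_ex (sh_thin sh).
have [s1 s10 [s1e s1c]] := small_ex (small_and (small_lt e10) (small_pos c ltr01)).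
have q0 : 0 < e1 * s1 / (1 + s1 * c) by rewrite divr_gt0 // mulr_gt0.
have := small_and sS (small_and (small_pos al ltr01)
  (small_pos (e1 * s1 / (1 + s1 * c) * al + be) q0)).
apply: small_imp => e e0 [h1 [h2 h3]].
set q := e1 * s1 / (1 + s1 * c) in q0 h3.
(* [m] and [k] come from comparing the coefficients of [x] and [v] in [zE]. *)
pose m := (1 + e * al) / (1 + s1 * c).
have m0 : 0 < m by rewrite divr_gt0.
pose k := - (e * be) / (m * s1).
have k0 : 0 < k.
  have h : 0 < - (e * be) by rewrite oppr_gt0 pmulr_rlt0.
  exact: divr_gt0 h (mulr_gt0 m0 s10).
have ke : k <= e1.
  rewrite ler_pdivrMr; last exact: mulr_gt0 m0 s10.
  have -> : e1 * (m * s1) = q * (1 + e * al) by rewrite /m /q; ring.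
  by lra.
have zE : x + e *: w = m *: (x + s1 *: (u + k *: (- v))).
  have mn : m != 0 by rewrite gt_eqF.
  have sn : s1 != 0 by rewrite gt_eqF.
  have dn : 1 + s1 * c != 0 by rewrite gt_eqF.
  have mE : m * (1 + s1 * c) = 1 + e * al by rewrite /m divfK.
  have kE : m * (s1 * k) = - (e * be).
    by rewrite mulrA /k mulrC divfK // mulf_neq0.
  transitivity ((m * (1 + s1 * c)) *: x - (m * (s1 * k)) *: v).
    by rewrite mE kE wE; apply: vecP; rewrite !vE; ring.
  by rewrite uE; apply: vecP; rewrite !vE; ring.
have [_ _ [b1 b2] _ _] := hB s1 k s10 (ltW s1e) k0 ke.
split; [exact: sh_edge sh|exact: sh_cross sh| |by []|exact: sL].
by rewrite zE wtaZ wtbZ; split; apply: (mulr_ge0 (ltW m0)).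
Qed.

Lemma shadow_visible_neg a b x u v w : shadow a b x u v -> 1 < wt a b x ->
  (0 < wta a b x /\ 0 < wtb a b x) \/ hgt t 0 = 0 ->
  small (fun e => vpart t (x + e *: w)) -> cross u w != 0 -> Lf a b w < 0.
Proof.
move=> sh S1 alt vw D0; have [//|Lw|Lw] := ltgtP (Lf a b w) 0.
  have [e e0 [h1 [ty vy]]] := small_ex (small_and (shadow_halfdisc sh S1 alt Lw) vw).
  by case: (blocks_not_vis h1).
by have := sh_Lv sh; rewrite (Lf_kernel v (sh_Lu sh) Lw D0) ltxx.
Qed.

Lemma along_epos a b (k : R) x u : along a b k x u -> exists2 c, 0 < c &
  forall e, x + e *: u = epos a b (k + e * c).
Proof.
move=> [ab _ -> _ [c c0 ->]]; exists c => // e.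
by apply: vecP; rewrite /epos !vE; ring.
Qed.

Lemma along_right a b (k : R) x u : along a b k x u ->
  small (fun e => vpart t (x + e *: u)) -> small (fun e => evis a b (k + e)).
Proof.
move=> al; have [c c0 hc] := along_epos al; move: al => [ab [at_ bt] _ _ _].
move=> /(small_scale c0); apply: small_imp => e e0.
rewrite hc divfK ?gt_eqF // => -[_]; by rewrite hgt_epos.
Qed.

Lemma along_along a b (k : R) a' b' (k' : R) x u u' : along a b k x u ->
  along a' b' k' x u' -> 0 < k -> 0 < k' -> cross u u' = 0.
Proof.
move=> [ab [at_ bt] xE /andP[_ k1] [c c0 ->]] [ab' [at' bt'] xE' /andP[_ k1'] [c' c0' ->]] k0 k0'.
have k01 : 0 < k < 1 by rewrite k0.
have k01' : 0 <= k' <= 1 by rewrite !ltW.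
have e : epos a b k = epos a' b' k' by rewrite -xE -xE'.
case: (same_edge tT tT at_ bt ab at' bt' ab' k01 k01' e) => -[-> ->];
  rewrite /cross !vE; ring.
Qed.

Lemma ph_same_edge a b a' b' (k : R) : cross (pos a') (pos b') != 0 ->
  (a = a' /\ b = b') \/ (a = b' /\ b = a') -> ph a' b' (epos a b k) = ehgt a b k.
Proof.
move=> D0 [[-> ->]|[-> ->]]; first exact: ph_epos.
rewrite ph_sym ph_epos // crossC oppr_eq0 //.
Qed.

(** The visible direction [u1] leads to the unhidden side of the shadow, so its opposite leads to
    the hidden side. *)
Lemma along_shadow a1 b1 (k : R) x u1 a2 b2 u2 v2 : along a1 b1 k x u1 -> 0 < k ->
  shadow a2 b2 x u2 v2 -> cross u2 u1 != 0 ->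
  small (fun e => vpart t (x + e *: u1)) ->
  (0 < wta a2 b2 x /\ 0 < wtb a2 b2 x) \/ hgt t 0 = 0 ->
  small (fun e => ~ evis a1 b1 (k - e)).
Proof.
move=> al k0 sh D0 v1 alt; have [c c0 hc] := along_epos al.
move: al => [ab [at_ bt] xE /andP[_ k1] _].
have [[ab2 [s sT [as_ bs]]] D2] := (sh_edge sh, sh_cross sh).
(* If the second edge passed through [x], it would be the first edge by [same_edge]; its plane would
   meet that of [t] in the two directions [u1] and [u2]. *)
have S1 : 1 < wt a2 b2 x.
  have := sh_wt sh; rewrite le_eqVlt => /orP[/eqP S1|//]; exfalso.
  have xE2 := wt_on_edge D2 (esym S1).
  have k01 : 0 < k < 1 by rewrite k0.
  have k01' : 0 <= wtb a2 b2 x <= 1.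
    by rewrite (sh_wtb sh); have := sh_wta sh; lra.
  have e : epos a1 b1 k = epos a2 b2 (wtb a2 b2 x) by rewrite -xE -xE2.
  have se := same_edge sT tT at_ bt ab as_ bs ab2 k01 k01' e.
  have Lu : Lf a2 b2 u1 = 0.
    have := ell_line 1 u1 (sh_Lx sh); rewrite hc ph_same_edge // hgt_epos // subrr.
    by rewrite mul1r.
  by have := sh_Lv sh; rewrite (Lf_kernel v2 (sh_Lu sh) Lu D0) ltxx.
have Ln := shadow_visible_neg sh S1 alt v1 D0.
have Lp : 0 < Lf a2 b2 (- u1) by rewrite -scaleN1r LfZ; lra.
have := small_scale c0 (shadow_halfdisc sh S1 alt Lp).
apply: small_imp => e e0; rewrite scalerN -scaleNr hc mulNr divfK ?gt_eqF //.
by rewrite hgt_epos // => /blocks_not_vis.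
Qed.

Section Oriented.
Variables (a b : 'I_n) (x u v : 'rV[R]_2).
Hypotheses (sh : shadow a b x u v) (or : 0 < cross x u / cross (pos a) (pos b)).

(** The parameter at which the line of sight to [x] crosses the edge. By [or] it increases in the
    direction [u]. *)
Definition shk := wtb a b x / wt a b x.

Lemma wt_gt0 : 0 < wt a b x.
Proof. by rewrite (lt_le_trans ltr01) //; exact: sh_wt sh. Qed.

Lemma shk_epos : x = wt a b x *: epos a b shk.
Proof.
have w0 := wt_gt0; have wn : wt a b x != 0 by rewrite gt_eqF.
rewrite {1}(wtE x (sh_cross sh)) /epos scalerDr !scalerA.
have kE : wt a b x * shk = wtb a b x by rewrite /shk mulrC divfK.
by congr (_ *: _ + _ *: _); rewrite ?mulrBr ?mulr1 kE // /wt addrK.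
Qed.

Lemma shadow_param (s0 : R) : 0 < s0 -> small (fun e => exists s, exists2 m,
  [/\ 0 < s, s < s0 & m = wt a b (x + s *: u)] & x + s *: u = m *: epos a b (shk + e)).
Proof.
move=> s00; have S0 := wt_gt0; have Sn : wt a b x != 0 by rewrite gt_eqF.
have D0 := sh_cross sh.
pose dl := wtb a b u - shk * wt a b u.
have dl0 : 0 < dl.
  have -> : dl = (cross x u / cross (pos a) (pos b)) / wt a b x.
    have kE : shk * wt a b x = wtb a b x by rewrite /shk divfK.
    apply: (mulIf Sn); rewrite divfK //.
    transitivity (wtb a b u * wt a b x - (shk * wt a b x) * wt a b u).
      by rewrite /dl; ring.
    rewrite kE /wt /wta /wtb; move: D0; rewrite /cross => D0; by field.
  exact: divr_gt0.
have h0 : 0 < s0 * dl by rewrite mulr_gt0.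
have := small_and (small_pos (- wt a b u) dl0)
  (small_pos (- (s0 * wt a b u) - wt a b x) h0).
apply: small_imp => e e0 [h1 h2].
have dn : dl + e * - wt a b u != 0 by rewrite gt_eqF.
(* The solution of [wtb a b (x + s *: u) = (shk + e) * wt a b (x + s *: u)]. *)
pose s := e * wt a b x / (dl + e * - wt a b u).
have sp : 0 < s by rewrite divr_gt0 // mulr_gt0.
exists s, (wt a b (x + s *: u)); first split=> //.
  by rewrite ltr_pdivrMr //; lra.
set y := x + s *: u.
have yw : wtb a b y = wt a b y * (shk + e).
  rewrite /y wtbD wtbZ wtD wtZ.
  have sE : s * (dl + e * - wt a b u) = e * wt a b x by rewrite /s divfK.
  have kE : wt a b x * shk = wtb a b x by rewrite /shk mulrC divfK.
  move: sE; rewrite /dl => sE.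
  transitivity (wt a b x * shk + s * wtb a b u); first by rewrite kE.
  by apply/eqP; rewrite -subr_eq0; apply/eqP; lra.
have ya : wta a b y = wt a b y * (1 - (shk + e)).
  by rewrite mulrBr mulr1 -yw /wt addrK.
by rewrite {1}(wtE y D0) ya yw /epos scalerDr !scalerA.
Qed.

(* [t] is the triangle on which the part of the edge [a b] just after the
   parameter [k] casts its shadow. *)
Definition casts (k : R) := small (fun e => exists m, [/\ 1 < m,
  vpart t (m *: epos a b (k + e)),
  forall i, i \in t -> 0 < bc t i (m *: epos a b (k + e)) &
  hgt t (m *: epos a b (k + e)) = m * ehgt a b (k + e)]).

Lemma shadow_casts : casts shk.
Proof.
have [s1 s10 hs] := sh_ray sh.
apply: small_imp (shadow_param s10) => e e0 [s [m [sp ss mE] yE]].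
have [|h1 h2 h3 h4 h5] := hs s; first by rewrite sp.
exists m; rewrite -yE; split=> //; first by rewrite mE.
by rewrite -h5 yE phZ ph_epos //; exact: sh_cross sh.
Qed.

(** The point of the edge lies on the line of sight to a visible point of the terrain. *)
Lemma casts_evis k : casts k -> small (fun e => evis a b (k + e)).
Proof.
apply: small_imp => e e0 [m [m1 [_ vm] _ hm]] s l sT /andP[l0 l1] sl.
have m0 : 0 < m by lra.
have lm : 0 <= l / m <= 1.
  by rewrite divr_ge0 ?(ltW m0) //= ler_pdivrMr // mul1r; lra.
have := vm s (l / m) sT lm; rewrite scalerA divfK ?gt_eqF // => /(_ sl).
by rewrite hm mulrA divfK ?gt_eqF.
Qed.

Lemma shk_lt1 : 0 <= shk < 1.
Proof.
have S0 := wt_gt0; rewrite divr_ge0 ?(sh_wtb sh) ?(ltW S0) //=.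
have [s1 s10 hs] := sh_ray sh.
have [e e0 [s [m [sp ss mE] yE]]] := small_ex (shadow_param s10).
have [|_ _ [h3 h3'] h4 _] := hs s; first by rewrite sp.
have m0 : 0 < m by rewrite mE /wt; lra.
have D0 := sh_cross sh.
have := h3; rewrite yE wtaZ wta_epos // pmulr_rge0 //.
by lra.
Qed.

Lemma shk_pos : 0 < shk -> 0 < wta a b x /\ 0 < wtb a b x.
Proof.
move=> k0; have S0 := wt_gt0; have D0 := sh_cross sh.
have /andP[_ k1] := shk_lt1.
have -> : wta a b x = wt a b x * (1 - shk) by rewrite {1}shk_epos wtaZ wta_epos.
have -> : wtb a b x = wt a b x * shk by rewrite {1}shk_epos wtbZ wtb_epos.
by split; apply: mulr_gt0 => //; rewrite subr_gt0.
Qed.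

End Oriented.

(** A larger [wt] means a nearer edge, so [a2 b2] is the farther one. Its shadow is visible beyond
    [x], hence on the unhidden side of the first shadow. Before that, the second edge is below the
    plane of the first, which blocks it. *)
Lemma shadow_shadow a1 b1 u1 v1 a2 b2 u2 v2 x :
  shadow a1 b1 x u1 v1 -> 0 < cross x u1 / cross (pos a1) (pos b1) ->
  shadow a2 b2 x u2 v2 -> 0 < cross x u2 / cross (pos a2) (pos b2) ->
  cross u1 u2 != 0 -> 0 < shk a1 b1 x -> 0 < shk a2 b2 x ->
  wt a2 b2 x <= wt a1 b1 x ->
  small (fun e => ~ evis a2 b2 (shk a2 b2 x - e)).
Proof.
move=> sh1 or1 sh2 or2 D0 k1 k2 le.
have [wa1 wb1] := shk_pos sh1 or1 k1.
have S2 := wt_gt0 sh2; have S1 := wt_gt0 sh1.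
have D1 := sh_cross sh1; have D2 := sh_cross sh2.
have xE1 := shk_epos sh1; have xE2 := shk_epos sh2.
(* Equality would give the edges a common interior point, hence make them equal, and their shadows
   would be parallel. *)
have lt : wt a2 b2 x < wt a1 b1 x.
  rewrite lt_neqAle le andbT; apply/negP => /eqP e.
  have [[ab2 [s sT [as_ bs]]] [ab1 [s1 s1T [as1 bs1]]]] := (sh_edge sh2, sh_edge sh1).
  have /andP[_ k11] := shk_lt1 sh1 or1; have /andP[_ k21] := shk_lt1 sh2 or2.
  have ee : epos a1 b1 (shk a1 b1 x) = epos a2 b2 (shk a2 b2 x).
    by apply: (scalerI (lt0r_neq0 S1)); rewrite -xE1 -e -xE2.
  have k1' : 0 < shk a1 b1 x < 1 by rewrite k1.
  have k2' : 0 <= shk a2 b2 x <= 1 by rewrite !ltW.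
  have se := same_edge sT s1T as1 bs1 ab1 as_ bs ab2 k1' k2' ee.
  have phE y : ph a1 b1 y = ph a2 b2 y.
    by case: se => -[-> ->] //; rewrite ph_sym.
  have LE y : Lf a1 b1 y = Lf a2 b2 y by rewrite /Lf phE.
  have := sh_Lv sh1; rewrite (Lf_kernel v1 (sh_Lu sh1) _ D0) ?ltxx //.
  by rewrite LE; exact: sh_Lu sh2.
have S1gt : 1 < wt a1 b1 x by rewrite (le_lt_trans _ lt) //; exact: sh_wt sh2.
have vis2 : small (fun e => vpart t (x + e *: u2)).
  by apply: small_imp (sh_ray sh2) => s s0 [].
have Ln := shadow_visible_neg sh1 S1gt (or_introl (conj wa1 wb1)) vis2 D0.
pose w := pos b2 - pos a2.
have Dn : cross x u2 != 0.
  by apply: contraTneq or2 => ->; rewrite mul0r ltxx.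
have crw : cross x w = wt a2 b2 x * cross (pos a2) (pos b2).
  by rewrite {1}xE2 /w /epos /cross !vE; ring.
pose be := cross x w / cross x u2.
have be0 : 0 < be.
  rewrite /be crw -mulrA pmulr_rgt0 //.
  by rewrite -invf_div invr_gt0.
(* The edge direction [w] combines [x], over which the two planes agree, with [u2], taken with the
   positive coefficient [be]. *)
have phw : ph a1 b1 w - ph a2 b2 w < 0.
  have -> : ph a1 b1 w - ph a2 b2 w = Lf a1 b1 w - Lf a2 b2 w by rewrite /Lf; ring.
  have wE := cramer w Dn; rewrite -/be in wE.
  rewrite wE !LfD !LfZ (sh_Lx sh1) (sh_Lx sh2) (sh_Lu sh2).
  have : be * Lf a1 b1 u2 < 0 by rewrite pmulr_rlt0.
  by lra.
have S2n : wt a2 b2 x != 0 by rewrite gt_eqF.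
have yE (e : R) : epos a2 b2 (shk a2 b2 x - e) = (wt a2 b2 x)^-1 *: x + e *: (- w).
  rewrite {3}xE2 scalerA mulVf // scale1r.
  by apply: vecP; rewrite /w /epos !vE; ring.
have i0 : 0 < (wt a2 b2 x)^-1 by rewrite invr_gt0.
have h1 : 0 < (wt a2 b2 x)^-1 * wta a1 b1 x by rewrite mulr_gt0.
have h2 : 0 < (wt a2 b2 x)^-1 * wtb a1 b1 x by rewrite mulr_gt0.
have h3 : 0 < (wt a2 b2 x)^-1 * wt a1 b1 x - 1.
  by rewrite subr_gt0 mulrC ltr_pdivlMr // mul1r.
have := small_and (small_and (small_pos (wta a1 b1 (- w)) h1)
  (small_pos (wtb a1 b1 (- w)) h2)) (small_pos (wt a1 b1 (- w)) h3).
apply: small_imp => e e0 [[g1 g2] g3].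
apply: (@blocks_not_vis _ _ _ _ a1 b1); split=> //.
- exact: sh_edge sh1.
- by rewrite yE wtaD wtbD !wtaZ !wtbZ !ltW.
- by rewrite yE -/(wt a1 b1 _) wtD !wtZ; lra.
- rewrite -(ph_epos _ D2) yE !phD !phZ.
  have ph0 : ph a1 b1 x = ph a2 b2 x.
    by have := sh_Lx sh1; have := sh_Lx sh2; rewrite /Lf; lra.
  have phN (c d : 'I_n) : ph c d (- w) = - ph c d w by rewrite -scaleN1r phZ mulN1r.
  rewrite ph0 ltrD2l !phN.
  have : e * (ph a1 b1 w - ph a2 b2 w) < 0 by rewrite pmulr_rlt0.
  by lra.
Qed.

End OneTriangle.
End KeyLemma.

(** * Charging each vertex to a germ that determines it *)

Section Keys.
Variables (R : realType) (n : nat) (T : terrain R n) (p : 'rV[R]_3).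
Hypothesis above : on_or_above T p.
Implicit Types (a b i : 'I_n) (u v w x y d : 'rV[R]_2) (C : set 'rV[R]_2).

Local Notation pos := (pos T p).
Local Notation inT := (inT T p).
Local Notation bc := (bc T p).
Local Notation hgt := (hgt T p).
Local Notation epos := (epos T p).
Local Notation ehgt := (ehgt T p).
Local Notation vpart := (vpart T p).
Local Notation evis := (evis T p).
Local Notation germ := (germ T p).
Local Notation Lf := (Lf T p).
Local Notation shadow := (shadow T p).
Local Notation along := (along T p).
Local Notation wt := (wt T p).
Local Notation shk := (shk T p).

(* The boundary direction charged at [x]: either it runs along the edge [a b] of
   [t] from its point of parameter [k] (case [e]), or it is the shadow of [a b],
   with [x] behind the point of parameter [k]. *)
Definition keyed t C (e : bool) a b (k : R) x := exists u v,
  [/\ thin C x u v, cross u v != 0, germ a b k &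
  if e then along t a b k x u else
  [/\ shadow t a b x u v, 0 < cross x u / cross (pos a) (pos b), k = shk a b x &
   hgt t 0 < 0]].

Lemma shadow_orient t a b x u v : t \in tri T -> shadow t a b x u v ->
  hgt t 0 < 0 -> exists a' b', shadow t a' b' x u v /\
    0 < cross x u / cross (pos a') (pos b').
Proof.
move=> tT sh h0; have D := shadow_nonradial tT sh h0.
have Dab := sh_cross sh.
have [lt|lt|/eqP] := ltgtP 0 (cross x u / cross (pos a) (pos b)).
- by exists a, b.
- exists b, a; split; first exact: shadow_sym.
  by rewrite [cross (pos b) _]crossC invrN mulrN oppr_gt0.
- by rewrite eq_sym mulf_eq0 invr_eq0 (negbTE D) (negbTE Dab).
Qed.

Section OneTriangle.
Variables (t : {set 'I_n}) (tT : t \in tri T) (C : set 'rV[R]_2).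
Hypothesis CV : C `<=` [set y | vpart t y].
Local Notation V := [set y | vpart t y].

Definition has_key x := exists e a b k, keyed t C e a b k x /\
  exists2 s, s \in tri T & [/\ a \in s, b \in s & e -> s = t].

Lemma along_key a b (k : R) x u v : along t a b k x u -> thin C x u v ->
  cross u v != 0 -> k = 0 \/ small (fun e => ~ evis a b (k - e)) -> has_key x.
Proof.
move=> al th D0 lf; exists true, a, b, k.
have [ab [at_ bt] xE k01 _] := al.
split; last by exists t.
exists u, v; split=> //; apply: mk_germ => //.
by apply: along_right al _ => //; exact: bray_ray CV th.
Qed.

Lemma shadow_key a b x u v : shadow t a b x u v -> thin C x u v ->
  0 < cross x u / cross (pos a) (pos b) -> hgt t 0 < 0 ->
  shk a b x = 0 \/ small (fun e => ~ evis a b (shk a b x - e)) -> has_key x.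
Proof.
move=> sh th or h0 lf; exists false, a, b, (shk a b x).
have [_ [s sT [as_ bs]]] := sh_edge sh.
split; last by exists s.
exists u, v; split=> //; first exact: sh_uv sh.
apply: mk_germ => //; first exact: shk_lt1 sh or.
exact: casts_evis (shadow_casts sh or).
Qed.

(** The side of [t] is charged, as the shadow hides it just before [x]. The exception is a shadow
    cast from an endpoint of its edge, where that edge has a germ at parameter 0. *)
Lemma mixed_key a1 b1 (k : R) a2 b2 x u1 v1 u2 v2 : along t a1 b1 k x u1 ->
  thin C x u1 v1 -> cross u1 v1 != 0 -> shadow t a2 b2 x u2 v2 ->
  thin C x u2 v2 -> cross u1 u2 != 0 -> has_key x.
Proof.
move=> al th1 D1 sh th2 D.
have D' : cross u2 u1 != 0 by rewrite crossC oppr_eq0.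
have vis1 := bray_ray above tT CV th1.
have [k0|k0] := eqVneq k 0; first by apply: (along_key al th1 D1); left.
have kp : 0 < k by have [_ _ _ /andP[kp _] _] := al; rewrite lt_def k0.
have [h0|h0] := eqVneq (hgt t 0) 0.
  apply: (along_key al th1 D1); right.
  by apply: (along_shadow tT al kp sh D' vis1); right.
have hn : hgt t 0 < 0 by rewrite lt_neqAle h0; exact: sh_hgt0 sh.
have [a [b [sh' or]]] := shadow_orient tT sh hn.
have [s0|s0] := eqVneq (shk a b x) 0; first by apply: (shadow_key sh' th2 or hn); left.
have sp : 0 < shk a b x.
  by have /andP[sp _] := shk_lt1 sh' or; rewrite lt_def s0.
apply: (along_key al th1 D1); right.
apply: (along_shadow tT al kp sh' D' vis1); left.
exact: shk_pos sh' or sp.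
Qed.

Lemma key_exists x u1 v1 u2 v2 : bray V C x u1 v1 -> bray V C x u2 v2 ->
  cross u1 u2 != 0 -> has_key x.
Proof.
move=> b1 b2 D; have [D1 th1 _] := b1; have [D2 th2 _] := b2.
have D' : cross u2 u1 != 0 by rewrite crossC oppr_eq0.
have [[a1 [c1 [k1 al1]]]|[a1 [c1 sh1]]] := bray_type above tT CV b1;
  have [[a2 [c2 [k2 al2]]]|[a2 [c2 sh2]]] := bray_type above tT CV b2.
- have [k0|k0] := eqVneq k1 0; first by apply: (along_key al1 th1 D1); left.
  have [k0'|k0'] := eqVneq k2 0; first by apply: (along_key al2 th2 D2); left.
  have kp : 0 < k1 by have [_ _ _ /andP[kp _] _] := al1; rewrite lt_def k0.
  have kp' : 0 < k2 by have [_ _ _ /andP[kp' _] _] := al2; rewrite lt_def k0'.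
  by rewrite (along_along tT al1 al2 kp kp') eqxx in D.
- exact: (mixed_key al1 th1 D1 sh2 th2 D).
- exact: (mixed_key al2 th2 D2 sh1 th1 D').
have [h0|h0] := eqVneq (hgt t 0) 0.
  have x0 : x != 0.
    apply: contraTneq (sh_wt sh1) => ->.
    have := wtZ T p a1 c1 0 (0 : 'rV[R]_2); rewrite /wt scaler0 mul0r => ->.
    by rewrite -ltNge ltr01.
  have [l1 e1] := parallel x0 (shadow_radial tT sh1 h0).
  have [l2 e2] := parallel x0 (shadow_radial tT sh2 h0).
  case/eqP: D; rewrite e1 e2 /cross !vE; ring.
have hn : hgt t 0 < 0 by rewrite lt_neqAle h0; exact: sh_hgt0 sh1.
have {sh1} [{}a1 [{}c1 [sh1 or1]]] := shadow_orient tT sh1 hn.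
have {sh2} [{}a2 [{}c2 [sh2 or2]]] := shadow_orient tT sh2 hn.
have [s1|s1] := eqVneq (shk a1 c1 x) 0; first by apply: (shadow_key sh1 th1 or1 hn); left.
have [s2|s2] := eqVneq (shk a2 c2 x) 0; first by apply: (shadow_key sh2 th2 or2 hn); left.
have sp1 : 0 < shk a1 c1 x.
  by have /andP[sp _] := shk_lt1 sh1 or1; rewrite lt_def s1.
have sp2 : 0 < shk a2 c2 x.
  by have /andP[sp _] := shk_lt1 sh2 or2; rewrite lt_def s2.
have [le|/ltW le] := lerP (wt a2 c2 x) (wt a1 c1 x).
  apply: (shadow_key sh2 th2 or2 hn); right.
  exact: (shadow_shadow tT sh1 or1 sh2 or2 D sp1 sp2 le).
apply: (shadow_key sh1 th1 or1 hn); right.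
exact: (shadow_shadow tT sh2 or2 sh1 or1 D' sp2 sp1 le).
Qed.

End OneTriangle.

Lemma thin_same_side C x (g : 'rV[R]_2) u v u' v' (c : R) : 0 < c -> u = c *: u' ->
  dot g u' = 0 -> 0 < dot g v -> 0 < dot g v' -> cross u' v' != 0 ->
  thin C x u' v' -> thin C x u v.
Proof.
move=> c0 -> gu gv gv' D th; have vD := cramer v D.
set al := cross v v' / _ in vD; set be := cross u' v / _ in vD.
have be0 : 0 < be.
  have e : dot g v = be * dot g v'.
    rewrite {1}vD; transitivity (al * dot g u' + be * dot g v').
      by rewrite !dotE !vE; ring.
    by rewrite gu mulr0 add0r.
  by move: gv; rewrite e pmulr_lgt0.
by rewrite vD; apply: thin_change.
Qed.

(** Both sectors lie along the same side of [t] and inside [t], so they overlap. The functional [g]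
    that shows this is the linear part of the weight of the third vertex. *)
Lemma keyed_edge_uniq t C C' a b (k : R) x x' : t \in tri T ->
  C `<=` [set y | vpart t y] -> C' `<=` [set y | vpart t y] ->
  keyed t C true a b k x -> keyed t C' true a b k x' ->
  x = x' /\ exists2 y, C y & C' y.
Proof.
move=> tT CV CV' [u [v [th D _ al]]] [u' [v' [th' D' _ al']]].
have [ab [at_ bt] xE k01 [c c0 uE]] := al.
have [_ _ xE' _ [c' c0' uE']] := al'.
have xx : x = x' by rewrite xE xE'.
split=> //; rewrite -xx in th'.
have [i [it ia ib]] : exists i, [/\ i \in t, i != a & i != b].
  have : ~~ (t \subset [set a; b]%SET).
    by apply/negP => /subset_leq_card; rewrite (tri_card tT) cards2 ab.
  move=> /fintype.subsetPn[i it]; rewrite !inE negb_or => /andP[ia ib].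
  by exists i.
have [g [h bE]] := bc_affine p tT i.
have gw : dot g (pos b - pos a) = 0.
  have := inT_pos p tT at_ i; have := inT_pos p tT bt i.
  rewrite !bE (negbTE ia) (negbTE ib) !dotE !vE; lra.
have bx : dot g x + h = 0.
  by rewrite -bE xE bc_epos // (negbTE ia) (negbTE ib) !mulr0 addr0.
have key D1 u1 v1 (c1 : R) : D1 `<=` [set y | vpart t y] -> thin D1 x u1 v1 ->
    cross u1 v1 != 0 -> u1 = c1 *: (pos b - pos a) -> dot g u1 = 0 /\ 0 < dot g v1.
  move=> DV th1 Duv u1E.
  have gu : dot g u1 = 0.
    rewrite u1E; transitivity (c1 * dot g (pos b - pos a)); last by rewrite gw mulr0.
    by rewrite !dotE !vE; ring.
  split=> //; have [e e0 he] := small_ex th1.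
  have [/(_ i) ge _] := DV _ (he e e e0 (lexx _) e0 (lexx _)).
  have e2 : 0 < e * e by rewrite mulr_gt0.
  have gv0 : 0 <= dot g v1.
    rewrite -(pmulr_rge0 _ e2).
    have -> : e * e * dot g v1 = bc t i (x + e *: (u1 + e *: v1)) - (dot g x + h) - e * dot g u1.
      by rewrite bE !dotE !vE; ring.
    by rewrite bx gu mulr0 !subr0.
  rewrite lt_def gv0 andbT; apply/eqP => gv.
  have g0 w : dot g w = 0.
    have wE := cramer w Duv; rewrite wE.
    set m1 := cross w v1 / _; set m2 := cross u1 w / _.
    transitivity (m1 * dot g u1 + m2 * dot g v1); first by rewrite !dotE !vE; ring.
    by rewrite gu gv !mulr0 addr0.
  have := inT_pos p tT it i; have := inT_pos p tT at_ i.
  rewrite !bE !g0 eqxx (negbTE ia) => -> /eqP; by rewrite eq_sym oner_eq0.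
have [gu gv] := key C u v c CV th D uE.
have [gu' gv'] := key C' u' v' c' CV' th' D' uE'.
have cc : 0 < c / c' by rewrite divr_gt0.
have uu : u = (c / c') *: u' by rewrite uE' scalerA divfK ?gt_eqF.
have th2 := thin_same_side cc uu gu' gv gv' D' th'.
by have [s [l [_ _ h1 h2]]] := thin_and th th2; exists (x + s *: (u + l *: v)).
Qed.

(** The viewpoint is strictly above the plane of [t], so behind the nearer point the line of sight
    runs below [t], and the farther point is hidden. *)
Lemma casts_le t t' a b (k m m' : R) : t \in tri T -> hgt t 0 < 0 -> 0 < m ->
  m < m' -> (forall i, i \in t -> 0 < bc t i (m *: epos a b k)) ->
  hgt t (m *: epos a b k) = m * ehgt a b k ->
  vpart t' (m' *: epos a b k) ->
  hgt t' (m' *: epos a b k) = m' * ehgt a b k -> False.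
Proof.
move=> tT h0 m0 mm it ht [_ vm] ht'.
set y := epos a b k in it ht vm ht'; set h := ehgt a b k in ht ht'.
have m0' : 0 < m' by lra.
have sm : small (fun e => forall i, i \in t -> 0 < bc t i (m *: y + e *: (m *: y))).
  apply: small_all => i; case: (boolP (i \in t)) => ti; last by apply: smallT.
  have := small_pos (bc t i (m *: y + m *: y) - bc t i (m *: y)) (it i ti).
  by apply: small_imp => e e0 he _; rewrite affine_line //; exact: bc_affine.
have mm' : 0 < m' - m by rewrite subr_gt0.
have [e e0 [h1 h2]] := small_ex (small_and sm (small_pos (- m) mm')).
have l01 : 0 <= (1 + e) * m / m' <= 1.
  rewrite divr_ge0 ?(ltW m0') //=; last by apply: mulr_ge0; [lra|exact: ltW].
  by rewrite ler_pdivrMr // mul1r; lra.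
have := vm t _ tT l01; rewrite scalerA divfK ?gt_eqF //.
have zE : ((1 + e) * m) *: y = m *: y + e *: (m *: y).
  by rewrite mulrDl mul1r scalerDl -scalerA.
have tz : inT t (((1 + e) * m) *: y).
  rewrite zE => i; case: (boolP (i \in t)) => ti; first exact/ltW/h1.
  by rewrite bc_out.
move=> /(_ tz); rewrite ht' mulrA divfK ?gt_eqF //.
rewrite -scalerA (affine_scale _ _ (hgt_affine p tT)) ht.
have : 0 < e * - hgt t 0 by rewrite mulr_gt0 // oppr_gt0.
by lra.
Qed.

(** By [casts_le] the shadow just after the germ falls on one triangle. Both sectors then lie along
    one half-line, on the side where [Lf] is negative. *)
Lemma keyed_shadow_uniq t t' C C' a b (k : R) x x' : t \in tri T -> t' \in tri T ->
  keyed t C false a b k x -> keyed t' C' false a b k x' ->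
  [/\ t = t', x = x' & exists2 y, C y & C' y].
Proof.
move=> tT tT' [u [v [th D _ [sh or kE h0]]]] [u' [v' [th' D' _ [sh' or' kE' h0']]]].
have c1 := shadow_casts sh or; have c2 := shadow_casts sh' or'.
rewrite -kE in c1; rewrite -kE' in c2.
have tt : t = t'.
  have [e e0 [[m [m1 v1 i1 g1]] [m' [m1' v2 i2 g2]]]] := small_ex (small_and c1 c2).
  have [lt|lt|me] := ltgtP m m'.
  - by case: (casts_le tT h0 _ lt i1 g1 v2 g2); lra.
  - by case: (casts_le tT' h0' _ lt i2 g2 v1 g1); lra.
  - by rewrite -me in i2; exact: inT_interior_uniq tT tT' i1 i2.
subst t'.
have xE := shk_epos sh; have xE' := shk_epos sh'.
rewrite -kE in xE; rewrite -kE' in xE'.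
(* On the line of sight over the parameter [k], the equation [Lf t a b x = hgt t 0] with nonzero
   right side fixes the multiple. *)
have xx : x = x'.
  have := sh_Lx sh; have := sh_Lx sh'; rewrite {1}xE {1}xE' !LfZ // => e1 e2.
  have L0 : Lf t a b (epos a b k) != 0.
    by apply/eqP => L0; move: h0; rewrite -e2 L0 mulr0 ltxx.
  by rewrite xE xE'; congr (_ *: _); apply: (mulIf L0); rewrite e1 e2.
split=> //; rewrite -xx in sh' or' th'.
have u0 : u' != 0 by apply: contra D' => /eqP ->; rewrite cross0l.
have [|c uE] := parallel u0 (v := u).
  apply/eqP; apply: contraT => Du.
  by have := sh_Lv sh; rewrite (Lf_kernel tT v (sh_Lu sh') (sh_Lu sh) Du) ltxx.
have c0 : 0 < c.
  move: or; rewrite uE; have -> : cross x (c *: u') = c * cross x u'.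
    by rewrite /cross !vE; ring.
  by rewrite -mulrA pmulr_lgt0.
have [g gE] := Lf_dot p tT a b.
have gN w : dot (- g) w = - Lf t a b w by rewrite gE !dotE !vE; ring.
have th2 : thin C' x u v.
  apply: (thin_same_side (g := - g) c0 uE _ _ _ D' th'); rewrite gN.
  - by rewrite (sh_Lu sh') oppr0.
  - by rewrite oppr_gt0; exact: sh_Lv sh.
  - by rewrite oppr_gt0; exact: sh_Lv sh'.
by have [s [l [_ _ h1 h2]]] := thin_and th th2; exists (x + s *: (u + l *: v)).
Qed.

End Keys.

(** * Counting the vertices of the viewshed *)

Lemma counting_le (R : realType) (X : choiceType) (K : finType) (A : set X)
    (rep : K -> X -> Prop) :
  (forall u, A u -> exists k, rep k u) ->
  (forall k u u', A u -> A u' -> rep k u -> rep k u' -> u = u') ->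
  (counting A <= (#|K|%:R : R)%:E)%E.
Proof.
move=> ex uq; have [[u0 Au0]|A0] := pselect (A !=set0); last first.
  have -> : A = set0 by apply/seteqP; split=> u //= Au; case: A0; exists u.
  rewrite /counting asboolT; last exact: finite_set0.
  by rewrite fset_set0 cardfs0 lee_fin ler0n.
(* [u0] is the value at keys that represent nothing. *)
pose f k := xget u0 [set u | A u /\ rep k u].
have sub u : A u -> u \in map f (enum K).
  move=> Au; have [k ku] := ex u Au; apply/mapP; exists k; first by rewrite mem_enum.
  by rewrite /f; case: xgetP => [v _ [Av kv]|/(_ u)[]//]; exact: uq Au Av ku kv.
have fA : finite_set A.
  by apply: (@sub_finite_set _ _ [set` map f (enum K)]) => //; exact: finite_seq.
rewrite /counting asboolT // lee_fin ler_nat cardE -(size_map f).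
apply: uniq_leq_size; first exact: fset_uniq.
by move=> u; rewrite in_fset_set // inE; exact: sub.
Qed.

Lemma component_segment (R : realType) (W : set 'rV[R]_2) c x y :
  connected_component W c x ->
  (forall k : R, 0 <= k <= 1 -> W ((1 - k) *: x + k *: y)) ->
  connected_component W c y.
Proof.
move=> cx h; apply: connected_component_trans cx _.
pose g k : 'rV[R]_2 := x + k *: (y - x).
have gE k : g k = (1 - k) *: x + k *: y.
  by apply: vecP; rewrite /g !vE; ring.
have gc : continuous g.
  move=> k; apply: (@cvgD _ _ _ (nbhs k) _ (fun=> x) (fun k : R => k *: (y - x))).
    exact: cvg_cst.
  by apply: cvgZr_tmp; exact: cvg_id.
have co : connected [set g k | k in `[0, 1]].
  apply: connected_continuous_connected; first exact: segment_connected.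
  exact: continuous_subspaceT.
have in01 (k : R) : `[0, 1]%classic k -> 0 <= k <= 1 by rewrite /= in_itv.
apply: (connected_component_max _ _ co).
- by exists 0; rewrite /= ?in_itv /= ?lexx ?ler01 // gE subr0 scale1r scale0r addr0.
- by move=> _ [k /in01 k01 <-]; rewrite gE; exact: h.
- by exists 1; rewrite /= ?in_itv /= ?lexx ?ler01 // gE subrr scale1r scale0r add0r.
Qed.

Section Assembly.
Variables (R : realType) (n : nat) (T : terrain R n) (p : 'rV[R]_3).
Hypothesis above : on_or_above T p.

Local Notation item := ({set 'I_n} * set 'rV[R]_2 * 'rV[R]_2)%type.

Definition shifted (C : set 'rV[R]_2) : set 'rV[R]_2 := [set d | C (xy p + d)].

(** For a shadow, the triangle of [u] is not part of the data: [s] is then any triangle containing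
    the edge, used to name its endpoints. *)
Definition represents (e : bool) (s : {set 'I_n}) a b (k : R) (u : item) :=
  u.1.1 \in tri T /\ (e -> s = u.1.1) /\
  exists2 c, interior (visible_part T p u.1.1) c &
    let C := connected_component (interior (visible_part T p u.1.1)) c in
    u.1.2 = closure C /\ keyed T p u.1.1 (shifted C) e a b k (u.2 - xy p).

Lemma shifted_sub t c : t \in tri T ->
  shifted (connected_component (interior (visible_part T p t)) c) `<=`
  [set d | vpart T p t d].
Proof.
move=> tT d /connected_component_sub/interior_subset/(visible_partE p _ tT).
by rewrite addrC addKr.
Qed.

Lemma represents_uniq e s a b (k : R) u u' : represents e s a b k u ->
  represents e s a b k u' -> u = u'.
Proof.
move: u u' => [[t Q] x] [[t' Q'] x'] [/= tT [es [c cV [-> key]]]].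
move=> [/= tT' [es' [c' cV' [-> key']]]].
have [tt [xx [y Cy Cy']]] : t = t' /\ (x = x' /\
    exists2 y, shifted (connected_component (interior (visible_part T p t)) c) y &
      shifted (connected_component (interior (visible_part T p t')) c') y).
  case: e es es' key key' => es es' key key'.
    have tt : t = t' by rewrite -es // es'.
    subst t'; split=> //.
    have [xx ?] := keyed_edge_uniq tT (shifted_sub tT) (shifted_sub tT) key key'.
    by split=> //; exact: addIr xx.
  have [tt xx ?] := keyed_shadow_uniq tT tT' key key'.
  by split=> //; split=> //; exact: addIr xx.
subst t' x'; congr (_, closure _, _).
rewrite (same_connected_component Cy); apply/esym.
exact: same_connected_component Cy'.
Qed.

Lemma represents_exists t Q x : t \in tri T -> viewshed_polygons T p t Q ->
  polygon_vertex Q x -> exists e a b k s,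
  [/\ s \in tri T, a \in s /\ b \in s, germ T p a b k, edge T a b &
    represents e s a b k (t, Q, x)].
Proof.
move=> tT [c cV <-] [Qx nst].
set V := visible_part T p t in cV nst Qx *.
set C := connected_component (interior V) c in nst Qx *.
pose f j x := vsign T p t j (x - xy p).
have fa j : affine (f j).
  exact: (@affine_sub _ _ (xy p) (vsign_affine p tT j)).
have Vf y z : (forall j, Num.sg (f j y) = Num.sg (f j z)) -> V y -> V z.
  move=> h /(visible_partE p _ tT) Vy; apply/(visible_partE p _ tT).
  exact: (vpart_sign above tT h Vy).
have Vcl : closed V.
  have -> : V = (fun y => y - xy p) @^-1` [set d | vpart T p t d].
    by apply/seteqP; split=> y /(visible_partE p _ tT).
  apply: closed_comp; last exact: (vpart_closed above tT).
  move=> y _; apply: (@cvgB _ _ _ (nbhs y) _ id (fun=> xy p)).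
    exact: cvg_id.
  exact: cvg_cst.
have CV : C `<=` interior V by exact: connected_component_sub.
have Cseg y z : C y ->
    (forall k : R, 0 <= k <= 1 -> interior V ((1 - k) *: y + k *: z)) -> C z.
  exact: component_segment.
have [u1 [v1 [u2 [v2 [b1 b2 D]]]]] := corner fa Vf Vcl CV Cseg Qx nst.
have sh u v : bray V C x u v ->
    bray [set d | vpart T p t d] (shifted C) (x - xy p) u v.
  move=> [D0 h1 h2].
  have e1 w : xy p + (x - xy p + w) = x + w by rewrite addrA [xy p + _]addrC subrK.
  split=> //.
    by apply: small_imp h1 => e e0 h s k s0 se k0 ke; rewrite /shifted /= e1; exact: h.
  apply: small_imp h2 => e e0 h s k s0 se k0 ke; have := h s k s0 se k0 ke.
  apply: contra_not => Vy; apply/(visible_partE p _ tT).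
  by rewrite addrAC.
have [e [a [b [k [key [s sT [as_ bs es]]]]]]] :=
  key_exists above tT (shifted_sub tT (c := c)) (sh _ _ b1) (sh _ _ b2) D.
have [u [v [_ _ g kk]]] := key.
exists e, a, b, k, s; split=> //.
  case: {es key} e kk => [[ab [at_ bt] _ _ _]|[sh' _ _ _]].
    by split=> //; exists t.
  exact: sh_edge sh'.
by split=> //; split=> //; exists c.
Qed.

(** The factors count the kind of boundary direction, the triangle that names the edge, the
    positions of the two endpoints in it, and the germs of the directed edge. *)
Lemma complexity_le : (viewshed_complexity T p <=
  ((2 * ((n * 2) * (3 * (3 * (prickliness T).+1))))%N%:R : R)%:E)%E.
Proof.
have [t0 t0T _] := dom0 above.
have [i0 _] := set3P (tri_card t0T).
have /choice[g gP] : forall ab : 'I_n * 'I_n, exists g : 'I_(prickliness T).+1 -> R,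
    edge T ab.1 ab.2 -> forall k, germ T p ab.1 ab.2 k -> exists l, g l = k.
  move=> [a b]; have [h|h] := pselect (edge T a b); last by exists (fun=> 0).
  by have [g gP] := germ_enum above h; exists g.
pose K := (bool * ('I_(n * 2) * ('I_3 * ('I_3 * 'I_(prickliness T).+1))))%type.
pose tr (k : 'I_(n * 2)) := nth finset.set0 (enum (tri T)) k.
pose vt (s : {set 'I_n}) (k : 'I_3) := nth i0 (enum s) k.
pose rep (q : K) (u : item) :=
  let s := tr q.2.1 in let a := vt s q.2.2.1 in let b := vt s q.2.2.2.1 in
  represents q.1 s a b (g (a, b) q.2.2.2.2) u.
have -> : (2 * ((n * 2) * (3 * (3 * (prickliness T).+1))))%N = #|{: K}|.
  by rewrite !card_prod card_bool !card_ord.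
apply: (@counting_le _ _ _ _ rep); last by move=> q u u' _ _; exact: represents_uniq.
move=> [[t Q] x] [/= tT Qt xQ].
have [e [a [b [k [s [sT [as_ bs] gk ab rp]]]]]] := represents_exists tT Qt xQ.
have [l gl] := gP (a, b) ab k gk.
have is_lt : (index s (enum (tri T)) < n * 2)%N.
  by rewrite (leq_trans _ (tri_count T)) // cardE index_mem mem_enum.
have lt3 i : i \in s -> (index i (enum s) < 3)%N.
  by move=> hi; rewrite -(tri_card sT) cardE index_mem mem_enum.
exists (e, (Ordinal is_lt, (Ordinal (lt3 a as_), (Ordinal (lt3 b bs), l)))).
have trE : tr (Ordinal is_lt) = s by rewrite /tr nth_index // mem_enum.
have vtE i (hi : i \in s) : vt s (Ordinal (lt3 i hi)) = i.
  by rewrite /vt nth_index // mem_enum.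
by rewrite /rep /= trE !vtE gl.
Qed.

End Assembly.

(** The maximum with 1 covers prickliness 0, as for a single triangle seen from above, whose
    viewshed still has three vertices. *)
Theorem theorem4 (R : realType) :
  exists C : nat, forall (n : nat) (T : terrain R n) (p : 'rV[R]_3),
    on_or_above T p ->
    (viewshed_complexity T p
       <= ((C * (n * maxn 1 (prickliness T)))%N%:R)%:E)%E.
Proof.
(* The constant is [2 * 2 * 3 * 3 * 2]; the last 2 bounds one more than the prickliness by twice its
   maximum with 1. *)
exists 72%N => n T p above; apply: le_trans (complexity_le above) _.
rewrite lee_fin ler_nat.
have h : ((prickliness T).+1 <= 2 * maxn 1 (prickliness T))%N.
  by rewrite mul2n -addnn -addn1 addnC leq_add ?leq_maxl ?leq_maxr.
have -> : (72 * (n * maxn 1 (prickliness T)) =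
  2 * (n * 2 * (3 * (3 * (2 * maxn 1 (prickliness T))))))%N.
  by ring.
by rewrite !leq_mul2l h !orbT.
Qed.
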